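(* Consider the finite volume--finite element scheme described in the context, with solution $(c_h^m,\theta_h^m,p_h^m,\mathbf u_h^m)_{0\le m\le N}$. There exists a constant $C>0$, depending only on the data of the problem and on the mesh regularity constant (not on $h$, $k$, $m$), such that for every $1\le m\le N$ $$k\sum_{n=1}^m\|c_h^n\|_h^2+k\sum_{n=1}^m\|\theta_h^n\|_h^2\le C,\qquad |\mathbf u_h^m|+|\nabla_hp_h^m|\le C.$$
   Context: **Data.** $\Omega\subset\mathbb R^2$ is a bounded polygonal domain, $T>0$; $|\cdot|$ and $(\cdot,\cdot)$ are the norm and inner product of $L^2=L^2(\Omega)$ and of $\mathbf L^2=(L^2)^2$; $L^2_0=\{v\in L^2:\int_\Omega v=0\}$; $H^1=H^1(\Omega)$. Constants: $D_c,D_\theta,\lambda,\theta_*>0$, $0<\theta_-\le\theta_+$. $\kappa\in W^{1,\infty}((0,1)\times(0,\infty))$ (identified with its Lipschitz representative on the closure) with $\kappa\ge\kappa_{inf}>0$; $s,s_c,s_\theta\in L^2$; $\mathbf f\in\mathcal C(0,T;\mathbf L^2)$ (continuous functions $[0,T]\to\mathbf L^2$); $c_0,\theta_0\in H^1$. Almost everywhere in $\Omega$: $0\le c_0\le1$, $\theta_-\le\theta_0\le\theta_+$, $2s+\lambda\ge s_c\ge0$, $2(\theta_--\theta_* )s+s_\theta\le0$, $2(\theta_+-\theta_* )s+s_\theta\ge0$. **Mesh.** $\mathcal T_h$ is a triangular mesh of $\Omega$ whose triangles have all angles $<\pi/2$; $\mathbf x_K$ is the circumcenter of $K$, $h_K$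 the diameter of its circumscribed circle, $h=\max_Kh_K$. $\mathcal E_K$ is the set of edges of $K$, $\mathcal E_h$ the set of all edges, $\mathcal E_h^{int}$ (resp. $\mathcal E_h^{ext}$) the edges inside $\Omega$ (resp. on $\partial\Omega$); $\mathbf n_{K,\sigma}$ is the unit normal to $\sigma\in\mathcal E_K$ outward to $K$; $\mathbf x_\sigma$ is the midpoint of $\sigma$, $|\sigma|$ its length. For $\sigma\in\mathcal E_h^{int}$, $K_\sigma,L_\sigma$ are the two triangles sharing $\sigma$ (in a sum over edges of $K$, $K_\sigma=K$ and $L_\sigma$ is the neighbor), $d_\sigma=|\mathbf x_{K_\sigma}-\mathbf x_{L_\sigma}|$; for $\sigma\in\mathcal E_h^{ext}$, $K_\sigma$ is the triangle containing $\sigma$ and $d_\sigma=d(\mathbf x_{K_\sigma},\mathbf x_\sigma)$; $\tau_\sigma=|\sigma|/d_\sigma$. There is a constant $C>0$ (independent of $h$; the mesh regularity constant) with $d_\sigma\ge C|\sigma|$ and $|\sigma|\ge Ch$ for all $\sigma\in\mathcal E_h$. **Discrete spaces.** $P_0$: functions constant on each triangle, $q_K=q|_K$; $\mathbf P_0=(P_0)^2$; for $q_h\in P_0$, $\|q_h\|_h=\big(\sum_{\sigma\in\mathcal E_h^{int}}\tau_\sigma(q_{L_\sigma}-q_{K_\sigma})^2\big)^{1/2}$. $P_1^{nc}$: functions affine on each triangle and continuous at midpoints of interior edges. $\mathbf{RT_0}$: vector fields $\mathbf v_h$, affine on each triangle, such that $\mathbf v_h|_K\cdot\mathbf n_{K,\sigma}$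 is constant on each edge $\sigma\in\mathcal E_K$ (denoted $(\mathbf v_h\cdot\mathbf n_{K,\sigma})_\sigma$), normal components are continuous across interior edges, and $\mathbf v_h\cdot\mathbf n=0$ on $\partial\Omega$. $\Pi_{P_0}$, $\Pi_{\mathbf P_0}$, $\widetilde\Pi_{P_1^{nc}}$, $\widetilde\Pi_{\mathbf{RT_0}}$ are the $L^2$-orthogonal projections onto $P_0,\mathbf P_0,P_1^{nc},\mathbf{RT_0}$. **Discrete operators.** $\nabla_h:P_1^{nc}\to\mathbf P_0$ is the elementwise gradient. $\mathrm{div}_h:\mathbf P_0\to P_1^{nc}$: $(\mathrm{div}_h\mathbf v_h)(\mathbf x_\sigma)=\frac{3|\sigma|}{|K_\sigma|+|L_\sigma|}(\mathbf v_{L_\sigma}-\mathbf v_{K_\sigma})\cdot\mathbf n_{K_\sigma,\sigma}$ for $\sigma\in\mathcal E_h^{int}$, $(\mathrm{div}_h\mathbf v_h)(\mathbf x_\sigma)=-\frac{3|\sigma|}{|K_\sigma|}\mathbf v_{K_\sigma}\cdot\mathbf n_{K_\sigma,\sigma}$ for $\sigma\in\mathcal E_h^{ext}$. $\Delta_h:P_0\to P_0$: $\Delta_hq_h|_K=\frac1{|K|}\sum_{\sigma\in\mathcal E_K\cap\mathcal E_h^{int}}\tau_\sigma(q_{L_\sigma}-q_K)$. $\widetilde{\mathrm b}_h:\mathbf{RT_0}\times P_0\to P_0$: $\widetilde{\mathrm b}_h(\mathbf v_h,q_h)|_K=\frac1{|K|}\sum_{\sigma\in\mathcal E_K\cap\mathcal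 E_h^{int}}|\sigma|\big((\mathbf v_h\cdot\mathbf n_{K,\sigma})_\sigma^+q_K+(\mathbf v_h\cdot\mathbf n_{K,\sigma})_\sigma^-q_{L_\sigma}\big)$, with $a^+=\max(a,0)$, $a^-=\min(a,0)$. **Scheme.** $k=T/N$, $t_m=mk$; $s_h=\Pi_{P_0}s$, $s_h^c=\Pi_{P_0}s_c$, $s_h^\theta=\Pi_{P_0}s_\theta$, $\mathbf f_h^m=\Pi_{\mathbf P_0}\mathbf f(t_m)$. Initially $c_h^0=\Pi_{P_0}c_0$, $\theta_h^0=\Pi_{P_0}\theta_0$. For $n=0,\dots,N-1$, $c_h^{n+1},\theta_h^{n+1}\in P_0$ solve $$\tfrac{c_h^{n+1}-c_h^n}{k}-D_c\Delta_hc_h^{n+1}=s_h^c-(s_h+\lambda)c_h^{n+1}-\widetilde{\mathrm b}_h(\mathbf u_h^n,c_h^{n+1}),$$ $$\tfrac{\theta_h^{n+1}-\theta_h^n}{k}-D_\theta\Delta_h\theta_h^{n+1}=-s_h^\theta-s_h(\theta_h^{n+1}-\theta_* )-\widetilde{\mathrm b}_h(\mathbf u_h^n,\theta_h^{n+1}),$$ and then, for $m=n+1$, $p_h^m\in P_1^{nc}\cap L_0^2$ and $\mathbf u_h^m\in\mathbf{RT_0}$ solve $$\mathrm{div}_h(\kappa_h^m\nabla_hp_h^m)=\mathrm{div}_h\mathbf f_h^m-\widetilde\Pi_{P_1^{nc}}s_h,\qquad \mathbf u_h^m=\widetilde\Pi_{\mathbf{RT_0}}(\mathbf f_h^m-\kappa_h^m\nabla_hp_h^m),$$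 with $\kappa_h^m=\kappa(c_h^m,\theta_h^m)\in P_0$. The initial pair $p_h^0,\mathbf u_h^0$ is given by the same two relations with $m=0$. (The evaluation of $\kappa$ is meaningful because the scheme satisfies the maximum principle $0\le c_h^m\le1$, $\theta_-\le\theta_h^m\le\theta_+$.) *)

(* Defs.v *)
From HB Require Import structures.
From mathcomp Require Import all_boot all_order all_algebra.
From mathcomp Require Import all_classical all_reals all_analysis.
Set Implicit Arguments.
Unset Strict Implicit.
Unset Printing Implicit Defensive.
Import Order.TTheory GRing.Theory Num.Theory.
Import numFieldNormedType.Exports.
Local Open Scope classical_set_scope.
Local Open Scope ring_scope.

(** * The Euclidean plane *)

Notation pt R := (R * R)%type.

Section Plane.
Variable R : realType.
Implicit Types x y : pt R.

Definition dot x y : R := x.1 * y.1 + x.2 * y.2.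

(* The library norm of a product space is the sup norm. *)
Definition enorm x : R := Num.sqrt (dot x x).

Definition leb2 : {measure set (measurableTypeR R * measurableTypeR R) -> \bar R} :=
  (@lebesgue_measure R \x @lebesgue_measure R)%E.

Definition segment x y : set (pt R) :=
  [set z | exists2 t : R, 0 <= t <= 1 & z = (1 - t) *: x + t *: y].

(* [interior (closure Om) = Om] excludes slits and punctures: the domain lies
   on one side only of each boundary segment. *)
Definition bounded_polygonal_domain (Om : set (pt R)) : Prop :=
  [/\ open Om, connected Om, Om !=set0 & bounded_set Om] /\
  interior (closure Om) = Om /\
  exists s : seq (pt R * pt R),
    closure Om `\` Om = \bigcup_(ab in [set` s]) segment ab.1 ab.2.

(** * Lebesgue and Sobolev spaces on a subset of the plane *)

(* [g \_ U] is the extension of [g] by 0 outside [U]. *)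
Definition in_Lp (U : set (pt R)) (p : \bar R) (g : pt R -> R) : Prop :=
  (g \_ U) \in Lfun leb2 p.

Definition in_L2v (U : set (pt R)) (g : pt R -> pt R) : Prop :=
  in_Lp U 2%:E (fun x => (g x).1) /\ in_Lp U 2%:E (fun x => (g x).2).

Definition ip (U : set (pt R)) (g h : pt R -> R) : R :=
  (\int[leb2]_(x in U) (g x * h x))%R.

Definition ipv (U : set (pt R)) (g h : pt R -> pt R) : R :=
  (\int[leb2]_(x in U) dot (g x) (h x))%R.

Definition L2normv (U : set (pt R)) (g : pt R -> pt R) : R :=
  Num.sqrt (ipv U g g).

Fixpoint Ck (n : nat) (phi : pt R -> R) : Prop :=
  if n is n'.+1 then
    [/\ continuous phi, forall x v, derivable phi x v
      & forall v, Ck n' (fun x => 'D_v phi x)]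
  else continuous phi.

Definition test_function (U : set (pt R)) (phi : pt R -> R) : Prop :=
  (forall n, Ck n phi) /\
  exists A, [/\ compact A, A `<=` U & forall x, ~ A x -> phi x = 0].

(* [g] is the weak derivative of [w] in the direction [e]. *)
Definition weak_derivative (U : set (pt R)) (e : pt R) (w g : pt R -> R) :=
  forall phi, test_function U phi ->
    ip U w (fun x => 'D_e phi x) = - ip U g phi.

Definition in_W1p (U : set (pt R)) (p : \bar R) (w : pt R -> R) : Prop :=
  in_Lp U p w /\
  exists g1 g2, [/\ in_Lp U p g1, in_Lp U p g2,
    weak_derivative U (1, 0) w g1 & weak_derivative U (0, 1) w g2].

Definition in_H1 (U : set (pt R)) (w : pt R -> R) : Prop := in_W1p U 2%:E w.

(* Continuity on [0, T] with values in L^2(U)^2. *)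
Definition in_C_L2v (T : R) (U : set (pt R)) (f : R -> pt R -> pt R) : Prop :=
  forall t, t \in `[0, T] ->
    in_L2v U (f t) /\
    L2normv U (fun x => f t' x - f t x) @[t' --> within `[0, T] (nbhs t)] --> 0.

(** * Meshes *)

(* A triangle is the set of its three vertex indices, an edge the set of its
   two vertex indices. *)
Record mesh := Mesh {
  nv : nat;
  pos : 'I_nv -> pt R;
  cells : {set {set 'I_nv}} }.

Notation sx M := {set 'I_(nv M)}.

Definition simplex (M : mesh) (S : sx M) : set (pt R) :=
  [set x | exists a : 'I_(nv M) -> R,
    [/\ forall v, v \in S -> 0 <= a v, \sum_(v in S) a v = 1
      & x = \sum_(v in S) a v *: pos v]].

(* The relative interior of [simplex S]. *)
Definition osimplex (M : mesh) (S : sx M) : set (pt R) :=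
  [set x | exists a : 'I_(nv M) -> R,
    [/\ forall v, v \in S -> 0 < a v, \sum_(v in S) a v = 1
      & x = \sum_(v in S) a v *: pos v]].

(* The angle at [x] of the triangle with vertices [x], [y], [z]. *)
Definition angle x y z : R :=
  acos (dot (y - x) (z - x) / (enorm (y - x) * enorm (z - x))).

(* Three distinct collinear points have an angle equal to pi, so the angle
   condition also excludes degenerate triangles. *)
Definition acute_mesh (Om : set (pt R)) (M : mesh) : Prop :=
  [/\ injective (@pos M),
      forall K, K \in cells M -> #|K| = 3%N,
      closure Om = \bigcup_(K in [set` cells M]) simplex K,
      forall K L, K \in cells M -> L \in cells M ->
        simplex K `&` simplex L = simplex (K :&: L)
    & forall K, K \in cells M -> forall a b c, a \in K -> b \in K -> c \in K ->
        uniq [:: a; b; c] -> angle (pos a) (pos b) (pos c) < pi / 2].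

Section MeshGeometry.
Variables (Om : set (pt R)) (M : mesh).
Implicit Types K L sg : sx M.

Definition area K : R := fine (leb2 (simplex K)).

Definition circumcenter K : pt R :=
  get [set c | forall a b, a \in K -> b \in K ->
                 enorm (c - pos a) = enorm (c - pos b)].

Definition hK K : R :=
  \big[Num.max/0]_(a in K) (2 * enorm (circumcenter K - pos a)).

Definition mesh_size : R := \big[Num.max/0]_(K in cells M) hK K.

Definition cell_edges K : {set sx M} :=
  [set sg : sx M | (#|sg| == 2)%N && (sg \subset K)]%SET.

Definition edges : {set sx M} := (\bigcup_(K in cells M) cell_edges K)%SET.

Definition int_edges : {set sx M} :=
  [set sg in edges | `[< osimplex sg `<=` Om >]]%SET.

Definition ext_edges : {set sx M} :=
  [set sg in edges | `[< simplex sg `<=` closure Om `\` Om >]]%SET.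

Definition midpoint sg : pt R := 2^-1 *: \sum_(a in sg) pos a.

Definition edge_length sg : R :=
  \big[Num.max/0]_(a in sg) \big[Num.max/0]_(b in sg) enorm (pos a - pos b).

Definition normal K sg : pt R :=
  get [set n | [/\ enorm n = 1,
    forall a b, a \in sg -> b \in sg -> dot n (pos b - pos a) = 0
  & forall a o, a \in sg -> o \in K -> o \notin sg ->
      dot n (pos o - pos a) < 0]].

(* The triangle on the other side of the interior edge [sg] of [K]. *)
Definition neighbor K sg : sx M :=
  odflt K [pick L in cells M | (sg \subset L) && (L != K)].

(* The two triangles sharing an interior edge are labelled arbitrarily; on a
   boundary edge [cellK] is the only triangle containing it. *)
Definition cellK sg : sx M := odflt (finset.set0) [pick K in cells M | sg \subset K].
Definition cellL sg : sx M := neighbor (cellK sg) sg.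

Definition dist sg : R :=
  if sg \in int_edges
  then enorm (circumcenter (cellK sg) - circumcenter (cellL sg))
  else enorm (circumcenter (cellK sg) - midpoint sg).

Definition trans sg : R := edge_length sg / dist sg.

Definition mesh_regular (Creg : R) : Prop :=
  forall sg, sg \in edges ->
    Creg * edge_length sg <= dist sg /\ Creg * mesh_size <= edge_length sg.

(** ** Discrete spaces

   An element of a discrete space is the family of its restrictions to the
   triangles; only the values of the family on [cells M] matter. *)

(* An affine function, given by its constant term and its gradient. *)
Definition aff := (R * pt R)%type.
Definition aff_eval (l : aff) (x : pt R) : R := l.1 + dot l.2 x.

Definition affv := (aff * aff)%type.
Definition affv_eval (w : affv) (x : pt R) : pt R :=
  (aff_eval w.1 x, aff_eval w.2 x).

(* The function on the plane with restrictions [F K] to the open triangles, and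
   value 0 elsewhere. *)
Definition pw (V : zmodType) (F : sx M -> pt R -> V) (x : pt R) : V :=
  if [pick K in cells M | `[< osimplex K x >]] is Some K then F K x else 0.

Definition P0fun (V : zmodType) (q : sx M -> V) : pt R -> V :=
  pw (fun K _ => q K).
Definition P1fun (q : sx M -> aff) : pt R -> R :=
  pw (fun K x => aff_eval (q K) x).
Definition RTfun (w : sx M -> affv) : pt R -> pt R :=
  pw (fun K x => affv_eval (w K) x).

Definition normh (q : sx M -> R) : R :=
  Num.sqrt (\sum_(sg in int_edges)
              trans sg * (q (cellL sg) - q (cellK sg)) ^+ 2).

Definition P1nc : set (sx M -> aff) :=
  [set q | forall sg, sg \in int_edges ->
     aff_eval (q (cellK sg)) (midpoint sg) =
     aff_eval (q (cellL sg)) (midpoint sg)].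

Definition RT0 : set (sx M -> affv) :=
  [set w | [/\
    forall K sg, K \in cells M -> sg \in cell_edges K ->
      exists r : R, forall x, simplex sg x ->
        dot (affv_eval (w K) x) (normal K sg) = r,
    forall sg, sg \in int_edges -> forall x, simplex sg x ->
      dot (affv_eval (w (cellK sg)) x) (normal (cellK sg) sg) =
      dot (affv_eval (w (cellL sg)) x) (normal (cellK sg) sg)
  & forall sg, sg \in ext_edges -> forall x, simplex sg x ->
      dot (affv_eval (w (cellK sg)) x) (normal (cellK sg) sg) = 0]].

(* The constant normal component of [w] on the edge [sg] of [K]. *)
Definition flux (w : sx M -> affv) K sg : R :=
  dot (affv_eval (w K) (midpoint sg)) (normal K sg).

(* [q] is the orthogonal projection of [g] onto the image under [emb] of the
   space [X], for the bilinear form [b]. *)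
Definition orth_proj (V : zmodType) (A : Type)
    (b : (pt R -> V) -> (pt R -> V) -> R) (emb : A -> pt R -> V) (X : set A)
    (g : pt R -> V) (q : A) : Prop :=
  X q /\ forall r, X r -> b (fun x => g x - emb q x) (emb r) = 0.

Definition proj_P0 (g : pt R -> R) (q : sx M -> R) : Prop :=
  orth_proj (ip Om) (@P0fun R) setT g q.
Definition proj_P0v (g : pt R -> pt R) (q : sx M -> pt R) : Prop :=
  orth_proj (ipv Om) (@P0fun (pt R)) setT g q.
Definition proj_P1nc (g : pt R -> R) (q : sx M -> aff) : Prop :=
  orth_proj (ip Om) P1fun P1nc g q.
Definition proj_RT0 (g : pt R -> pt R) (w : sx M -> affv) : Prop :=
  orth_proj (ipv Om) RTfun RT0 g w.

(** ** Discrete operators *)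

Definition gradh (q : sx M -> aff) : sx M -> pt R := fun K => (q K).2.

(* [q] is div_h [v]: the element of P_1^nc with the prescribed values at the
   midpoints of the edges. *)
Definition is_divh (v : sx M -> pt R) (q : sx M -> aff) : Prop :=
  [/\ P1nc q,
    forall sg, sg \in int_edges ->
      aff_eval (q (cellK sg)) (midpoint sg) =
      3 * edge_length sg / (area (cellK sg) + area (cellL sg)) *
        dot (v (cellL sg) - v (cellK sg)) (normal (cellK sg) sg)
  & forall sg, sg \in ext_edges ->
      aff_eval (q (cellK sg)) (midpoint sg) =
      - (3 * edge_length sg / area (cellK sg) *
           dot (v (cellK sg)) (normal (cellK sg) sg))].

Definition laph (q : sx M -> R) : sx M -> R := fun K =>
  (area K)^-1 * \sum_(sg in cell_edges K :&: int_edges)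
                   trans sg * (q (neighbor K sg) - q K).

Definition bh (w : sx M -> affv) (q : sx M -> R) : sx M -> R := fun K =>
  (area K)^-1 * \sum_(sg in cell_edges K :&: int_edges)
     edge_length sg * (Num.max (flux w K sg) 0 * q K +
                       Num.min (flux w K sg) 0 * q (neighbor K sg)).

End MeshGeometry.

(** * Data and scheme *)

(* [src], [srcc], [srcth] are s, s_c, s_theta; [thstar], [thmin], [thmax] are
   theta_*, theta_-, theta_+; [force] is f, a function of time and space. *)
Record problem_data := ProblemData {
  Omega : set (pt R);
  Tfin : R;
  Dc : R;
  Dth : R;
  lam : R;
  thstar : R;
  thmin : R;
  thmax : R;
  kappa : pt R -> R;
  kinf : R;
  src : pt R -> R;
  srcc : pt R -> R;
  srcth : pt R -> R;
  force : R -> pt R -> pt R;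
  c_init : pt R -> R;
  th_init : pt R -> R }.

Record admissible (d : problem_data) : Prop := Admissible {
  adm_Omega : bounded_polygonal_domain (Omega d);
  adm_T : 0 < Tfin d;
  adm_Dc : 0 < Dc d;
  adm_Dth : 0 < Dth d;
  adm_lam : 0 < lam d;
  adm_thstar : 0 < thstar d;
  adm_thmin : 0 < thmin d;
  adm_thmax : thmin d <= thmax d;
  adm_kappa_W : in_W1p (`]0, 1[ `*` `]0, +oo[) +oo%E (kappa d);
  (* [kappa] is the Lipschitz representative on the closure. *)
  adm_kappa_lip : exists k : R,
    k.-lipschitz_(`[0, 1] `*` `[0, +oo[) (kappa d);
  adm_kinf : 0 < kinf d;
  adm_kappa_inf : forall x, (`[0, 1] `*` `[0, +oo[) x -> kinf d <= kappa d x;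
  adm_src : in_Lp (Omega d) 2%:E (src d);
  adm_srcc : in_Lp (Omega d) 2%:E (srcc d);
  adm_srcth : in_Lp (Omega d) 2%:E (srcth d);
  adm_force : in_C_L2v (Tfin d) (Omega d) (force d);
  adm_c_init : in_H1 (Omega d) (c_init d);
  adm_th_init : in_H1 (Omega d) (th_init d);
  adm_c_init_bd : {ae leb2, forall x, Omega d x -> 0 <= c_init d x <= 1};
  adm_th_init_bd :
    {ae leb2, forall x, Omega d x -> thmin d <= th_init d x <= thmax d};
  adm_srcc_bd :
    {ae leb2, forall x, Omega d x -> 0 <= srcc d x <= 2 * src d x + lam d};
  adm_srcth_min : {ae leb2, forall x, Omega d x ->
    2 * (thmin d - thstar d) * src d x + srcth d x <= 0};
  adm_srcth_max : {ae leb2, forall x, Omega d x ->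
    0 <= 2 * (thmax d - thstar d) * src d x + srcth d x} }.

Section Scheme.
Variables (d : problem_data) (M : mesh).

Definition kappah (c th : sx M -> R) : sx M -> R :=
  fun K => kappa d (c K, th K).

Definition concentration_step (k : R) (sh sch : sx M -> R) (u : sx M -> affv)
    (c c' : sx M -> R) : Prop :=
  forall K, K \in cells M ->
    (c' K - c K) / k - Dc d * laph (Omega d) c' K =
    sch K - (sh K + lam d) * c' K - bh (Omega d) u c' K.

Definition temperature_step (k : R) (sh sth : sx M -> R) (u : sx M -> affv)
    (th th' : sx M -> R) : Prop :=
  forall K, K \in cells M ->
    (th' K - th K) / k - Dth d * laph (Omega d) th' K =
    - sth K - sh K * (th' K - thstar d) - bh (Omega d) u th' K.

Definition pressure_eq (sh : sx M -> R) (fh : sx M -> pt R) (kh : sx M -> R)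
    (p : sx M -> aff) : Prop :=
  [/\ P1nc (Omega d) p, (\int[leb2]_(x in Omega d) P1fun p x)%R = 0
  & exists qp qf qs : sx M -> aff,
    [/\ is_divh (Omega d) (fun K => kh K *: gradh p K) qp,
        is_divh (Omega d) fh qf,
        proj_P1nc (Omega d) (P0fun sh) qs
      & forall K, K \in cells M -> qp K = qf K - qs K]].

Definition velocity_eq (fh : sx M -> pt R) (kh : sx M -> R) (p : sx M -> aff)
    (u : sx M -> affv) : Prop :=
  proj_RT0 (Omega d) (P0fun (fun K => fh K - kh K *: gradh p K)) u.

(* [kappa] is only constrained on [0, 1] x [0, +oo[, so its evaluation at
   discrete solutions makes sense under the maximum principle [sol_cbd],
   [sol_thbd], which is part of what is meant by a solution. *)
Record scheme_solution (N : nat) (c th : nat -> sx M -> R)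
    (p : nat -> sx M -> aff) (u : nat -> sx M -> affv) : Prop := SchemeSolution {
  sol_c0 : proj_P0 (Omega d) (c_init d) (c 0%N);
  sol_th0 : proj_P0 (Omega d) (th_init d) (th 0%N);
  sol_cbd : forall m, (m <= N)%N ->
    forall K, K \in cells M -> 0 <= c m K <= 1;
  sol_thbd : forall m, (m <= N)%N ->
    forall K, K \in cells M -> thmin d <= th m K <= thmax d;
  sol_eqs : exists (sh sch sth : sx M -> R) (fh : nat -> sx M -> pt R),
    let k := Tfin d / N%:R in
    [/\ [/\ proj_P0 (Omega d) (src d) sh,
            proj_P0 (Omega d) (srcc d) sch,
            proj_P0 (Omega d) (srcth d) sth
          & forall m, (m <= N)%N ->
              proj_P0v (Omega d) (force d (m%:R * k)) (fh m)],
        forall n, (n < N)%N ->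
          concentration_step k sh sch (u n) (c n) (c n.+1),
        forall n, (n < N)%N ->
          temperature_step k sh sth (u n) (th n) (th n.+1)
      & forall m, (m <= N)%N ->
          pressure_eq sh (fh m) (kappah (c m) (th m)) (p m) /\
          velocity_eq (fh m) (kappah (c m) (th m)) (p m) (u m)] }.

End Scheme.

End Plane.

Notation sx M := {set 'I_(nv M)}.

(* Main.v *)
Require Import Defs.
From HB Require Import structures.
From mathcomp Require Import all_boot all_order all_algebra.
From mathcomp Require Import all_classical all_reals all_analysis.
From mathcomp Require Import measurable_realfun unstable.
From mathcomp Require Import ring lra.
Import Order.TTheory GRing.Theory Num.Theory.
Import numFieldNormedType.Exports.
Local Open Scope classical_set_scope.
Local Open Scope ring_scope.
Set Implicit Arguments.
Unset Strict Implicit.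
Unset Printing Implicit Defensive.

(** The pressure and the velocity are estimated first, at each time separately;
    the estimate of the concentration and of the temperature uses that of the
    velocity.

    Pressure and velocity. The discrete divergence is minus the adjoint of the
    broken gradient ([divh_adjoint]), so testing the pressure equation with the
    pressure itself gives a bound of the broken gradient by the force and the
    source, once the norm of the pressure is controlled by its broken gradient
    ([poincare]). The velocity is an orthogonal projection of the resulting
    flux, whose norm it cannot exceed ([velocity_bound]).

    Concentration and temperature. Testing each equation with its unknown makes
    the time differences telescope and the diffusion produce the discrete
    Dirichlet norm. In the convection term each interior edge contributes the
    flux of the velocity times a jump of the unknown; the unknown is bounded by
    the maximum principle, so the jump is absorbed by the diffusion and a sum of
    squared fluxes remains. On a regular mesh the midpoint rule bounds this sum
    by the squared norm of the velocity ([flux_sum]).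

    The delicate point is a Poincare inequality whose constant does not depend
    on the mesh. A nonconforming function is estimated first along segments:
    the triangles met by a segment that avoids the vertices form a chain of
    neighbours, and the function agrees at the midpoint of each common edge
    ([segment_variation]). Integrating this over the domain bounds the mean
    square difference between the function and a translate of it by the broken
    gradient, for translations of at most the mesh size ([local_translation])
    and then, by subdivision, for all translations ([translation]). On a convex
    set, averaging over the translations shows that the function is close to a
    constant ([good_convex]). Two such sets with a common box have a union of
    the same kind ([good_union]), and connectedness joins any two points of the
    domain by such a set ([piece_through]). The open triangles of one fixed
    mesh then cover the domain up to a null set by finitely many convex pieces,
    which yields the inequality on every other mesh.

    The geometry behind this is elementary: triangles with a common edge lie on
    opposite sides of it ([opposite_sides]), so that an edge belongs to two
    triangles if it is interior and to one if it lies on the boundary, and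
    acuteness turns the lower bound of the edge lengths into a lower bound of
    the areas ([acute_det]). *)

(** * Affine changes of variables *)

(** The plane as a measurable space; convertible to [pt R]. *)
Notation mpt R := (measurableTypeR R * measurableTypeR R)%type.

Section AffineChange.
Variable R : realType.
Let mu := (@lebesgue_measure R).

Lemma measurable_affine1 (a b : R) :
  measurable_fun setT ((fun y : R => a * y + b) : measurableTypeR R -> measurableTypeR R).
Proof. by apply: measurable_funD => //; apply: measurable_funM. Qed.

Lemma preimage_affine1 (a b x y : R) : a != 0 ->
  (fun t : R => a * t + b) @^-1` `]x, y]%classic =
  if 0 < a then `](x - b) / a, (y - b) / a]%classic else `[(y - b) / a, (x - b) / a[%classic.
Proof.
move=> a0; case: ifPn => pa; apply/seteqP; split => t /=; rewrite !in_itv/=.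
- by rewrite ltr_pdivrMr// ler_pdivlMr//; rewrite (mulrC t); lra.
- by rewrite ltr_pdivrMr// ler_pdivlMr//; rewrite (mulrC t); lra.
- have na : a < 0 by lra.
  by rewrite ltr_ndivlMr// ler_ndivrMr//; rewrite (mulrC t); lra.
- have na : a < 0 by lra.
  by rewrite ltr_ndivlMr// ler_ndivrMr//; rewrite (mulrC t); lra.
Qed.

(** The rescaled image measure agrees with the Lebesgue measure on intervals, which
    determine it. *)
Lemma lebesgue_affine1 (a b : R) (A : set (measurableTypeR R)) : a != 0 -> measurable A ->
  mu ((fun y : R => a * y + b) @^-1` A) = (`|a|^-1%:E * mu A)%E.
Proof.
move=> a0 mA.
pose f : measurableTypeR R -> measurableTypeR R := fun y => a * y + b.
have mf : measurable_fun setT f by exact: measurable_affine1.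
have na : 0 < `|a| by rewrite normr_gt0.
pose nu0 := HB.pack_for {measure set (measurableTypeR R) -> \bar R}
  (pushforward mu f) (Measure.on (pushforward mu f)).
pose nu := nu0 mf.
have E : mu A = mscale (NngNum (ltW na)) nu A.
  apply: lebesgue_measure_unique => // _ [[x y]] _ <-.
  transitivity (`|a|%:E * mu ((fun t : R => (a * t + b)%R) @^-1` `]x, y]%classic))%E => //.
  rewrite preimage_affine1//.
  rewrite [LHS]lebesgue_measure_itv/= !lte_fin.
  case: (ltP 0 a) => pa; rewrite /mu lebesgue_measure_itv/= !lte_fin.
  - rewrite ltr_pM2r ?invr_gt0// ltrD2r; case: ifP => xy; last by rewrite mule0.
    by rewrite -!EFinD -EFinM gtr0_norm//; congr _%:E; field.
  - have na' : a < 0 by rewrite lt_neqAle a0.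
    rewrite ltr_nM2r ?invr_lt0// ltrD2r; case: ifP => xy; last by rewrite mule0.
    by rewrite -!EFinD -EFinM ltr0_norm//; congr _%:E; field.
rewrite E /mscale/= muleA -EFinM mulVf ?mul1e//.
by rewrite gt_eqF.
Qed.

(** [r] is the inverse of the absolute value of the Jacobian. In this form the change of variables
    composes, so that it has to be checked on generators of the affine group only. *)
Definition scales (f : mpt R -> mpt R) (r : R) : Prop :=
  measurable_fun setT f /\
  forall E : set (mpt R), measurable E -> @leb2 R (f @^-1` E) = (r%:E * @leb2 R E)%E.

Lemma scales_comp f g r s : 0 <= r -> scales f r -> scales g s ->
  scales (f \o g) (s * r).
Proof.
move=> r0 [mf hf] [mg hg]; split; first exact: measurableT_comp.
move=> E mE; rewrite comp_preimage hg; last first.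
  by rewrite -[X in measurable X]setTI; exact: mf.
by rewrite hf// muleA EFinM.
Qed.

(** The product measure is determined by its values on rectangles. *)
Lemma scales_swap : scales (fun x => (x.2, x.1)) 1.
Proof.
have ms : measurable_fun setT (fun x : mpt R => (x.2, x.1) : mpt R).
  by apply/measurable_fun_pairP; split => /=; [exact: measurable_snd|exact: measurable_fst].
split=> // E mE; rewrite mul1e; apply/esym.
pose sw : mpt R -> mpt R := fun x => (x.2, x.1).
pose nu0 := HB.pack_for {measure set (mpt R) -> \bar R}
  (pushforward (@leb2 R) sw) (Measure.on (pushforward (@leb2 R) sw)).
pose nu := nu0 ms.
apply: (@product_measure_unique _ _ _ _ _ _ _ nu) => // A B mA mB.
rewrite /nu/= /pushforward.
have -> : (fun x : mpt R => (x.2, x.1)) @^-1` (A `*` B) = B `*` A.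
  by apply/seteqP; split => -[x y] /= [].
by rewrite /leb2 /= product_measure1E// muleC.
Qed.

(** By Fubini: the vertical sections are rescaled by [d] and translated, and the
    remaining integral is rescaled by [a]. *)
Lemma scales_lower (a c d e g : R) : a != 0 -> d != 0 ->
  scales (fun x => (a * x.1 + e, c * x.1 + d * x.2 + g)) `|a * d|^-1.
Proof.
move=> a0 d0.
have mf : measurable_fun setT
   (fun x : mpt R => (a * x.1 + e, c * x.1 + d * x.2 + g) : mpt R).
  apply/measurable_fun_pairP; split => /=.
    by apply: measurable_funD => //; apply: measurable_funM => //; exact: measurable_fst.
  by apply: measurable_funD => //; apply: measurable_funD => //; apply: measurable_funM.
split => // E mE; rewrite /leb2/= /product_measure1/=.
pose h : R -> \bar R := fun x => mu (xsection E x).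
have mh : measurable_fun setT (h : measurableTypeR R -> \bar R).
  exact: measurable_fun_xsection.
transitivity (\int[mu]_x ((`|d|^-1)%R%:E * h (a * x + e)%R))%E.
  apply: eq_integral => x _ /=.
  rewrite /h -(@lebesgue_affine1 d (c * x + g)) //; last exact: measurable_xsection.
  congr (mu _); apply/seteqP; split => y; rewrite /xsection/= !inE/=;
    by rewrite (_ : c * x + d * y + g = d * y + (c * x + g)); last by ring.
have ma := measurable_affine1 a e.
rewrite ge0_integralZl//=; last first.
  exact: measurableT_comp.
have -> : (\int[mu]_x h (a * x + e)%R = (`|a|^-1)%R%:E * \int[mu]_x h x)%E.
  transitivity (\int[mu]_(x in (fun y => (a * y + e)%R) @^-1` setT) (h \o (fun y => (a * y + e)%R)) x)%E.
    by rewrite preimage_setT.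
  rewrite -(@ge0_integral_pushforward _ _ _ _ _ _ ma mu setT h)//.
  rewrite (eq_measure_integral (mscale (NngNum (normr_ge0 a^-1)) mu)).
    by rewrite ge0_integral_mscale//= normfV.
  by move=> A mA _; rewrite [LHS](lebesgue_affine1 e a0 mA) -normfV.
by rewrite normrM invfM mulrC EFinM muleA.
Qed.

(** Every invertible affine map is a product of triangular maps and swaps. *)
Lemma scales_affine (a b c d e g : R) : a * d - b * c != 0 ->
  scales (fun x => (a * x.1 + b * x.2 + e, c * x.1 + d * x.2 + g))
    `|a * d - b * c|^-1.
Proof.
move=> D0; have [a0|a0] := eqVneq a 0.
  have bc0 : b != 0 /\ c != 0.
    by split; apply: contraNneq D0 => ->; rewrite a0 ?(mul0r,mulr0) subrr.
  have := scales_comp _ (@scales_lower b d c e g bc0.1 bc0.2) scales_swap.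
  rewrite invr_ge0 normr_ge0 a0 !mul0r sub0r normrN mul1r => /(_ isT).
  congr (scales _ _); apply/funext => x /=.
  by rewrite mul0r add0r; congr pair; ring.
pose d' := d - b * c / a.
have Dd : a * d - b * c = a * d' by rewrite /d'; field.
have d'0 : d' != 0 by apply: contra_neq D0 => E; rewrite Dd E mulr0.
have u1 := scales_comp _ (@scales_lower 1 (b / a) 1 0 0 (oner_neq0 _) (oner_neq0 _)) scales_swap.
have u2 := scales_comp _ scales_swap (u1 _).
have := scales_comp _ (@scales_lower a c d' e g a0 d'0) (u2 _ _).
rewrite !mul1r normr1 invr1 => /(_ _ ler01 ler01); rewrite invr_ge0 normr_ge0 mul1r => /(_ isT).
rewrite -Dd; congr (scales _ _); last by rewrite mul1r.
by apply/funext => x /=; congr pair; rewrite /d'; field.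
Qed.

Lemma scales_translate (v : pt R) : scales (fun x => (x.1 + v.1, x.2 + v.2)) 1.
Proof.
have := @scales_affine 1 0 0 1 v.1 v.2.
rewrite !mul0r !mul1r subr0 normr1 invr1 => /(_ (oner_neq0 _)).
congr (scales _ _); apply/funext => x /=.
by rewrite !mul0r !mul1r add0r addr0.
Qed.

Lemma scales_ge0_integral f r (D : set (mpt R)) (F : mpt R -> \bar R) : scales f r -> 0 < r ->
  measurable D -> measurable_fun D F -> (forall x, D x -> 0 <= F x)%E ->
  (\int[@leb2 R]_(x in D) F x = (r^-1)%R%:E * \int[@leb2 R]_(x in f @^-1` D) F (f x))%E.
Proof.
move=> [mf hf] r0 mD mF F0.
rewrite -(@ge0_integral_pushforward _ _ _ _ _ _ mf (@leb2 R) D F)//; last first.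
  by move=> x; rewrite inE; exact: F0.
have E A : measurable A -> A `<=` D ->
    pushforward (@leb2 R) f A = mscale (NngNum (ltW r0)) (@leb2 R) A.
  by move=> mA _; exact: hf.
rewrite (eq_measure_integral _ E); last exact: mf.
rewrite (ge0_integral_mscale _ mD _ mF F0).
have -> : ((r^-1)%R%:E * ((NngNum (ltW r0))%:num%:E * \int[@leb2 R]_(x in D) F x)
   = (r^-1 * r)%R%:E * \int[@leb2 R]_(x in D) F x)%E by rewrite EFinM muleA.
by rewrite mulVf ?mul1e// gt_eqF.
Qed.

End AffineChange.

(** * Second moments of the reference triangle *)

Section RefTriangle.
Variable R : realType.
Notation leb := (@leb2 R).
Let mu := (@lebesgue_measure R).

Lemma measurable_aff (l : aff R) : measurable_fun setT (aff_eval l : mpt R -> R).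
Proof.
by apply: measurable_funD => //; apply: measurable_funD => //;
  apply: measurable_funM.
Qed.

Lemma measurable_aff_preimage (l : aff R) (B : set (measurableTypeR R)) : measurable B ->
  measurable ([set x | B (aff_eval l x)] : set (mpt R)).
Proof. by move=> mB; rewrite -[X in measurable X]setTI; exact: measurable_aff. Qed.

Lemma measurable_aff_ge0 (l : aff R) : measurable ([set x | 0 <= aff_eval l x] : set (mpt R)).
Proof.
have := @measurable_aff_preimage l `[0, +oo[%classic (measurable_itv _).
by congr measurable; apply/seteqP; split => x; rewrite /= in_itv/= andbT.
Qed.

Lemma measurable_aff_gt0 (l : aff R) : measurable ([set x | 0 < aff_eval l x] : set (mpt R)).
Proof.
have := @measurable_aff_preimage l `]0, +oo[%classic (measurable_itv _).
by congr measurable; apply/seteqP; split => x; rewrite /= in_itv/= andbT.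
Qed.

Lemma measurable_aff_eq0 (l : aff R) : measurable ([set x | aff_eval l x = 0] : set (mpt R)).
Proof.
have := @measurable_aff_preimage l [set 0] (measurable_set1 _).
by congr measurable; apply/seteqP; split => x.
Qed.

Definition reftri : set (mpt R) := [set x | [/\ 0 <= x.1, 0 <= x.2 & x.1 + x.2 <= 1]].

Lemma measurable_reftri : measurable reftri.
Proof.
have -> : reftri = [set x | 0 <= aff_eval (0, (1, 0)) x] `&`
   ([set x | 0 <= aff_eval (0, (0, 1)) x] `&` [set x | 0 <= aff_eval (1, (-1, -1)) x]).
  apply/seteqP; split => x; rewrite /reftri /aff_eval /dot /=.
    by move=> [? ? ?]; split; [|split]; lra.
  by move=> [? [? ?]]; split; lra.
by apply: measurableI; [|apply: measurableI]; exact: measurable_aff_ge0.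
Qed.

(** Fubini reduces the moment to a beta integral. *)
Lemma reftri_moment (k : nat) :
  \int[leb]_(x in reftri) x.1 ^+ k = k`!%:R / (k.+2)`!%:R.
Proof.
have mF : measurable_fun setT (fun x : mpt R => (x.1 ^+ k * \1_reftri x)%:E).
  apply/measurable_EFinP; apply: measurable_funM; last first.
    exact: measurable_indic measurable_reftri.
  by apply: measurable_funX; exact: measurable_fst.
have F0 (x : mpt R) : (0 <= (x.1 ^+ k * \1_reftri x)%:E)%E.
  rewrite lee_fin indicE; have [|_] := boolP (x \in reftri); last by rewrite mulr0.
  by rewrite inE => -[? _ _]; rewrite mulr1 exprn_ge0.
rewrite Rintegral_mkcond.
transitivity (fine (\int[leb]_x (x.1 ^+ k * \1_reftri x)%:E)).
  congr fine; apply: eq_integral => x _; congr EFin.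
  by rewrite patchE indicE; case: ifPn; rewrite ?mulr1 ?mulr0.
rewrite [X in fine X](fubini_tonelli1 (fun x : mpt R => (x.1 ^+ k * \1_reftri x)%:E))//.
rewrite (_ : k`!%:R / _ = beta_fun k.+1 2); last first.
  by rewrite beta_fun_fact muln1 addn1.
rewrite /beta_fun /Rintegral; congr fine; apply: eq_integral => x _.
rewrite /fubini_F/=.
rewrite patchE; case: ifPn => /=; rewrite ?inE/= ?notin_setE/= in_itv/=.
  move=> /andP[x0 x1].
  transitivity (\int[mu]_y ((x ^+ k)%:E * (\1_(`[0, 1 - x]%classic : set R) y)%:E))%E.
    apply: eq_integral => y _; rewrite -EFinM; congr (_ * _)%:E.
    rewrite !indicE; congr (_%:R); congr nat_of_bool; apply/idP/idP; rewrite !inE/= in_itv/=.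
      by move=> [/= _ -> ?]; lra.
    by move=> /andP[? ?]; split => /=; lra.
  rewrite ge0_integralZl//=; last 2 first.
  - by apply/measurable_EFinP; exact: measurable_indic.
  - by rewrite lee_fin exprn_ge0.
  rewrite integral_indic//= setIT /mu lebesgue_measure_itv/= lte_fin.
  rewrite /XMonemX /unstable.onem expr1 EFinM; congr (_ * _)%E.
  by case: ltP => h; rewrite ?oppr0 ?adde0 ?subr0 -?EFinD ?subr0//; congr EFin; lra.
move=> h; rewrite integral0_eq// => y _; rewrite indicE memNset ?mulr0//.
by move=> -[/= x0 y0 xy]; apply: h; apply/andP; split; lra.
Qed.

Lemma leb_bounded (D : set (mpt R)) (r : R) : measurable D ->
  (forall x, D x -> `|x.1| <= r /\ `|x.2| <= r) ->
  (leb D <= (`|r| *+ 2 * (`|r| *+ 2))%:E)%E.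
Proof.
move=> mD Dr.
pose I : set (measurableTypeR R) := `[- `|r|, `|r|]%classic.
have mI : measurable I by exact: measurable_itv.
have : (leb D <= leb (I `*` I))%E.
  apply: le_measure; rewrite ?inE//; first exact: measurableX.
  by move=> x /Dr[x1 x2]; split; rewrite /I /= in_itv/= -ler_norml (le_trans _ (ler_norm r)).
move=> /le_trans; apply; rewrite [X in (X <= _)%E]product_measure1E//.
rewrite /= lebesgue_measure_itv/= lte_fin; case: ifP => _.
  by rewrite -!EFinD -EFinM lee_fin mulr2n opprK.
by rewrite mule0 lee_fin mulr_ge0// mulrn_wge0.
Qed.

Lemma integrable_bounded (D : set (mpt R)) (r M : R) (f : mpt R -> R) : measurable D ->
  (forall x, D x -> `|x.1| <= r /\ `|x.2| <= r) -> measurable_fun setT f ->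
  (forall x, D x -> `|f x| <= M) -> leb.-integrable D (EFin \o f).
Proof.
move=> mD Dr mf fM; apply: measurable_bounded_integrable => //.
- by rewrite (le_lt_trans (leb_bounded mD Dr))// ltry.
- exact: measurable_funS mf.
- exists M; split; first exact: num_real.
  by move=> x Mx y Dy /=; rewrite (le_trans (fM _ Dy))// ltW.
Qed.

Lemma aff_bounded (l : aff R) (r : R) (x : pt R) : `|x.1| <= r -> `|x.2| <= r ->
  `|aff_eval l x| <= `|l.1| + (`|l.2.1| + `|l.2.2|) * r.
Proof.
move=> x1 x2; rewrite /aff_eval /dot (le_trans (ler_normD _ _))// lerD2l.
rewrite mulrDl (le_trans (ler_normD _ _))// lerD// normrM ler_wpM2l//.
Qed.

Lemma integrable_aff2 (D : set (mpt R)) (r : R) (l l' : aff R) : measurable D ->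
  (forall x, D x -> `|x.1| <= r /\ `|x.2| <= r) ->
  leb.-integrable D (EFin \o (fun x => aff_eval l x * aff_eval l' x)).
Proof.
move=> mD Dr.
apply: (@integrable_bounded _ r ((`|l.1| + (`|l.2.1| + `|l.2.2|) * r) *
   (`|l'.1| + (`|l'.2.1| + `|l'.2.2|) * r))) => //.
  by apply: measurable_funM; exact: measurable_aff.
by move=> x /Dr[x1 x2]; rewrite normrM ler_pM ?aff_bounded.
Qed.

Lemma reftri_le1 x : reftri x -> `|x.1| <= 1 /\ `|x.2| <= 1.
Proof. by move=> [x1 x2 x12]; rewrite !ger0_norm//; split; lra. Qed.

Lemma aff_evalE (c a b : R) (x : pt R) : aff_eval (c, (a, b)) x = c + (a * x.1 + b * x.2).
Proof. by []. Qed.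

Lemma scales_Rintegral f r (D : set (mpt R)) (F : mpt R -> R) : scales f r -> 0 < r ->
  measurable D -> measurable_fun D F -> (forall x, D x -> 0 <= F x) ->
  \int[leb]_(x in D) F x = r^-1 * \int[leb]_(x in f @^-1` D) F (f x).
Proof.
move=> sf r0 mD mF F0; rewrite /Rintegral.
rewrite (@scales_ge0_integral _ _ _ _ (fun x => (F x)%:E) sf r0 mD); first last.
- by move=> x Dx; rewrite lee_fin F0.
- exact/measurable_EFinP.
set I := (\int[_]_(x in _) _)%E.
have : (0 <= I)%E by apply: integral_ge0 => x Dx; rewrite lee_fin F0.
case: I => [I _|_|//] /=; first by [].
by rewrite gt0_muley ?lte_fin ?invr_gt0//= mulr0.
Qed.

(** The moments enter [reftri_sq] through this computation, which leaves the mixed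
    one, [B X Y], undetermined. *)
Lemma bilin_sq (B : aff R -> aff R -> R) (one X Y : aff R) :
  (forall l (c a b : R), B l (c, (a, b)) = c * B l one + a * B l X + b * B l Y) ->
  (forall l l', B l l' = B l' l) ->
  B one one = 1 / 2 -> B one X = 1 / 6 -> B one Y = 1 / 6 ->
  B X X = 1 / 12 -> B Y Y = 1 / 12 -> forall c a b : R,
  B (c, (a, b)) (c, (a, b)) =
    c ^+ 2 / 2 + a ^+ 2 / 12 + b ^+ 2 / 12 + c * a / 3 + c * b / 3 + a * b * 2 * B X Y.
Proof.
move=> comb BC B11 B1X B1Y BXX BYY c a b.
rewrite [LHS]comb !(BC (c, (a, b)) _) !comb (BC X one) (BC Y one) (BC Y X).
by rewrite B11 B1X B1Y BXX BYY; field.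
Qed.

(** The moments of the first coordinate are beta integrals and the swap of the
    coordinates gives those of the second. The mixed moment then follows from the
    invariance of the triangle under the affine map that exchanges [x.1] with
    [1 - x.1 - x.2]. *)
Lemma reftri_sq (l : aff R) :
  \int[leb]_(x in reftri) (aff_eval l x ^+ 2) =
  (aff_eval l (0, 0) ^+ 2 + aff_eval l (1, 0) ^+ 2 + aff_eval l (0, 1) ^+ 2 +
   aff_eval l (0, 0) * aff_eval l (1, 0) + aff_eval l (0, 0) * aff_eval l (0, 1) +
   aff_eval l (1, 0) * aff_eval l (0, 1)) / 12.
Proof.
pose J (F : mpt R -> R) := \int[leb]_(x in reftri) F x.
have mT := measurable_reftri.
have iT l1 l2 : leb.-integrable reftri (EFin \o (fun x => aff_eval l1 x * aff_eval l2 x)).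
  exact: integrable_aff2 mT reftri_le1.
pose one : aff R := (1, (0, 0)); pose X : aff R := (0, (1, 0)); pose Y : aff R := (0, (0, 1)).
pose Z : aff R := (1, (-1, -1)).
pose B l1 l2 := J (fun x => aff_eval l1 x * aff_eval l2 x).
have e1 x : aff_eval one x = 1 by rewrite /one aff_evalE !mul0r !addr0.
have eX x : aff_eval X x = x.1 by rewrite /X aff_evalE mul0r mul1r add0r addr0.
have eY x : aff_eval Y x = x.2 by rewrite /Y aff_evalE mul0r mul1r !add0r.
have eZ x : aff_eval Z x = 1 - x.1 - x.2 by rewrite /Z aff_evalE; ring.
have BZ l1 l2 l3 (a : R) : B l1 (l2.1 + a * l3.1, (l2.2.1 + a * l3.2.1, l2.2.2 + a * l3.2.2))
    = B l1 l2 + a * B l1 l3.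
  rewrite /B /J -RintegralZl// -RintegralD//; last first.
    have -> : EFin \o (fun x : mpt R => a * (aff_eval l1 x * aff_eval l3 x))
      = (fun x => a%:E * (aff_eval l1 x * aff_eval l3 x)%:E)%E by [].
    by apply: integrableZl => //; exact: iT.
  by apply: eq_Rintegral => x _; rewrite /aff_eval /dot /=; ring.
have BC l1 l2 : B l1 l2 = B l2 l1 by apply: eq_Rintegral => x _; rewrite mulrC.
have sw : scales (fun x : mpt R => (x.2, x.1)) 1 by exact: scales_swap.
have ro : scales (fun x : mpt R => (1 - x.1 - x.2, x.2)) 1.
  have := @scales_affine R (-1) (-1) 0 1 1 0.
  rewrite mulr0 subr0 mulr1 normrN1 invr1 oppr_eq0 oner_neq0 => /(_ isT).
  by congr (scales _ _); apply/funext => x /=; congr pair; ring.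
have psw : (fun x : mpt R => (x.2, x.1)) @^-1` reftri = reftri.
  by apply/seteqP; split => -[x y] [/= ? ? ?]; split => /=; lra.
have pro : (fun x : mpt R => (1 - x.1 - x.2, x.2)) @^-1` reftri = reftri.
  by apply/seteqP; split => -[x y] [/= ? ? ?]; split => /=; lra.
have sq l1 : B l1 l1 = J (fun x => aff_eval l1 x ^+ 2).
  by apply: eq_Rintegral => x _; rewrite expr2.
have m2 l1 : measurable_fun reftri (fun x : mpt R => aff_eval l1 x ^+ 2).
  by apply: measurable_funTS; apply: measurable_funX; exact: measurable_aff.
have B11 : B one one = 1 / 2.
  rewrite sq /J -[RHS]/(1%N%:R / 2%N%:R) -[RHS](@reftri_moment 0).
  by apply: eq_Rintegral => x _; rewrite e1 expr1n.
have B1X : B one X = 1 / 6.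
  rewrite /B /J -[RHS]/(1%N%:R / 6%N%:R) -[RHS](@reftri_moment 1).
  by apply: eq_Rintegral => x _; rewrite e1 eX mul1r expr1.
have BXX : B X X = 1 / 12.
  rewrite sq /J (_ : 1 / 12 = 2%N%:R / 24%N%:R :> R); last by field.
  rewrite -[RHS](@reftri_moment 2).
  by apply: eq_Rintegral => x _; rewrite eX.
have BYY : B Y Y = 1 / 12.
  rewrite sq /J (scales_Rintegral sw)//; last by move=> x _; exact: sqr_ge0.
  rewrite invr1 mul1r psw -BXX sq; apply: eq_Rintegral => x _.
  by rewrite eX eY.
have B1Y : B one Y = 1 / 6.
  rewrite /B /J (scales_Rintegral sw)//.
  - rewrite invr1 mul1r psw -B1X; apply: eq_Rintegral => x _.
    by rewrite !e1 eX eY.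
  - by apply: measurable_funTS; apply: measurable_funM; exact: measurable_aff.
  - by move=> x [_ x2 _]; rewrite e1 eY mul1r.
have BZZ : B Z Z = 1 / 12.
  rewrite sq /J (scales_Rintegral ro)//; last by move=> x _; exact: sqr_ge0.
  rewrite invr1 mul1r pro -BXX sq; apply: eq_Rintegral => x _.
  by rewrite eX eZ /=; congr (_ ^+ 2); ring.
have comb l1 (c a b : R) : B l1 (c, (a, b)) = c * B l1 one + a * B l1 X + b * B l1 Y.
  have := BZ l1 (c, (a, 0)) Y b; rewrite /= !(mulr0, mulr1, addr0, add0r) => ->.
  have := BZ l1 (c, (0, 0)) X a; rewrite /= !(mulr0, mulr1, addr0, add0r) => ->.
  have := BZ l1 (0, (0, 0)) one c; rewrite /= !(mulr0, mulr1, addr0, add0r) => ->.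
  suff -> : B l1 (0, (0, 0)) = 0 by rewrite add0r.
  have := BZ l1 (0, (0, 0)) (0, (0, 0)) 1; rewrite /= !(mulr0, addr0) => h; lra.
have sqE := bilin_sq comb BC B11 B1X B1Y BXX BYY.
have BXY : B X Y = 1 / 24.
  by move: (sqE 1 (-1) (-1)); rewrite [LHS]BZZ; lra.
case: l => [c [a b]]; rewrite -[LHS]sq sqE BXY.
by rewrite !aff_evalE /=; field.
Qed.

End RefTriangle.

(** * Affine functions and triangles *)

Section Geometry.
Variable R : realType.
Implicit Types (x y z : pt R) (l : aff R).
Notation leb := (@leb2 R).

(** Twice the signed area of the triangle. *)
Definition det3 x y z : R := (y.1 - x.1) * (z.2 - x.2) - (y.2 - x.2) * (z.1 - x.1).

Lemma ptP x y : x.1 = y.1 -> x.2 = y.2 -> x = y.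
Proof. by case: x y => [a b] [c e] /= -> ->. Qed.

Lemma ptE : ((forall x y, (x + y).1 = x.1 + y.1) * (forall x y, (x + y).2 = x.2 + y.2)) *
  ((forall (k : R) x, (k *: x).1 = k * x.1) * (forall (k : R) x, (k *: x).2 = k * x.2)) *
  ((forall x, (- x).1 = - x.1) * (forall x, (- x).2 = - x.2)).
Proof. by []. Qed.

Lemma aff_evalD l1 l2 x : aff_eval (l1.1 + l2.1, l1.2 + l2.2) x = aff_eval l1 x + aff_eval l2 x.
Proof. by rewrite /aff_eval /dot /=; ring. Qed.

Lemma aff_evalZ (k : R) l x : aff_eval (k * l.1, k *: l.2) x = k * aff_eval l x.
Proof. by rewrite /aff_eval /dot /= /GRing.scale/=; ring. Qed.

Lemma aff_evalB l x y : aff_eval l x - aff_eval l y = dot l.2 (x - y).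
Proof. by rewrite /aff_eval /dot /=; ring. Qed.

Lemma aff_eval_line l x y (t : R) :
  aff_eval l ((1 - t) *: x + t *: y) = (1 - t) * aff_eval l x + t * aff_eval l y.
Proof. by rewrite /aff_eval /dot /= /GRing.scale/=; ring. Qed.

Lemma fst_sum (I : finType) (P : pred I) (F : I -> pt R) :
  (\sum_(i | P i) F i).1 = \sum_(i | P i) (F i).1.
Proof. by elim/big_rec2: _ => // i y1 y2 _ <-. Qed.

Lemma snd_sum (I : finType) (P : pred I) (F : I -> pt R) :
  (\sum_(i | P i) F i).2 = \sum_(i | P i) (F i).2.
Proof. by elim/big_rec2: _ => // i y1 y2 _ <-. Qed.

Lemma aff_comb (I : finType) (P : pred I) (a : I -> R) (F : I -> pt R) l :
  \sum_(i | P i) a i = 1 ->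
  aff_eval l (\sum_(i | P i) a i *: F i) = \sum_(i | P i) a i * aff_eval l (F i).
Proof.
move=> a1; rewrite /aff_eval /dot fst_sum snd_sum -[in LHS](mul1r l.1) -a1 mulr_suml !mulr_sumr.
by rewrite -!big_split/=; apply: eq_bigr => i _; rewrite /GRing.scale/=; ring.
Qed.

Lemma aff_eq0 l x y z : det3 x y z != 0 ->
  aff_eval l x = 0 -> aff_eval l y = 0 -> aff_eval l z = 0 -> l = (0, (0, 0)).
Proof.
move=> D; case: l => c [a b]; rewrite /aff_eval /dot /= => lx ly lz.
have hy : a * (y.1 - x.1) + b * (y.2 - x.2) = 0 by lra.
have hz : a * (z.1 - x.1) + b * (z.2 - x.2) = 0 by lra.
have a0 : a * det3 x y z = 0.
  rewrite /det3.
  transitivity ((a * (y.1 - x.1) + b * (y.2 - x.2)) * (z.2 - x.2) -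
    (a * (z.1 - x.1) + b * (z.2 - x.2)) * (y.2 - x.2)); first by ring.
  by rewrite hy hz; ring.
have b0 : b * det3 x y z = 0.
  rewrite /det3.
  transitivity (- (a * (y.1 - x.1) + b * (y.2 - x.2)) * (z.1 - x.1) +
    (a * (z.1 - x.1) + b * (z.2 - x.2)) * (y.1 - x.1)); first by ring.
  by rewrite hy hz; ring.
move: a0 b0 => /eqP; rewrite mulf_eq0 (negbTE D) orbF => /eqP a0.
move=> /eqP; rewrite mulf_eq0 (negbTE D) orbF => /eqP b0.
by move: lx; rewrite a0 b0 !mul0r !addr0 => ->.
Qed.

Lemma aff_ext l1 l2 x y z : det3 x y z != 0 ->
  aff_eval l1 x = aff_eval l2 x -> aff_eval l1 y = aff_eval l2 y ->
  aff_eval l1 z = aff_eval l2 z -> l1 = l2.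
Proof.
move=> D hx hy hz.
have h u : aff_eval l1 u = aff_eval l2 u ->
    aff_eval (l1.1 + -1 * l2.1, l1.2 + -1 *: l2.2) u = 0.
  by move=> e; rewrite (aff_evalD l1 (_, _)) aff_evalZ e; ring.
have := aff_eq0 D (h _ hx) (h _ hy) (h _ hz).
case: l1 {hx hy hz h} => c1 [a1 b1]; case: l2 => c2 [a2 b2] /= -[].
rewrite /GRing.scale/= => ? ? ?; congr pair; last congr pair; lra.
Qed.

(** The affine function with values 0, 0, 1 at [x], [y], [z]. *)
Definition hat x y z : aff R :=
  let g := ((x.2 - y.2) / det3 x y z, (y.1 - x.1) / det3 x y z) in (- dot g x, g).

Lemma hatP x y z : det3 x y z != 0 ->
  [/\ aff_eval (hat x y z) x = 0, aff_eval (hat x y z) y = 0 & aff_eval (hat x y z) z = 1].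
Proof.
rewrite /hat /aff_eval /dot /det3 /= => D; split; first by ring.
  by field.
by field.
Qed.

Lemma det3_rot x y z : det3 y z x = det3 x y z.
Proof. by rewrite /det3; ring. Qed.

Lemma det3_swap x y z : det3 y x z = - det3 x y z.
Proof. by rewrite /det3; ring. Qed.

(** Described by barycentric coordinates: half-planes are measurable and are easily
    pulled back to the reference triangle. *)
Definition triangle x y z : set (mpt R) :=
  [set u | [/\ 0 <= aff_eval (hat y z x) u, 0 <= aff_eval (hat z x y) u
             & 0 <= aff_eval (hat x y z) u]].

Lemma measurable_triangle x y z : measurable (triangle x y z).
Proof.
rewrite (_ : triangle x y z = [set u | 0 <= aff_eval (hat y z x) u] `&`
  ([set u | 0 <= aff_eval (hat z x y) u] `&` [set u | 0 <= aff_eval (hat x y z) u])).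
  by apply: measurableI; [|apply: measurableI]; exact: measurable_aff_ge0.
by apply/seteqP; split => u; [move=> [? ? ?]|move=> [? []]].
Qed.

Lemma hat_comb x y z u : det3 x y z != 0 ->
  aff_eval (hat y z x) u + aff_eval (hat z x y) u + aff_eval (hat x y z) u = 1 /\
  u = aff_eval (hat y z x) u *: x + aff_eval (hat z x y) u *: y + aff_eval (hat x y z) u *: z.
Proof.
move=> D; rewrite /hat (det3_rot y z x) (det3_rot x y z).
move: D; rewrite /det3 => D; split; first by rewrite /aff_eval /dot /=; field.
by apply: ptP; rewrite !ptE /aff_eval /dot /=; field.
Qed.

(** The midpoint rule for squares. Both sides are invariant under affine changes of
    variables, which reduces it to the reference triangle. *)
Lemma triangle_sq x y z l : det3 x y z != 0 ->
  \int[leb]_(u in triangle x y z) (aff_eval l u ^+ 2) =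
  `|det3 x y z| / 2 / 3 * (((aff_eval l x + aff_eval l y) / 2) ^+ 2 +
     ((aff_eval l y + aff_eval l z) / 2) ^+ 2 + ((aff_eval l z + aff_eval l x) / 2) ^+ 2).
Proof.
move=> D.
pose f (u : mpt R) : mpt R := ((y.1 - x.1) * u.1 + (z.1 - x.1) * u.2 + x.1,
  (y.2 - x.2) * u.1 + (z.2 - x.2) * u.2 + x.2).
have sf : scales f `|det3 x y z|^-1.
  have := @scales_affine R (y.1 - x.1) (z.1 - x.1) (y.2 - x.2) (z.2 - x.2) x.1 x.2.
  have -> : (y.1 - x.1) * (z.2 - x.2) - (z.1 - x.1) * (y.2 - x.2) = det3 x y z.
    by rewrite /det3; ring.
  exact.
rewrite (scales_Rintegral sf)//; first last.
- by move=> u _; exact: sqr_ge0.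
- by apply: measurable_funTS; apply: measurable_funX; exact: measurable_aff.
- exact: measurable_triangle.
- by rewrite invr_gt0 normr_gt0.
have -> : f @^-1` triangle x y z = @reftri R.
  have e1 u : aff_eval (hat z x y) (f u) = u.1.
    rewrite /hat (det3_rot y z x) (det3_rot x y z) /f /aff_eval /dot /=.
    by move: D; rewrite /det3 => D; field.
  have e2 u : aff_eval (hat x y z) (f u) = u.2.
    by rewrite /hat /f /aff_eval /dot /=; move: D; rewrite /det3 => D; field.
  have e0 u : aff_eval (hat y z x) (f u) = 1 - u.1 - u.2.
    by have [] := hat_comb (f u) D; rewrite e1 e2 => <- _; ring.
  by apply/seteqP; split => u; rewrite /triangle /reftri /= e0 e1 e2 => -[? ? ?]; split; lra.
pose l' : aff R := (aff_eval l x, (dot l.2 (y - x), dot l.2 (z - x))).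
have lf u : aff_eval l (f u) = aff_eval l' u by rewrite /f /l' /aff_eval /dot /=; ring.
transitivity (`|det3 x y z| * \int[leb]_(u in @reftri R) (aff_eval l' u ^+ 2)).
  rewrite invrK; congr (_ * _); apply: eq_Rintegral => u _.
  by rewrite lf.
rewrite reftri_sq -!lf.
have -> : f (0, 0) = x by rewrite /f /= !mulr0 !add0r; case: (x).
have -> : f (1, 0) = y by rewrite /f /= !mulr0 !mulr1 !addr0 !subrK; case: (y).
have -> : f (0, 1) = z by rewrite /f /= !mulr0 !mulr1 !add0r !subrK; case: (z).
by field.
Qed.
End Geometry.

(** * The Euclidean norm and barycentric coordinates *)

Section PlaneNorm.
Variable R : realType.
Implicit Types x y z : pt R.

Lemma dotC x y : dot x y = dot y x.
Proof. by rewrite /dot; ring. Qed.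
Lemma dotDl x y z : dot (x + y) z = dot x z + dot y z.
Proof. by rewrite /dot !ptE; ring. Qed.
Lemma dotDr x y z : dot z (x + y) = dot z x + dot z y.
Proof. by rewrite /dot !ptE; ring. Qed.
Lemma dotZl (k : R) x y : dot (k *: x) y = k * dot x y.
Proof. by rewrite /dot !ptE; ring. Qed.
Lemma dotZr (k : R) x y : dot x (k *: y) = k * dot x y.
Proof. by rewrite /dot !ptE; ring. Qed.
Lemma dotNl x y : dot (- x) y = - dot x y.
Proof. by rewrite /dot !ptE; ring. Qed.
Lemma dotNr x y : dot x (- y) = - dot x y.
Proof. by rewrite /dot !ptE; ring. Qed.
Lemma dot0l x : dot 0 x = 0 :> R.
Proof. by rewrite /dot /= !mul0r addr0. Qed.
Lemma dot_ge0 x : 0 <= dot x x.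
Proof. by rewrite /dot -!expr2 addr_ge0// sqr_ge0. Qed.
Lemma dot_eq0 x : dot x x = 0 -> x = 0.
Proof.
by rewrite /dot -!expr2 => /eqP; rewrite paddr_eq0 ?sqr_ge0// !sqrf_eq0 => /andP[/eqP ? /eqP ?]; exact: ptP.
Qed.
Lemma enorm_sq x : enorm x ^+ 2 = dot x x.
Proof. by rewrite sqr_sqrtr ?dot_ge0. Qed.
Lemma enorm_ge0 x : 0 <= enorm x.
Proof. exact: sqrtr_ge0. Qed.
Lemma enorm_gt0 x : x != 0 -> 0 < enorm x.
Proof.
move=> x0; rewrite sqrtr_gt0 lt_neqAle dot_ge0 andbT eq_sym.
by apply: contra_neq x0 => /dot_eq0.
Qed.
Lemma enormN x : enorm (- x) = enorm x.
Proof. by rewrite /enorm dotNl dotNr opprK. Qed.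
Lemma enormB x y : enorm (x - y) = enorm (y - x).
Proof. by rewrite -enormN opprB. Qed.
Lemma enormZ (k : R) x : enorm (k *: x) = `|k| * enorm x.
Proof. by rewrite /enorm dotZl dotZr mulrA -expr2 sqrtrM ?sqr_ge0// sqrtr_sqr. Qed.
Lemma dot_sq_le x y : dot x y ^+ 2 <= dot x x * dot y y.
Proof.
rewrite -subr_ge0 (_ : _ - _ = (x.1 * y.2 - x.2 * y.1) ^+ 2) ?sqr_ge0//.
by rewrite /dot; ring.
Qed.
Lemma dot_le x y : `|dot x y| <= enorm x * enorm y.
Proof.
rewrite -(ler_pXn2r (n := 2)) ?nnegrE ?mulr_ge0 ?enorm_ge0// exprMn !enorm_sq.
by rewrite real_normK ?num_real// dot_sq_le.
Qed.
Lemma enormD x y : enorm (x + y) <= enorm x + enorm y.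
Proof.
rewrite -(ler_pXn2r (n := 2)) ?nnegrE ?addr_ge0 ?enorm_ge0//.
rewrite enorm_sq sqrrD !enorm_sq !dotDl !dotDr (dotC y x).
have := le_trans (ler_norm _) (dot_le x y); lra.
Qed.
Lemma enorm_coord x : `|x.1| <= enorm x /\ `|x.2| <= enorm x.
Proof.
split; rewrite -(ler_pXn2r (n := 2)) ?nnegrE ?enorm_ge0// enorm_sq real_normK ?num_real// /dot -!expr2.
  by rewrite lerDl sqr_ge0.
by rewrite lerDr sqr_ge0.
Qed.
Lemma enorm_sum (I : finType) (P : pred I) (F : I -> pt R) :
  enorm (\sum_(i | P i) F i) <= \sum_(i | P i) enorm (F i).
Proof.
elim/big_rec2: _ => [|i y1 y2 _ h]; last by rewrite (le_trans (enormD _ _))// lerD2l.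
by rewrite /enorm dot0l sqrtr0.
Qed.
End PlaneNorm.

Section Cell.
Variables (R : realType) (M : mesh R).
Notation V := 'I_(nv M).
Notation leb := (@leb2 R).
Implicit Types (K S : sx M) (a b c v w : V) (l : aff R) (x y : pt R).
Local Notation pos := (@pos R M).

(** The determinant excludes degenerate triangles. *)
Definition vertices K a b c :=
  [/\ K = [set a; b; c]%SET, uniq [:: a; b; c] & det3 (pos a) (pos b) (pos c) != 0].

Definition is_triangle K := exists a b c, vertices K a b c.

Lemma verticesC K a b c : vertices K a b c -> vertices K b c a.
Proof.
move=> [-> u d]; split; last by rewrite det3_rot.
  by apply/setP => v; rewrite !inE -orbA orbC.
by move: u; rewrite /= !inE !negb_or !andbT (eq_sym b a) (eq_sym c a) => /andP[/andP[-> ->] ->].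
Qed.

Lemma in_vertices K a b c : vertices K a b c -> [/\ a \in K, b \in K & c \in K].
Proof. by move=> [-> _ _]; rewrite !inE !eqxx !orbT. Qed.

Lemma big_vertices K a b c (T : nmodType) (F : V -> T) : vertices K a b c ->
  \sum_(v in K) F v = F a + F b + F c.
Proof.
move=> [-> u _]; move: u; rewrite /= !inE !andbT negb_or => /andP[/andP[ab ac] bc].
rewrite (big_setD1 c) /=; last by rewrite !inE eqxx !orbT.
rewrite (_ : _ :\ c = [set a; b])%SET; last first.
  apply/setP => v; rewrite !inE; case: eqVneq => [->|_] /=; last by rewrite orbF.
  by rewrite eq_sym (negbTE ac) eq_sym (negbTE bc).
by rewrite big_setU1 /= ?inE// big_set1 addrC.
Qed.

(** The barycentric coordinate of the vertex [v]. *)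
Definition bary K v : aff R :=
  get [set l : aff R | forall w, w \in K -> aff_eval l (pos w) = (w == v)%:R].

Lemma aff_ext_cell K l1 l2 : is_triangle K ->
  (forall w, w \in K -> aff_eval l1 (pos w) = aff_eval l2 (pos w)) -> l1 = l2.
Proof.
move=> [a [b [c h]]] e; have [aK bK cK] := in_vertices h.
by case: h => _ _ D; apply: (aff_ext D); exact: e.
Qed.

Lemma hat_vertices K a b c w : vertices K a b c -> w \in K ->
  aff_eval (hat (pos a) (pos b) (pos c)) (pos w) = (w == c)%:R.
Proof.
move=> [-> u D]; have [h1 h2 h3] := hatP D.
move: u; rewrite /= !inE !andbT negb_or => /andP[/andP[ab ac] bc].
by case/orP => [/orP[]|] /eqP->; rewrite ?h1 ?h2 ?h3 ?eqxx ?(negbTE ac) ?(negbTE bc).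
Qed.

Lemma baryP K v w : is_triangle K -> v \in K -> w \in K ->
  aff_eval (bary K v) (pos w) = (w == v)%:R.
Proof.
move=> [a [b [c h]]] vK.
suff E : exists l, [set l : aff R | forall w, w \in K -> aff_eval l (pos w) = (w == v)%:R] l.
  by move=> wK; exact: (getPex E).
have h' := verticesC h; have h'' := verticesC h'.
have : v \in [set a; b; c]%SET by case: h => <-.
rewrite !inE => /orP[/orP[]|] /eqP->.
- by exists (hat (pos b) (pos c) (pos a)) => u uK; exact: hat_vertices h' uK.
- by exists (hat (pos c) (pos a) (pos b)) => u uK; exact: hat_vertices h'' uK.
- by exists (hat (pos a) (pos b) (pos c)) => u uK; exact: hat_vertices h uK.
Qed.

Lemma bary_hat K a b c : vertices K a b c -> bary K c = hat (pos a) (pos b) (pos c).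
Proof.
move=> h; have nK : is_triangle K by exists a, b, c.
have [_ _ cK] := in_vertices h.
by apply: (aff_ext_cell nK) => w wK; rewrite baryP// (hat_vertices h).
Qed.

Lemma bary_sum1 K x : is_triangle K -> \sum_(v in K) aff_eval (bary K v) x = 1.
Proof.
move=> [a [b [c h]]]; have h' := verticesC h; have h'' := verticesC h'.
rewrite (big_vertices _ h) (bary_hat h) (bary_hat h') (bary_hat h'').
by case: h => _ _ D; have [] := hat_comb x D.
Qed.

Lemma bary_pos K x : is_triangle K -> \sum_(v in K) aff_eval (bary K v) x *: pos v = x.
Proof.
move=> [a [b [c h]]]; have h' := verticesC h; have h'' := verticesC h'.
rewrite (big_vertices _ h) (bary_hat h) (bary_hat h') (bary_hat h'').
by case: h => _ _ D; have [] := hat_comb x D.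
Qed.

Lemma aff_bary K l x : is_triangle K ->
  aff_eval l x = \sum_(v in K) aff_eval (bary K v) x * aff_eval l (pos v).
Proof. by move=> nK; rewrite -{1}(bary_pos x nK) aff_comb// bary_sum1. Qed.

Lemma bary_comb K S (t : V -> R) w : is_triangle K -> S \subset K -> w \in K ->
  \sum_(v in S) t v = 1 ->
  aff_eval (bary K w) (\sum_(v in S) t v *: pos v) = if w \in S then t w else 0.
Proof.
move=> nK SK wK t1; rewrite aff_comb//.
case: ifPn => wS.
  rewrite (big_setD1 w wS) /= baryP// eqxx mulr1 big1 ?addr0// => v; rewrite !inE => /andP[vw vS].
  by rewrite (baryP nK wK (fintype.subsetP SK v vS)) (negbTE vw) mulr0.
rewrite big1// => v vS; rewrite (baryP nK wK (fintype.subsetP SK v vS)).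
by case: eqP => [e|]; rewrite ?mulr0//; move: wS; rewrite -e vS.
Qed.

Lemma bary_face K S x : is_triangle K -> S \subset K ->
  (forall v, v \in K -> v \notin S -> aff_eval (bary K v) x = 0) ->
  \sum_(v in S) aff_eval (bary K v) x = 1 /\
  x = \sum_(v in S) aff_eval (bary K v) x *: pos v.
Proof.
move=> nK SK x0.
have KS : forall (T : nmodType) (F : V -> T), (forall v, v \in K -> v \notin S -> F v = 0) ->
    \sum_(v in K) F v = \sum_(v in S) F v.
  move=> T F F0; rewrite (big_setID S)/= (finset.setIidPr SK) [X in _ + X]big1 ?addr0//.
  by move=> v; rewrite inE => /andP[vS vK]; exact: F0.
split; first by rewrite -(bary_sum1 x nK) KS.
by rewrite -KS ?bary_pos// => v vK vS; rewrite x0// scale0r.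
Qed.

Lemma simplex_bary K S x : is_triangle K -> S \subset K ->
  simplex S x <-> (forall v, v \in K -> 0 <= aff_eval (bary K v) x) /\
                 (forall v, v \in K -> v \notin S -> aff_eval (bary K v) x = 0).
Proof.
move=> nK SK; split=> [[t [t0 t1 ->]]|[x0 xS]].
  split=> v vK; rewrite bary_comb//; first by case: ifPn => // /t0.
  by move=> /negbTE ->.
have [e1 e2] := bary_face nK SK xS.
by exists (fun v => aff_eval (bary K v) x); split => // v vS; rewrite x0// (fintype.subsetP SK).
Qed.

Lemma osimplex_bary K S x : is_triangle K -> S \subset K ->
  osimplex S x <-> (forall v, v \in S -> 0 < aff_eval (bary K v) x) /\
                  (forall v, v \in K -> v \notin S -> aff_eval (bary K v) x = 0).
Proof.
move=> nK SK; split=> [[t [t0 t1 ->]]|[x0 xS]].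
  split=> v vS; first by rewrite bary_comb ?(fintype.subsetP SK)// vS t0.
  by move=> /negbTE vS'; rewrite bary_comb// vS'.
have [e1 e2] := bary_face nK SK xS.
by exists (fun v => aff_eval (bary K v) x).
Qed.

Lemma cell_simplexP K x : is_triangle K ->
  simplex K x <-> forall v, v \in K -> 0 <= aff_eval (bary K v) x.
Proof.
move=> nK; rewrite (@simplex_bary K K)//; split=> [[]//|h]; split => // v -> //.
Qed.

Lemma cell_osimplexP K x : is_triangle K ->
  osimplex K x <-> forall v, v \in K -> 0 < aff_eval (bary K v) x.
Proof.
move=> nK; rewrite (@osimplex_bary K K)//; split=> [[]//|h]; split => // v -> //.
Qed.

Lemma osimplexS S : @osimplex R M S `<=` simplex S.
Proof. by move=> x [t [t0 t1 e]]; exists t; split => // v /t0/ltW. Qed.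

Lemma simplex_vertex S v : v \in S -> simplex S (pos v).
Proof.
move=> vS; exists (fun w => (w == v)%:R); split => //.
- by rewrite (big_setD1 v vS) /= eqxx big1 ?addr0// => w; rewrite !inE => /andP[/negbTE->].
- rewrite (big_setD1 v vS) /= eqxx scale1r big1 ?addr0// => w.
  by rewrite !inE => /andP[/negbTE-> _]; rewrite scale0r.
Qed.

Lemma cell_triangle K a b c : vertices K a b c ->
  simplex K = triangle (pos a) (pos b) (pos c).
Proof.
move=> h; have h' := verticesC h; have h'' := verticesC h'.
have nK : is_triangle K by exists a, b, c.
have [aK bK cK] := in_vertices h.
apply/seteqP; split => x; rewrite cell_simplexP// /triangle/=.
  by move=> x0; rewrite -(bary_hat h) -(bary_hat h') -(bary_hat h''); split; apply: x0.
rewrite -(bary_hat h) -(bary_hat h') -(bary_hat h'') => -[? ? ?] v vK.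
have : v \in [set a; b; c]%SET by case: h => <-.
by rewrite !inE => /orP[/orP[]|] /eqP->.
Qed.

Lemma measurable_cell K : is_triangle K -> measurable (simplex K : set (mpt R)).
Proof. by move=> [a [b [c h]]]; rewrite (cell_triangle h); exact: measurable_triangle. Qed.

Lemma aff_midpoint (a b : V) l : a != b ->
  aff_eval l (midpoint [set a; b]%SET) = (aff_eval l (pos a) + aff_eval l (pos b)) / 2.
Proof.
move=> ab; rewrite /midpoint big_setU1 ?inE//= big_set1 /aff_eval /dot !ptE.
by field.
Qed.

(** An affine change of variables makes the line vertical, hence a product with a
    point. *)
Lemma null_line l x : aff_eval l x != 0 -> leb [set u : mpt R | aff_eval l u = 0] = 0%E.
Proof.
case: l => c [a b] lx.
have key (f : mpt R -> mpt R) r : scales f r -> 0 < r ->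
    f @^-1` [set u | aff_eval (c, (a, b)) u = 0] = ([set 0] `*` setT) ->
    leb [set u : mpt R | aff_eval (c, (a, b)) u = 0] = 0%E.
  move=> [_ sf] r0 e; have := sf _ (measurable_aff_eq0 (c, (a, b))).
  rewrite e => /esym.
  rewrite [X in _ = X -> _]product_measure1E//= lebesgue_measure_set1 mul0e.
  by move/eqP; rewrite mule_eq0 eqe (gt_eqF r0)/= => /eqP.
have [a0|a0] := eqVneq a 0; last first.
  apply: (key _ _ (@scales_affine R a^-1 (- b / a) 0 1 (- c / a) 0 _)).
  - by rewrite mulr0 subr0 mulr1 invr_eq0.
  - by rewrite mulr0 subr0 mulr1 invr_gt0 normr_gt0 invr_eq0.
  - apply/seteqP; split => u; rewrite /aff_eval /dot /=.
      by move=> h; split => //; rewrite -[RHS]h; field.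
    by move=> [-> _]; field.
have [b0|b0] := eqVneq b 0.
  move: lx; rewrite a0 b0 /aff_eval /dot /= !mul0r !addr0 => c0.
  rewrite (_ : [set u | _] = set0) ?measure0//; apply/seteqP; split => u //=.
  by rewrite !mul0r !addr0 => /eqP; rewrite (negbTE c0).
apply: (key _ _ (@scales_affine R 0 1 b^-1 0 0 (- c / b) _)).
- by rewrite mul0r sub0r mul1r oppr_eq0 invr_eq0.
- by rewrite mul0r sub0r mul1r invr_gt0 normrN normr_gt0 invr_eq0.
- apply/seteqP; split => u; rewrite /aff_eval /dot /= a0.
    by move=> h; split => //; rewrite -[RHS]h; field.
  by move=> [-> _]; field.
Qed.

Lemma bary_null K v : is_triangle K -> v \in K ->
  leb [set u : mpt R | aff_eval (bary K v) u = 0] = 0%E.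
Proof. by move=> nK vK; apply: (@null_line _ (pos v)); rewrite baryP// eqxx oner_neq0. Qed.

End Cell.

(** * The midpoint rule *)

Section CellQuad.
Variables (R : realType) (M : mesh R).
Notation V := 'I_(nv M).
Notation leb := (@leb2 R).
Implicit Types (K S sg : sx M) (a b c v w : V) (l : aff R) (x y : pt R).
Local Notation pos := (@pos R M).

Lemma card_vertices K a b c : vertices K a b c -> #|K| = 3%N.
Proof.
move=> [-> u _]; move: u; rewrite /= !inE !andbT negb_or => /andP[/andP[ab ac] bc].
by rewrite -finset.setUA cardsU1 cards2 !inE negb_or ab ac bc.
Qed.

Lemma card_triangle K : is_triangle K -> #|K| = 3%N.
Proof. by move=> [a [b [c h]]]; exact: card_vertices h. Qed.

Lemma cell_edgesE K : is_triangle K -> cell_edges K = [set (K :\ o)%SET | o in K]%SET.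
Proof.
move=> nK; have K3 := card_triangle nK.
apply/setP => sg; rewrite !inE; apply/andP/imsetP => [[/eqP s2 sK]|[w wK ->]]; last first.
  rewrite finset.subD1set; split=> //; apply/eqP.
  by move: (cardsD1 w K); rewrite wK K3 add1n => -[].
have : #|(K :\: sg)%SET| == 1%N by rewrite cardsD (finset.setIidPr sK) K3 s2.
move=> /cards1P[w Ko]; have : w \in (K :\: sg)%SET by rewrite Ko finset.set11.
rewrite inE => /andP[os oK]; exists w => //; apply/setP => v.
rewrite !inE; move/setP: Ko => /(_ v); rewrite !inE => <-.
by have /implyP := fintype.subsetP sK v; case: (v \in sg); case: (v \in K).
Qed.

Lemma big_cell_edges K (F : sx M -> R) : is_triangle K ->
  \sum_(sg in cell_edges K) F sg = \sum_(o in K) F (K :\ o)%SET.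
Proof.
move=> nK; rewrite cell_edgesE// big_imset//= => u v uK vK e.
apply/eqP; have /setP/(_ u) := e; rewrite !inE eqxx /= uK andbT => /esym/negbFE.
by rewrite eq_sym.
Qed.

Lemma edge_vertices K a b c : vertices K a b c -> (K :\ c)%SET = [set a; b]%SET.
Proof.
move=> [-> u _]; move: u; rewrite /= !inE !andbT negb_or => /andP[/andP[ab ac] bc].
apply/setP => v; rewrite !inE; case: eqVneq => [->|_] /=; last by rewrite orbF.
by rewrite eq_sym (negbTE ac) eq_sym (negbTE bc).
Qed.

Lemma vertices_neq K a b c : vertices K a b c -> [/\ a != b, b != c & c != a].
Proof.
move=> [_ u _]; move: u; rewrite /= !inE !andbT negb_or => /andP[/andP[ab ac] bc].
by rewrite (eq_sym c).
Qed.

Lemma simplex_bounded S x : simplex S x ->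
  `|x.1| <= \sum_(v in S) enorm (pos v) /\ `|x.2| <= \sum_(v in S) enorm (pos v).
Proof.
move=> [t [t0 t1 ->]].
have h : enorm (\sum_(v in S) t v *: pos v) <= \sum_(v in S) enorm (pos v).
  apply: (le_trans (enorm_sum _ _)); apply: ler_sum => v vS.
  rewrite enormZ ger0_norm ?t0// ler_piMl ?enorm_ge0//.
  by rewrite -t1 (big_setD1 v vS)/= lerDl sumr_ge0// => w; rewrite inE => /andP[_ /t0].
by have [h1 h2] := enorm_coord (\sum_(v in S) t v *: pos v); split; exact: le_trans h.
Qed.

Lemma integrable_cell K l l' : is_triangle K ->
  leb.-integrable (simplex K) (EFin \o (fun x => aff_eval l x * aff_eval l' x)).
Proof.
by move=> nK; apply: integrable_aff2; [exact: measurable_cell|exact: simplex_bounded].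
Qed.

Lemma leb_cell_fin K : is_triangle K -> (leb (simplex K) < +oo)%E.
Proof.
move=> nK; apply: (le_lt_trans (leb_bounded (measurable_cell nK) (@simplex_bounded K))).
by rewrite ltry.
Qed.

Lemma leb_cell K : is_triangle K -> leb (simplex K) = (area K)%:E.
Proof. by move=> nK; rewrite /area fineK// ge0_fin_numE// leb_cell_fin. Qed.

Lemma area_vertices K a b c : vertices K a b c ->
  area K = `|det3 (pos a) (pos b) (pos c)| / 2.
Proof.
move=> h; have nK : is_triangle K by exists a, b, c.
have [_ _ D] := h; have := triangle_sq (1, (0, 0)) D.
rewrite -(cell_triangle h) !aff_evalE !mul0r !addr0.
rewrite (_ : \int[leb]_(u in _) _ = area K); first by move=> ->; field.
transitivity (\int[leb]_(u in simplex K) (cst 1 u : R)).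
  by apply: eq_Rintegral => x _; rewrite aff_evalE !mul0r !addr0 expr1n.
by rewrite Rintegral_cst ?mul1r//; exact: measurable_cell.
Qed.

Lemma area_gt0 K : is_triangle K -> 0 < area K.
Proof.
move=> [a [b [c h]]]; rewrite (area_vertices h) divr_gt0// normr_gt0.
by case: h.
Qed.

(** Polarisation turns [triangle_sq] into the midpoint rule for products of two
    affine functions. *)
Lemma cell_quad K l l' : is_triangle K ->
  \int[leb]_(x in simplex K) (aff_eval l x * aff_eval l' x) =
  area K / 3 * \sum_(sg in cell_edges K)
     (aff_eval l (midpoint sg) * aff_eval l' (midpoint sg)).
Proof.
move=> nK; rewrite big_cell_edges//; have [a [b [c h]]] := nK.
have h' := verticesC h; have h'' := verticesC h'.
have [ab bc ca] := vertices_neq h.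
rewrite (big_vertices _ h) (edge_vertices h) (edge_vertices h') (edge_vertices h'').
rewrite !aff_midpoint// (area_vertices h).
have [_ _ D] := h.
have mK := measurable_cell nK.
pose lp : aff R := (l.1 + l'.1, l.2 + l'.2); pose lm : aff R := (l.1 + -1 * l'.1, l.2 + -1 *: l'.2).
have Ep x : aff_eval lp x = aff_eval l x + aff_eval l' x by exact: aff_evalD.
have Em x : aff_eval lm x = aff_eval l x - aff_eval l' x.
  by rewrite (aff_evalD l (_, _)) aff_evalZ mulN1r.
have i2 l1 : leb.-integrable (simplex K) (EFin \o (fun x => aff_eval l1 x ^+ 2)).
  by rewrite (_ : (fun x => _) = (fun x => aff_eval l1 x * aff_eval l1 x)) ?integrable_cell.
transitivity (4^-1 * (\int[leb]_(x in simplex K) (aff_eval lp x ^+ 2) -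
    \int[leb]_(x in simplex K) (aff_eval lm x ^+ 2))).
  rewrite -RintegralB// -RintegralZl//; last exact: (integrableB mK (i2 lp) (i2 lm)).
  by apply: eq_Rintegral => x _; rewrite Ep Em; field.
rewrite (cell_triangle h) !triangle_sq// !Ep !Em.
by field.
Qed.

(** * Acute triangles *)

Lemma angle_acute (x y z : pt R) : angle x y z < pi / 2 -> 0 < dot (y - x) (z - x).
Proof.
rewrite /angle; set t := _ / _ => tpi.
have n0 : 0 <= enorm (y - x) * enorm (z - x) by rewrite mulr_ge0 ?enorm_ge0.
have [n00|nn0] := eqVneq (enorm (y - x) * enorm (z - x)) 0.
  move: tpi; rewrite /t n00 invr0 mulr0 acos0 ltxx//.
have np : 0 < enorm (y - x) * enorm (z - x) by rewrite lt_neqAle eq_sym nn0.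
have t1 : -1 <= t <= 1.
  by rewrite -ler_norml normrM normfV (gtr0_norm np) ler_pdivrMr// mul1r dot_le.
have : 0 < cos (acos t).
  apply: cos_gt0_pihalf; rewrite tpi andbT (lt_le_trans _ (acos_ge0 t1))//.
  by rewrite oppr_lt0 divr_gt0 ?pi_gt0.
by rewrite acosK// pmulr_lgt0// invr_gt0.
Qed.

(** Each factor of a product on the right is the scalar product at one vertex: the
    square of the area is controlled from below by the acute angles. *)
Lemma det3_sq (x y z : pt R) : det3 x y z ^+ 2 =
  dot (y - x) (z - x) * dot (x - y) (z - y) + dot (x - y) (z - y) * dot (x - z) (y - z) +
  dot (x - z) (y - z) * dot (y - x) (z - x).
Proof. by rewrite /det3 /dot !ptE; ring. Qed.

(** The squared length of a side is the sum of the scalar products at its two ends,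
    so the area is bounded below through [det3_sq]. *)
Lemma acute_det (x y z : pt R) (e : R) : 0 < dot (y - x) (z - x) -> 0 < dot (x - y) (z - y) ->
  0 < dot (x - z) (y - z) -> 0 <= e -> e <= enorm (x - y) -> e <= enorm (y - z) ->
  e <= enorm (z - x) -> e ^+ 2 <= 2 * `|det3 x y z|.
Proof.
move=> dx dy dz e0 exy eyz ezx.
have sq (u u' : pt R) : e <= enorm (u - u') -> e ^+ 2 <= dot (u - u') (u - u').
  by move=> h; rewrite -enorm_sq ler_pXn2r ?nnegrE ?enorm_ge0.
have hxy : e ^+ 2 <= dot (y - x) (z - x) + dot (x - y) (z - y).
  by rewrite (le_trans (sq _ _ exy))// le_eqVlt; apply/orP; left; apply/eqP; rewrite /dot !ptE; ring.
have hyz : e ^+ 2 <= dot (x - y) (z - y) + dot (x - z) (y - z).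
  by rewrite (le_trans (sq _ _ eyz))// le_eqVlt; apply/orP; left; apply/eqP; rewrite /dot !ptE; ring.
have hzx : e ^+ 2 <= dot (x - z) (y - z) + dot (y - x) (z - x).
  by rewrite (le_trans (sq _ _ ezx))// le_eqVlt; apply/orP; left; apply/eqP; rewrite /dot !ptE; ring.
rewrite -(ler_pXn2r (n := 2)) ?nnegrE ?mulr_ge0 ?sqr_ge0// [(2 * _) ^+ 2]exprMn real_normK ?num_real// det3_sq.
have e20 := sqr_ge0 e.
move: hxy hyz hzx e20 dx dy dz; move: (dot (y - x) _) (dot (x - y) _) (dot (x - z) _) (e ^+ 2).
move=> A B C E hAB hBC hCA E0 A0 B0 C0.
(* Three numbers whose pairwise sums are at least [E]: two of them are at least [E / 2]. *)
have two (p q r : R) : 0 < p -> 0 < q -> 0 < r -> E / 2 <= p -> E / 2 <= q ->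
    E ^+ 2 <= 2 ^+ 2 * (p * q + q * r + r * p).
  move=> p0 q0 r0 hp hq.
  have h1 : E / 2 * (E / 2) <= p * q by apply: ler_pM => //; lra.
  have h2 : 0 < q * r by exact: mulr_gt0.
  have h3 : 0 < r * p by exact: mulr_gt0.
  rewrite !expr2; lra.
have [hA|hA] := leP (E / 2) A; have [hB|hB] := leP (E / 2) B.
- exact: two.
- have hC : E / 2 <= C by lra.
  by rewrite (_ : A * B + _ + _ = C * A + A * B + B * C); [exact: two|ring].
- have hC : E / 2 <= C by lra.
  by rewrite (_ : A * B + _ + _ = B * C + C * A + A * B); [exact: two|ring].
- lra.
Qed.

End CellQuad.

(** * How the triangles fit together *)

Section PlaneTopology.
Variable R : realType.
Implicit Types (x y z u : pt R) (l : aff R).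

Lemma near_box (P : set (pt R)) x : (\forall y \near x, P y) <->
  exists2 e : R, 0 < e & forall y, `|y.1 - x.1| < e -> `|y.2 - x.2| < e -> P y.
Proof.
split=> [/nbhs_ballP[e /= e0 h]|[e e0 h]].
  by exists e => // y y1 y2; apply: h; split; rewrite /ball/= distrC.
apply/nbhs_ballP; exists e => //= y [y1 y2].
by apply: h; rewrite distrC.
Qed.

Lemma aff_continuous l : continuous (aff_eval l : pt R -> R).
Proof.
move=> x; apply: cvgD; first exact: cvg_cst.
by apply: cvgD; apply: cvgM; (try exact: cvg_cst); [exact: cvg_fst|exact: cvg_snd].
Qed.

Lemma near_aff_gt0 l x : 0 < aff_eval l x -> \forall y \near x, 0 < aff_eval l y.
Proof. by move=> lx; exact: cvgr_gt (@aff_continuous l x) _ lx. Qed.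

Lemma near_aff_lt0 l x : aff_eval l x < 0 -> \forall y \near x, aff_eval l y < 0.
Proof. by move=> lx; exact: cvgr_lt (@aff_continuous l x) _ lx. Qed.

(** The form in which openness is used: a point can be moved a little in any
    direction. *)
Lemma near_line (P : set (pt R)) z u : (\forall y \near z, P y) ->
  exists2 e : R, 0 < e <= 1 & P (z + e *: u).
Proof.
move=> /near_box[d d0 h].
pose s : R := 1 + `|u.1| + `|u.2|.
have s0 : 0 < s by rewrite /s -addrA ltr_pwDl// addr_ge0.
have e0 : 0 < Num.min 1 (d / (2 * s)) by rewrite lt_min ltr01 divr_gt0// mulr_gt0.
exists (Num.min 1 (d / (2 * s))); first by rewrite e0 ge_min lexx.
have key (a : R) : `|a| <= s -> `|Num.min 1 (d / (2 * s)) * a| < d.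
  move=> ha; rewrite normrM gtr0_norm//.
  apply: (@le_lt_trans _ _ (d / (2 * s) * s)).
    by apply: ler_pM => //; [exact: ltW|rewrite ge_min lexx orbT].
  by rewrite (_ : d / (2 * s) * s = d / 2); [lra|field; rewrite gt_eqF].
have h0 := normr_ge0 u.1; have h1 := normr_ge0 u.2.
by apply: h; rewrite !ptE addrAC subrr add0r key// /s; lra.
Qed.
End PlaneTopology.

Section MeshTopology.
Variables (R : realType) (Om : set (pt R)) (M : mesh R).
Notation V := 'I_(nv M).
Implicit Types (K L S sg : sx M) (a b c v w : V) (l : aff R) (x y z : pt R).
Local Notation pos := (@pos R M).
Hypothesis hOm : bounded_polygonal_domain Om.
Hypothesis hM : acute_mesh Om M.

Lemma acute_vertices K : K \in cells M -> exists a b c,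
  [/\ vertices K a b c, 0 < dot (pos b - pos a) (pos c - pos a),
     0 < dot (pos a - pos b) (pos c - pos b) & 0 < dot (pos a - pos c) (pos b - pos c)].
Proof.
move=> KM; have [_ h3 _ _ ha] := hM; have := h3 _ KM.
move=> K3; have [a [b [c [ab bc ca Kabc]]]] : exists a b c,
    [/\ a != b, b != c, c != a & K = [set a; b; c]%SET].
  move: (enum_uniq K) (mem_enum K) (cardE K); rewrite K3.
  case: (enum K) => [|a [|b [|c [|? ?]]]]//= u mK _; exists a, b, c.
  move: u; rewrite !inE !andbT negb_or => /andP[/andP[ab ac] bc]; rewrite (eq_sym c); split => //.
  by apply/setP => v; rewrite -mK !inE orbA.
have [aK bK cK] : [/\ a \in K, b \in K & c \in K] by rewrite Kabc !inE !eqxx !orbT.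
have u : uniq [:: a; b; c] by rewrite /= !inE !andbT negb_or ab bc eq_sym ca.
have d1 := angle_acute (ha _ KM _ _ _ aK bK cK u).
have d2 : 0 < dot (pos a - pos b) (pos c - pos b).
  by apply/angle_acute/(ha _ KM _ _ _ bK aK cK); rewrite /= !inE !andbT negb_or (eq_sym b) ab bc eq_sym ca.
have d3 : 0 < dot (pos a - pos c) (pos b - pos c).
  by apply/angle_acute/(ha _ KM _ _ _ cK aK bK); rewrite /= !inE !andbT negb_or ca ab eq_sym bc.
exists a, b, c; split => //; split => //.
rewrite -sqrf_eq0 det3_sq gt_eqF//.
by rewrite addr_gt0// ?addr_gt0// mulr_gt0.
Qed.

Lemma cell_triangular K : K \in cells M -> is_triangle K.
Proof. by move=> /acute_vertices[a [b [c [h _ _ _]]]]; exists a, b, c. Qed.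

Lemma closure_cells x : closure Om x <-> exists2 K, K \in cells M & simplex K x.
Proof.
have [_ _ -> _ _] := hM; split; first by move=> [K /= KM Kx]; exists K.
by move=> [K KM Kx]; exists K.
Qed.

Lemma simplexI K L x : K \in cells M -> L \in cells M -> simplex K x -> simplex L x ->
  simplex (K :&: L)%SET x.
Proof.
by move=> KM LM Kx Lx; have [_ _ _ <- //] := hM.
Qed.

(** Where the absence of slits and punctures in the domain enters. *)
Lemma interior_closure x : (\forall y \near x, closure Om y) -> Om x.
Proof. by have [_ [e _]] := hOm => h; rewrite -e. Qed.

Lemma near_Om x : Om x -> \forall y \near x, Om y.
Proof. by have [[oOm _ _ _] _] := hOm => Ox; exact: open_nbhs_nbhs. Qed.

Lemma near_osimplex K x : K \in cells M -> osimplex K x -> \forall y \near x, osimplex K y.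
Proof.
move=> KM; have nK := cell_triangular KM; rewrite cell_osimplexP// => h.
have [a [b [c hv]]] := nK; have [aK bK cK] := in_vertices hv.
have ha := near_aff_gt0 (h _ aK); have hb := near_aff_gt0 (h _ bK).
have hc := near_aff_gt0 (h _ cK).
near=> y; rewrite cell_osimplexP// => v vK.
have : v \in [set a; b; c]%SET by case: hv => <-.
by rewrite !inE => /orP[/orP[]|] /eqP->; near: y.
Unshelve. all: by end_near.
Qed.

Lemma near_notin K x : K \in cells M -> ~ simplex K x -> \forall y \near x, ~ simplex K y.
Proof.
move=> KM nKx; have nK := cell_triangular KM.
have [v vK lv] : exists2 v, v \in K & aff_eval (bary K v) x < 0.
  apply: contrapT => h; apply: nKx; rewrite cell_simplexP// => v vK.
  by rewrite leNgt; apply/negP => lv; apply: h; exists v.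
near=> y; rewrite cell_simplexP// => /(_ v vK); apply/negP; rewrite -ltNge.
by near: y; exact: near_aff_lt0.
Unshelve. all: by end_near.
Qed.

Lemma osimplex_Om K x : K \in cells M -> osimplex K x -> Om x.
Proof.
move=> KM Kx; apply: interior_closure; near=> y; apply/closure_cells; exists K => //.
by apply: osimplexS; near: y; exact: near_osimplex.
Unshelve. all: by end_near.
Qed.

Lemma edge_of_cell K sg : K \in cells M -> sg \subset K -> #|sg| = 2%N ->
  exists a b c, vertices K a b c /\ sg = [set a; b]%SET.
Proof.
move=> KM sK s2; have nK := cell_triangular KM.
have : sg \in cell_edges K by rewrite inE s2 eqxx.
rewrite cell_edgesE// => /imsetP[w wK ->].
have [a [b [c h]]] := nK; have h' := verticesC h; have h'' := verticesC h'.
have : w \in [set a; b; c]%SET by case: h => <-.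
rewrite !inE => /orP[/orP[]|] /eqP->.
- by exists b, c, a; rewrite (edge_vertices h').
- by exists c, a, b; rewrite (edge_vertices h'').
- by exists a, b, c; rewrite (edge_vertices h).
Qed.

Lemma vertices_mem K a b c v : vertices K a b c -> v \in K -> [\/ v = a, v = b | v = c].
Proof.
move=> [-> _ _]; rewrite !inE => /orP[/orP[]|] /eqP->; by [apply: Or31|apply: Or32|apply: Or33].
Qed.

Lemma vertices_share K L a b c : K \in cells M -> L \in cells M -> K != L ->
  vertices K a b c -> [set a; b]%SET \subset L ->
  exists c', [/\ vertices L a b c', c' \notin K & c \notin L].
Proof.
move=> KM LM KL hK abL.
have [ab bc ca] := vertices_neq hK; have [aK bK cK] := in_vertices hK.
have ab2 : #|[set a; b]%SET| = 2%N by rewrite cards2 ab.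
have [a' [b' [c' [hL e]]]] := edge_of_cell LM abL ab2.
have [aL bL cL] := in_vertices hL.
have hL' : vertices L a b c'.
  have em v : (v \in [set a; b]%SET) = (v \in [set a'; b']%SET) by rewrite e.
  have := em a; rewrite !inE eqxx => /esym/orP[] /eqP ea.
    have := em b; rewrite !inE eqxx orbT => /esym/orP[] /eqP eb.
      by move: ab; rewrite ea eb eqxx.
    by rewrite ea eb.
  have := em b; rewrite !inE eqxx orbT => /esym/orP[] /eqP eb; last first.
    by move: ab; rewrite ea eb eqxx.
  rewrite ea eb; case: hL => [-> u d]; split.
  - by apply/setP => v; rewrite !inE (orbC (v == b')).
  - by move: u; rewrite /= !inE !andbT !negb_or => /andP[/andP[h1 h2] h3]; rewrite (eq_sym b' a') h1 h2 h3.
  - by rewrite det3_swap oppr_eq0.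
exists c'; split => //.
- apply/negP => c'K; have [] := vertices_mem hK c'K => e1.
  + by have [_ _] := vertices_neq hL'; rewrite e1 eqxx.
  + by have [_] := vertices_neq hL'; rewrite e1 eqxx.
  + by move: KL; case: hK => -> _ _; case: hL' => -> _ _; rewrite e1 eqxx.
- apply/negP => cL'; have [] := vertices_mem hL' cL' => e1.
  + by move: ca; rewrite e1 eqxx.
  + by move: bc; rewrite e1 eqxx.
  + by move: KL; case: hK => -> _ _; case: hL' => -> _ _; rewrite e1 eqxx.
Qed.

(** Otherwise a point slightly inside from the midpoint of the common edge would
    belong to both triangles without belonging to their common face. *)
Lemma opposite_sides K L a b c c' : K \in cells M -> L \in cells M ->
  vertices K a b c -> vertices L a b c' -> c' \notin K ->
  aff_eval (bary K c) (pos c') < 0.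
Proof.
move=> KM LM hK hL c'K; rewrite ltNge; apply/negP => t0.
have nK := cell_triangular KM; have nL := cell_triangular LM.
have [ab bc ca] := vertices_neq hK; have [aK bK cK] := in_vertices hK.
have [aL bL c'L] := in_vertices hL; have [_ bc' ca'] := vertices_neq hL.
pose z := midpoint [set a; b]%SET.
have za : aff_eval (bary K a) z = 1 / 2.
  by rewrite aff_midpoint// !baryP// eqxx eq_sym (negbTE ab) addr0.
have zb : aff_eval (bary K b) z = 1 / 2.
  by rewrite aff_midpoint// !baryP// eqxx (negbTE ab) add0r.
have zc : aff_eval (bary K c) z = 0.
  by rewrite aff_midpoint// !baryP// (negbTE bc) (eq_sym a) (negbTE ca) addr0 mul0r.
have : \forall y \near z, 0 < aff_eval (bary K a) y /\ 0 < aff_eval (bary K b) y.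
  by near=> y; split; near: y; apply: near_aff_gt0; rewrite ?za ?zb.
(* [y] lies beyond the edge, towards [c'] but close to the midpoint [z]. *)
move=> /(near_line (pos c' - z))[e /andP[e0 e1] [ya yb]].
set y := z + _ in ya yb.
have yE : y = (1 - e) *: z + e *: pos c'.
  by apply: ptP; rewrite /y !ptE; ring.
have Ky : simplex K y.
  rewrite cell_simplexP// => v /(vertices_mem hK)[] ->; [exact: ltW|exact: ltW|].
  by rewrite yE aff_eval_line zc mulr0 add0r mulr_ge0// ltW.
have lLc' : aff_eval (bary L c') y = e.
  rewrite yE aff_eval_line aff_midpoint// !baryP// eqxx (negbTE bc') (eq_sym a) (negbTE ca').
  by rewrite addr0 mul0r mulr0 add0r mulr1.
have Ly : simplex L y.
  rewrite cell_simplexP// => v /(vertices_mem hL)[] ->.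
  - by rewrite yE aff_eval_line aff_midpoint// !baryP// eqxx (eq_sym b) (negbTE ab) (negbTE ca') !addr0 mulr0 addr0 mulr_ge0// subr_ge0.
  - by rewrite yE aff_eval_line aff_midpoint// !baryP// eqxx (negbTE ab) (eq_sym c') (negbTE bc') add0r mulr0 addr0 mulr_ge0// subr_ge0.
  - by rewrite lLc' ltW.
have := simplexI KM LM Ky Ly; rewrite (simplex_bary (K := L))// ?finset.subsetIr// => -[_].
move=> /(_ c' c'L); rewrite inE (negbTE c'K) => /(_ isT); rewrite lLc' => e00.
by rewrite e00 ltxx in e0.
Unshelve. all: by end_near.
Qed.

(** The coordinates opposite to the common edge vanish on the same line, hence are
    proportional. *)
Lemma opposite_bary K L a b c c' x : K \in cells M -> L \in cells M ->
  vertices K a b c -> vertices L a b c' -> c' \notin K ->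
  aff_eval (bary K c) x = aff_eval (bary K c) (pos c') * aff_eval (bary L c') x.
Proof.
move=> KM LM hK hL c'K.
have nK := cell_triangular KM; have nL := cell_triangular LM.
have [ab bc ca] := vertices_neq hK; have [aK bK cK] := in_vertices hK.
have [aL bL c'L] := in_vertices hL.
rewrite (aff_bary _ _ nL) (big_vertices _ hL) (baryP nK cK aK) (baryP nK cK bK).
by rewrite (negbTE bc) (eq_sym a) (negbTE ca) !mulr0 !add0r mulrC.
Qed.

(** The union of two triangles with a common edge is a neighbourhood of the relative
    interior of this edge. *)
Lemma shared_edge_Om K L sg z : K \in cells M -> L \in cells M -> K != L ->
  sg \subset K -> sg \subset L -> #|sg| = 2%N -> osimplex sg z -> Om z.
Proof.
move=> KM LM KL sK sL s2 sz.
have nK := cell_triangular KM; have nL := cell_triangular LM.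
have [a [b [c [hK sgE]]]] := edge_of_cell KM sK s2.
rewrite sgE in sL; have [c' [hL c'K cL]] := vertices_share KM LM KL hK sL.
have t0 := opposite_sides KM LM hK hL c'K.
have h x := opposite_bary x KM LM hK hL c'K.
have [ab bc ca] := vertices_neq hK; have [aK bK cK] := in_vertices hK.
have [aL bL c'L] := in_vertices hL.
have asg : a \in sg by rewrite sgE !inE eqxx.
have bsg : b \in sg by rewrite sgE !inE eqxx orbT.
have [zK _] := (osimplex_bary z nK sK).1 sz.
have [zL _] : (forall v, v \in sg -> 0 < aff_eval (bary L v) z) /\ _ :=
  (osimplex_bary z nL (etrans (congr1 (fun s : sx M => s \subset L) sgE) sL)).1 sz.
apply: interior_closure; near=> y.
have yKa : 0 < aff_eval (bary K a) y by near: y; apply/near_aff_gt0/zK.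
have yKb : 0 < aff_eval (bary K b) y by near: y; apply/near_aff_gt0/zK.
have yLa : 0 < aff_eval (bary L a) y by near: y; apply/near_aff_gt0/zL.
have yLb : 0 < aff_eval (bary L b) y by near: y; apply/near_aff_gt0/zL.
apply/closure_cells; have [yc|yc] := leP 0 (aff_eval (bary K c) y).
  by exists K => //; rewrite cell_simplexP// => v /(vertices_mem hK)[] ->; rewrite // ltW.
exists L => //; rewrite cell_simplexP// => v /(vertices_mem hL)[] ->; rewrite ?(ltW yLa) ?(ltW yLb)//.
by move: yc; rewrite h nmulr_rlt0// => /ltW.
Unshelve. all: by end_near.
Qed.

(** A triangle cannot fill a neighbourhood of a point of one of its edges. *)
Lemma edge_other_cell K sg z : K \in cells M -> sg \subset K -> #|sg| = 2%N ->
  osimplex sg z -> Om z -> exists L, [/\ L \in cells M, L != K & sg \subset L].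
Proof.
move=> KM sK s2 sz Oz.
have nK := cell_triangular KM.
have [a [b [c [hK sgE]]]] := edge_of_cell KM sK s2.
have [ab bc ca] := vertices_neq hK; have [aK bK cK] := in_vertices hK.
have asg : a \in sg by rewrite sgE !inE eqxx.
have bsg : b \in sg by rewrite sgE !inE eqxx orbT.
have [zK zK0] := (osimplex_bary z nK sK).1 sz.
have [L LM [LK Lz]] : exists2 L, L \in cells M & L != K /\ simplex L z.
  apply: contrapT => noL.
  have : \forall y \near z, Om y /\ forall L : sx M, L \in cells M -> L != K -> ~ simplex L y.
    apply: filterI; first exact: near_Om.
    have := @filter_forall _ (sx M) (fun L y => L \in cells M -> L != K -> ~ simplex L y) (nbhs z).
    apply => L.
    have [LM|LM] := boolP (L \in cells M); last exact: nearW.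
    have [->|LK] := eqVneq L K; first by apply: nearW => y _ /eqP.
    have : ~ simplex L z by move=> Lz; apply: noL; exists L.
    by move=> /(near_notin LM); apply: filterS => y h _ _.
  (* Moving away from the third vertex leaves [K] and stays in the domain. *)
  move=> /(near_line (z - pos c))[e /andP[e0 _] [Oy yL]].
  have [L LM Ly] := (closure_cells _).1 (@subset_closure _ Om _ Oy).
  have [eLK|LK] := eqVneq L K; last exact: (yL L).
  move: Ly; rewrite eLK cell_simplexP// => /(_ c cK).
  have -> : z + e *: (z - pos c) = (1 - (- e)) *: z + (- e) *: pos c.
    by apply: ptP; rewrite !ptE; ring.
  rewrite aff_eval_line zK0//; last by rewrite sgE !inE negb_or ca eq_sym bc.
  by rewrite baryP// eqxx mulr0 add0r mulr1 oppr_ge0 leNgt e0.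
exists L; split => //.
have Kz : simplex K z.
  rewrite cell_simplexP// => v vK; have [vs|vs] := boolP (v \in sg); first exact/ltW/zK.
  by rewrite zK0.
have := simplexI KM LM Kz Lz; rewrite (simplex_bary (K := K))// ?finset.subsetIl// => -[_ h].
apply/fintype.subsetP => v vs; have vK := fintype.subsetP sK _ vs.
apply: contraT => vL; have := h v vK; rewrite inE vK (negbTE vL) => /(_ isT) h0.
by have := zK _ vs; rewrite h0 ltxx.
Qed.

(** Two more triangles on the same edge would lie on opposite sides of each other
    and both opposite to [K]; a line has two sides only. *)
Lemma two_cells K L L' sg : K \in cells M -> L \in cells M -> L' \in cells M ->
  sg \subset K -> sg \subset L -> sg \subset L' -> #|sg| = 2%N ->
  K != L -> K != L' -> L = L'.
Proof.
move=> KM LM LM' sK sL sL' s2 KL KL'; apply: contraTeq isT => LL'.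
have [a [b [c [hK sgE]]]] := edge_of_cell KM sK s2.
rewrite sgE in sL sL'.
have [c1 [hL c1K cL]] := vertices_share KM LM KL hK sL.
have [c2 [hL' c2K cL']] := vertices_share KM LM' KL' hK sL'.
have c2L : c2 \notin L.
  have [c3 [hL'' c3L _]] := vertices_share LM LM' LL' hL sL'.
  have [_ _ c2L'] := in_vertices hL'; have [_ bc2 ca2] := vertices_neq hL'.
  have [e|e|->//] := vertices_mem hL'' c2L'.
    by move: ca2; rewrite e eqxx.
  by move: bc2; rewrite e eqxx.
have t1 := opposite_sides KM LM hK hL c1K.
have t2 := opposite_sides KM LM' hK hL' c2K.
have t3 := opposite_sides LM LM' hL hL' c2L.
have := opposite_bary (pos c2) KM LM hK hL c1K.
by move=> e; have := nmulr_rgt0 (aff_eval (bary L c1) (pos c2)) t1; rewrite -e; lra.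
Qed.
End MeshTopology.

(** * Interior and boundary edges *)

Section Edges.
Variables (R : realType) (Om : set (pt R)) (M : mesh R).
Notation V := 'I_(nv M).
Implicit Types (K L S sg : sx M) (a b c v w : V) (l : aff R) (x y z : pt R).
Local Notation pos := (@pos R M).
Hypothesis hOm : bounded_polygonal_domain Om.
Hypothesis hM : acute_mesh Om M.
Notation int_edges := (int_edges Om M).
Notation ext_edges := (ext_edges Om M).

Lemma edgesP sg : reflect (exists K, [/\ K \in cells M, sg \subset K & #|sg| = 2%N]) (sg \in edges M).
Proof.
apply: (iffP bigcupP) => [[K KM]|[K [KM sK s2]]].
  by rewrite inE => /andP[/eqP s2 sK]; exists K.
by exists K => //; rewrite inE s2 eqxx.
Qed.

Lemma edge_card sg : sg \in edges M -> #|sg| = 2%N.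
Proof. by move=> /edgesP[K []]. Qed.

Lemma int_edges_edges sg : sg \in int_edges -> sg \in edges M.
Proof. by rewrite inE => /andP[]. Qed.

Lemma in_cell_edges K sg : (sg \in cell_edges K) = (#|sg| == 2%N) && (sg \subset K).
Proof. by rewrite inE. Qed.

Lemma cellKP sg : sg \in edges M -> cellK sg \in cells M /\ sg \subset cellK sg.
Proof.
move=> /edgesP[K [KM sK _]]; rewrite /cellK; case: pickP => [L /andP[]//|/(_ K)].
by rewrite KM sK.
Qed.

Lemma midpoint_osimplex sg : #|sg| = 2%N -> osimplex sg (midpoint sg).
Proof.
move=> s2; exists (fun=> 2^-1); split.
- by move=> v _; rewrite invr_gt0.
- by rewrite sumr_const s2 -[_ *+ 2]mulr_natr mulVf.
- by rewrite /midpoint scaler_sumr.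
Qed.

Lemma int_edge_two K L sg : K \in cells M -> L \in cells M -> K != L ->
  sg \subset K -> sg \subset L -> #|sg| = 2%N -> sg \in int_edges.
Proof.
move=> KM LM KL sK sL s2; rewrite inE; apply/andP; split.
  by apply/edgesP; exists K.
by apply/asboolP => z; exact: (shared_edge_Om hOm hM KM LM KL).
Qed.

Lemma neighborP K sg : sg \in int_edges -> K \in cells M -> sg \subset K ->
  [/\ neighbor K sg \in cells M, sg \subset neighbor K sg & neighbor K sg != K].
Proof.
move=> isg KM sK; have s2 := edge_card (int_edges_edges isg).
move: isg; rewrite inE => /andP[_ /asboolP sOm].
have mid := midpoint_osimplex s2.
have [L [LM LK sL]] := edge_other_cell hOm hM KM sK s2 mid (sOm _ mid).
rewrite /neighbor; case: pickP => [L' /andP[LM' /andP[? ?]]|/(_ L)] //=.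
by rewrite LM LK sL.
Qed.

Lemma neighbor_uniq K L sg : sg \in int_edges -> K \in cells M -> L \in cells M ->
  sg \subset K -> sg \subset L -> L != K -> L = neighbor K sg.
Proof.
move=> isg KM LM sK sL LK; have [NM sN NK] := neighborP isg KM sK.
apply: (two_cells hM KM LM NM sK sL sN) => //; rewrite 1?eq_sym//.
exact: edge_card (int_edges_edges isg).
Qed.

Lemma neighborK K sg : sg \in int_edges -> K \in cells M -> sg \subset K ->
  neighbor (neighbor K sg) sg = K.
Proof.
move=> isg KM sK; have [NM sN NK] := neighborP isg KM sK.
by apply/esym/(neighbor_uniq isg NM KM sN sK); rewrite eq_sym.
Qed.

(** A point of the edge inside the domain could be moved along the edge into its
    relative interior, where [edge_other_cell] provides a second triangle. *)
Lemma ext_edgeP sg : sg \in edges M -> sg \notin int_edges -> sg \in ext_edges.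
Proof.
move=> esg isg; have s2 := edge_card esg; have [KM sK] := cellKP esg.
rewrite inE esg /=; apply/asboolP => y sy; split.
  apply/(closure_cells hM); exists (cellK sg) => //.
  have nK := cell_triangular hM KM.
  have /simplex_bary-/(_ (cellK sg) nK sK)[h _] := sy.
  by rewrite cell_simplexP.
move=> Oy; move: isg => /negP; apply.
have [e /andP[e0 e1] Oz] := near_line (midpoint sg - y) (near_Om hOm Oy).
have sz : osimplex sg (y + e *: (midpoint sg - y)).
  have nK := cell_triangular hM KM; rewrite (osimplex_bary _ nK sK).
  have -> : y + e *: (midpoint sg - y) = (1 - e) *: y + e *: midpoint sg.
    by apply: ptP; rewrite !ptE; ring.
  have [y0 yS] := (simplex_bary y nK sK).1 sy.
  have [m0 mS] := (osimplex_bary (midpoint sg) nK sK).1 (midpoint_osimplex s2).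
  split=> v vK; rewrite aff_eval_line.
    have := m0 v vK; have := y0 v (fintype.subsetP sK v vK) => h1 h2.
    by rewrite ltr_wpDl ?mulr_gt0 ?mulr_ge0// subr_ge0.
  by move=> vs; rewrite yS// mS// !mulr0 addr0.
have [L [LM LK sL]] := edge_other_cell hOm hM KM sK s2 sz Oz.
by apply: (int_edge_two KM LM _ sK sL s2); rewrite eq_sym.
Qed.

Lemma ext_edge_uniq sg L : sg \in edges M -> sg \notin int_edges ->
  L \in cells M -> sg \subset L -> L = cellK sg.
Proof.
move=> esg isg LM sL; have [KM sK] := cellKP esg.
apply: contraNeq isg => LK; exact: (int_edge_two LM KM LK sL sK (edge_card esg)).
Qed.

Lemma cellLP sg : sg \in int_edges ->
  [/\ cellL sg \in cells M, sg \subset cellL sg & cellL sg != cellK sg].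
Proof.
by move=> isg; have [KM sK] := cellKP (int_edges_edges isg); exact: neighborP.
Qed.

(** An interior edge belongs to exactly two triangles, any other edge to one. *)
Lemma sum_cell_edges (F : sx M -> sx M -> R) :
  \sum_(K in cells M) \sum_(sg in cell_edges K) F K sg =
  \sum_(sg in int_edges) (F (cellK sg) sg + F (cellL sg) sg) +
  \sum_(sg in edges M | sg \notin int_edges) F (cellK sg) sg.
Proof.
transitivity (\sum_(sg in edges M) \sum_(K in cells M | sg \subset K) F K sg).
  rewrite (exchange_big_dep (mem (edges M))) /=; last first.
    by move=> K sg KM; rewrite inE => /andP[/eqP s2 sK]; apply/edgesP; exists K.
  apply: eq_bigr => sg esg; apply: eq_bigl => K.
  by rewrite in_cell_edges (edge_card esg) eqxx.
rewrite (bigID (mem int_edges))/=; congr (_ + _).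
  rewrite [LHS](eq_bigl (mem int_edges)); last first.
    move=> sg /=; apply/andP/idP => [[]//|isg]; split => //; exact: int_edges_edges.
  apply: eq_bigr => sg isg; have [KM sK] := cellKP (int_edges_edges isg).
  have [LM sL LK] := cellLP isg.
  rewrite (bigD1 (cellK sg)) ?KM//= (bigD1 (cellL sg)) ?LM ?sL//= big1 ?addr0//.
  move=> K /andP[/andP[/andP[KM' sK'] KK] KL].
  by move: KL; rewrite (neighbor_uniq isg KM KM' sK sK' KK) eqxx.
apply: eq_bigr => sg /andP[esg isg]; have [KM sK] := cellKP esg.
rewrite (bigD1 (cellK sg)) ?KM//= big1 ?addr0// => K /andP[/andP[KM' sK'] KK].
by move: KK; rewrite (ext_edge_uniq esg isg KM' sK') eqxx.
Qed.

Lemma sum_int_edges (F : sx M -> sx M -> R) :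
  \sum_(K in cells M) \sum_(sg in cell_edges K :&: int_edges) F K sg =
  \sum_(sg in int_edges) (F (cellK sg) sg + F (cellL sg) sg).
Proof.
pose G K sg := if sg \in int_edges then F K sg else 0.
transitivity (\sum_(K in cells M) \sum_(sg in cell_edges K) G K sg).
  apply: eq_bigr => K KM; rewrite big_mkcond [RHS]big_mkcond; apply: eq_bigr => sg _.
  by rewrite /G finset.in_setI; case: (sg \in cell_edges K); case: (sg \in int_edges).
rewrite sum_cell_edges [X in _ + X]big1 ?addr0; last first.
  by move=> sg /andP[_ /negbTE isg]; rewrite /G isg.
by apply: eq_bigr => sg isg; rewrite /G isg.
Qed.

Lemma neighbor_cellL sg : sg \in int_edges -> neighbor (cellL sg) sg = cellK sg.
Proof. by move=> isg; have [KM sK] := cellKP (int_edges_edges isg); exact: neighborK. Qed.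

(** * Normals *)

Lemma edge_lengthE a b : edge_length [set a; b]%SET = enorm (pos a - pos b).
Proof.
have aS : a \in [set a; b]%SET by rewrite !inE eqxx.
have bS : b \in [set a; b]%SET by rewrite !inE eqxx orbT.
have e0 u : u \in [set a; b]%SET -> forall w, w \in [set a; b]%SET ->
    enorm (pos u - pos w) <= enorm (pos a - pos b).
  rewrite !inE => /orP[] /eqP-> w; rewrite !inE => /orP[] /eqP->;
    rewrite ?subrr ?lexx// 1?enormB ?lexx// /(enorm 0) dot0l sqrtr0 enorm_ge0//.
apply/eqP; rewrite eq_le; apply/andP; split.
  apply: bigmax_le; first exact: enorm_ge0.
  by move=> u uS; apply: bigmax_le; [exact: enorm_ge0|exact: e0].
rewrite (le_trans _ (le_bigmax_cond _ _ aS))//.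
exact: (le_bigmax_cond _ (fun w => enorm (pos a - pos w)) bS).
Qed.

Lemma dot_grad_bary K c v : K \in cells M -> c \in K -> v \in K ->
  forall w, w \in K -> dot (bary K c).2 (pos v - pos w) = (v == c)%:R - (w == c)%:R.
Proof.
move=> KM cK vK w wK; have nK := cell_triangular hM KM.
by rewrite -aff_evalB !baryP.
Qed.

Lemma grad_bary_neq0 K c : K \in cells M -> c \in K -> (bary K c).2 != 0.
Proof.
move=> KM cK; have nK := cell_triangular hM KM.
have [w wK wc] : exists2 w, w \in K & w != c.
  have [a [b [c' h]]] := nK; have [aK bK _] := in_vertices h; have [ab _ _] := vertices_neq h.
  by have [e|] := eqVneq a c; [exists b; rewrite // -e eq_sym|exists a].
apply/eqP => g0; have := dot_grad_bary KM cK cK wK; rewrite g0 dot0l eqxx (negbTE wc) subr0.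
by move/eqP; rewrite eq_sym oner_eq0.
Qed.

(** The coordinate of the opposite vertex vanishes on the edge and is positive inside. *)
Lemma normal_spec K a b c : K \in cells M -> vertices K a b c ->
  normal K [set a; b]%SET = - (enorm (bary K c).2)^-1 *: (bary K c).2.
Proof.
move=> KM hK; have nK := cell_triangular hM KM.
have [ab bc ca] := vertices_neq hK; have [aK bK cK] := in_vertices hK.
set g := (bary K c).2; have g0 : 0 < enorm g by exact/enorm_gt0/grad_bary_neq0.
set P : set (pt R) := [set n | [/\ enorm n = 1,
    forall a0 b0, a0 \in [set a; b]%SET -> b0 \in [set a; b]%SET -> dot n (pos b0 - pos a0) = 0
  & forall a0 o, a0 \in [set a; b]%SET -> o \in K -> o \notin [set a; b]%SET ->
      dot n (pos o - pos a0) < 0]].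
have sub v : v \in [set a; b]%SET -> v \in K /\ v == c = false.
  by rewrite !inE => /orP[]/eqP->; rewrite ?aK ?bK ?(negbTE bc) // eq_sym (negbTE ca).
have notin o : o \in K -> o \notin [set a; b]%SET -> o = c.
  by move=> oK; have [->|->|//] := vertices_mem hK oK; rewrite !inE eqxx ?orbT.
have ex : P (- (enorm g)^-1 *: g).
  split.
  - by rewrite enormZ normrN normfV (ger0_norm (enorm_ge0 _)) mulVf// gt_eqF.
  - move=> u v /sub[uK uc] /sub[vK vc]; rewrite dotZl /g dot_grad_bary// uc vc subrr mulr0//.
  - move=> u v /sub[uK uc] vK /(notin _ vK) ->; rewrite dotZl /g dot_grad_bary// uc eqxx subr0.
    by rewrite mulr1 oppr_lt0 invr_gt0.
have un n : P n -> n = - (enorm g)^-1 *: g.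
  move=> [n1 n2 n3].
  have aS : a \in [set a; b]%SET by rewrite !inE eqxx.
  have bS : b \in [set a; b]%SET by rewrite !inE eqxx orbT.
  have cS : c \notin [set a; b]%SET by rewrite !inE negb_or ca eq_sym bc.
  set k := dot n (pos c - pos a); have k0 : k < 0 by exact: n3.
  have nE : (- dot n (pos a), n) = (k * (bary K c).1, k *: g) :> aff R.
    apply: (aff_ext_cell nK) => w wK; rewrite aff_evalZ.
    have [->|->|->] := vertices_mem hK wK; rewrite baryP// /(aff_eval (_, _)) /= -dotNr -dotDr addrC.
    - by rewrite subrr /dot !mulr0 addr0 eq_sym (negbTE ca) mulr0.
    - by rewrite n2// (negbTE bc) mulr0.
    - by rewrite eqxx mulr1.
  have {nE} nE : n = k *: g by case: nE.
  move: n1; rewrite nE enormZ ltr0_norm// => /(congr1 (fun t => - (t / enorm g))).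
  by rewrite mulfK ?gt_eqF// opprK mul1r => ->.
apply: un; apply: (@getPex _ P); by exists (- (enorm g)^-1 *: g).
Qed.

Lemma edge_length_grad K a b c : K \in cells M -> vertices K a b c ->
  edge_length [set a; b]%SET = 2 * area K * enorm (bary K c).2.
Proof.
move=> KM hK; rewrite edge_lengthE (area_vertices hK) (bary_hat hK).
have [_ _ D] := hK; set d := det3 _ _ _.
have -> : (hat (pos a) (pos b) (pos c)).2 =
    d^-1 *: ((pos a).2 - (pos b).2, (pos b).1 - (pos a).1).
  by apply: ptP; rewrite !ptE /= mulrC.
rewrite enormZ normfV (_ : 2 * (`|d| / 2) * (`|d|^-1 * _) =
   enorm ((pos a).2 - (pos b).2, (pos b).1 - (pos a).1)); last first.
  by field; rewrite normr_eq0.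
by congr Num.sqrt; rewrite /dot !ptE /=; ring.
Qed.

(** Unlike the normal itself, this product involves no norm: sums over the edges of a
    triangle become computable. *)
Lemma edge_length_normal K a b c : K \in cells M -> vertices K a b c ->
  edge_length [set a; b]%SET *: normal K [set a; b]%SET = - (2 * area K) *: (bary K c).2.
Proof.
move=> KM hK; rewrite (edge_length_grad KM hK) (normal_spec KM hK).
have [_ _ cK] := in_vertices hK.
have g0 : enorm (bary K c).2 != 0 by rewrite gt_eqF// enorm_gt0// grad_bary_neq0.
by apply: ptP; rewrite !ptE; field.
Qed.

Lemma normal_norm K sg : K \in cells M -> sg \subset K -> #|sg| = 2%N -> enorm (normal K sg) = 1.
Proof.
move=> KM sK s2; have [a [b [c [hK ->]]]] := edge_of_cell hM KM sK s2.
have [_ _ cK] := in_vertices hK.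
rewrite (normal_spec KM hK) enormZ normrN normfV (ger0_norm (enorm_ge0 _)) mulVf// gt_eqF//.
by rewrite enorm_gt0// grad_bary_neq0.
Qed.

(** The coordinates opposite to the edge are proportional with a negative factor. *)
Lemma normal_opp K L sg : K \in cells M -> L \in cells M -> K != L ->
  sg \subset K -> sg \subset L -> #|sg| = 2%N -> normal L sg = - normal K sg.
Proof.
move=> KM LM KL sK sL s2; have [a [b [c [hK sgE]]]] := edge_of_cell hM KM sK s2.
rewrite sgE in sL *; have [c' [hL c'K _]] := vertices_share hM KM LM KL hK sL.
rewrite (normal_spec KM hK) (normal_spec LM hL).
have t0 := opposite_sides hM KM LM hK hL c'K.
set t := aff_eval _ _ in t0.
have e : bary K c = (t * (bary L c').1, t *: (bary L c').2).
  apply: (aff_ext_cell (cell_triangular hM KM)) => w _.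
  by rewrite aff_evalZ (opposite_bary hM _ KM LM hK hL c'K).
have [_ _ c'L] := in_vertices hL.
have g0 : enorm (bary L c').2 != 0 by rewrite gt_eqF// enorm_gt0// grad_bary_neq0.
rewrite e /= enormZ ltr0_norm//; have tn : t != 0 by rewrite lt_eqF.
by apply: ptP; rewrite !ptE; field; rewrite g0 tn.
Qed.

(** Integration by parts for an affine function on a triangle. The normals weighted
    by the lengths of the edges are multiples of the gradients of the barycentric
    coordinates, and these gradients have sum zero. *)
Lemma cell_gradient K l x : K \in cells M ->
  \sum_(sg in cell_edges K) edge_length sg * aff_eval l (midpoint sg) * dot x (normal K sg) =
  area K * dot x l.2.
Proof.
move=> KM; have nK := cell_triangular hM KM; rewrite big_cell_edges//.
have [a [b [c h]]] := nK; have h' := verticesC h; have h'' := verticesC h'.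
have [ab bc ca] := vertices_neq h.
rewrite (big_vertices _ h) (edge_vertices h) (edge_vertices h') (edge_vertices h'').
have E u v w : vertices K u v w ->
    edge_length [set u; v]%SET * aff_eval l (midpoint [set u; v]%SET) * dot x (normal K [set u; v]%SET) =
    - (area K) * (aff_eval l (pos u) + aff_eval l (pos v)) * dot x (bary K w).2.
  move=> hK; have [uv _ _] := vertices_neq hK.
  rewrite mulrAC -dotZr (edge_length_normal KM hK) dotZr aff_midpoint//.
  by field.
rewrite !(E _ _ _ h) !(E _ _ _ h') !(E _ _ _ h'').
have dx l1 : dot x l1.2 = aff_eval l1 x - aff_eval l1 0.
  by rewrite aff_evalB subr0 dotC.
have s0 : dot x (bary K a).2 + dot x (bary K b).2 + dot x (bary K c).2 = 0.
  rewrite !dx; have := bary_sum1 x nK; have := bary_sum1 0 nK.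
  by rewrite !(big_vertices _ h) => h1 h2; lra.
have -> : dot x l.2 = dot x (bary K a).2 * aff_eval l (pos a) +
   dot x (bary K b).2 * aff_eval l (pos b) + dot x (bary K c).2 * aff_eval l (pos c).
  by rewrite dx (aff_bary l x nK) (aff_bary l 0 nK) !(big_vertices _ h) !dx; ring.
have -> : dot x (bary K c).2 = - (dot x (bary K a).2 + dot x (bary K b).2) by lra.
by ring.
Qed.

End Edges.

(** * Integrals of piecewise functions *)

Section Integrals.
Variables (R : realType) (Om : set (pt R)) (M : mesh R).
Notation V := 'I_(nv M).
Notation leb := (@leb2 R).
Implicit Types (K L S sg : sx M) (a b c v w : V) (l : aff R) (x y z : pt R).
Hypothesis hOm : bounded_polygonal_domain Om.
Hypothesis hM : acute_mesh Om M.

Lemma osimplex_disjoint K L x : K \in cells M -> L \in cells M ->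
  osimplex K x -> simplex L x -> K = L.
Proof.
move=> KM LM oKx Lx; have nK := cell_triangular hM KM; have nL := cell_triangular hM LM.
have := simplexI hM KM LM (osimplexS oKx) Lx.
rewrite (simplex_bary (K := K))// ?finset.subsetIl// => -[_ h].
have KL : K \subset L.
  apply/fintype.subsetP => v vK; apply: contraT => vL; have := h v vK.
  rewrite inE vK (negbTE vL) => /(_ isT) h0.
  by have /(_ v vK) := (cell_osimplexP x nK).1 oKx; rewrite h0 ltxx.
by apply/eqP; rewrite eqEcard KL (card_triangle nK) (card_triangle nL).
Qed.

Lemma pw_in (T : zmodType) (F : sx M -> pt R -> T) K x : K \in cells M -> osimplex K x ->
  pw F x = F K x.
Proof.
move=> KM Kx; rewrite /pw; case: pickP => [L /andP[LM /asboolP Lx]|/(_ K)].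
  by rewrite (osimplex_disjoint KM LM Kx (osimplexS Lx)).
by rewrite KM/= => /asboolP.
Qed.

Lemma pw_out (T : zmodType) (F : sx M -> pt R -> T) x :
  (forall K, K \in cells M -> ~ osimplex K x) -> pw F x = 0.
Proof.
move=> h; rewrite /pw; case: pickP => [L /andP[LM /asboolP Lx]|//].
by case: (h L).
Qed.

Lemma pw_case x : (exists2 K, K \in cells M & osimplex K x) \/
  (forall K, K \in cells M -> ~ osimplex K x).
Proof.
have [h|h] := pselect (exists2 K, K \in cells M & osimplex K x); [by left|right].
by move=> K KM Kx; apply: h; exists K.
Qed.

Lemma measurable_osimplex K : K \in cells M -> measurable (osimplex K : set (mpt R)).
Proof.
move=> KM; have nK := cell_triangular hM KM; have [a [b [c h]]] := nK.
have [aK bK cK] := in_vertices h.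
rewrite (_ : osimplex K = [set u | 0 < aff_eval (bary K a) u] `&`
  ([set u | 0 < aff_eval (bary K b) u] `&` [set u | 0 < aff_eval (bary K c) u])).
  by apply: measurableI; [|apply: measurableI]; exact: measurable_aff_gt0.
apply/seteqP; split => u; rewrite cell_osimplexP//.
  by move=> h0; split; [|split]; exact: h0.
by move=> [? [? ?]] v /(vertices_mem h)[] ->.
Qed.

(** The open triangles are disjoint. *)
Lemma pwE (f : sx M -> pt R -> R) x :
  pw f x = \sum_(K in cells M) (f K \_ (osimplex K)) x.
Proof.
have [[K KM Kx]|h] := pw_case x.
  rewrite (pw_in _ KM Kx) (bigD1 K KM)/= patchE mem_set// big1 ?addr0// => L /andP[LM LK].
  rewrite patchE memNset// => Lx; move/eqP: LK; apply.
  by rewrite (osimplex_disjoint LM KM Lx (osimplexS Kx)).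
rewrite pw_out// big1// => K KM; rewrite patchE memNset//; exact: h.
Qed.

Lemma measurable_pw (f : sx M -> pt R -> R) :
  (forall K, K \in cells M -> measurable_fun setT (f K : mpt R -> R)) ->
  measurable_fun setT (pw f : mpt R -> R).
Proof.
move=> mf; rewrite (_ : pw f = fun x => \sum_(K in cells M) (f K \_ (osimplex K)) x); last first.
  by apply/funext => x; exact: pwE.
pose g K := if K \in cells M then f K \_ (osimplex K) else cst 0.
rewrite (_ : (fun x => _) = fun x => \sum_(K : sx M) g K x); last first.
  apply/funext => x; rewrite big_mkcond; apply: eq_bigr => K _.
  by rewrite /g; case: ifP.
apply: measurable_sum => K; rewrite /g; case: ifPn => // KM.
apply/(measurable_restrictT _ (measurable_osimplex KM)).
apply: measurable_funTS; exact: mf.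
Qed.

Lemma simplex_osimplex_null K : K \in cells M ->
  exists N : set (mpt R), [/\ measurable N, leb N = 0%E & osimplex K = simplex K `\` N].
Proof.
move=> KM; have nK := cell_triangular hM KM; have [a [b [c h]]] := nK.
have [aK bK cK] := in_vertices h.
have m0 v : measurable ([set u | aff_eval (bary K v) u = 0] : set (mpt R)) by exact: measurable_aff_eq0.
exists ([set u : mpt R | aff_eval (bary K a) u = 0] `|` ([set u : mpt R | aff_eval (bary K b) u = 0] `|`
  [set u : mpt R | aff_eval (bary K c) u = 0])); split.
- by apply: measurableU => //; exact: measurableU.
- have bc0 : leb ([set u : mpt R | aff_eval (bary K b) u = 0] `|`
      [set u : mpt R | aff_eval (bary K c) u = 0]) = 0%E.
    by rewrite measureU0 ?bary_null//; exact: m0.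
  by rewrite measureU0 ?bary_null//; exact: measurableU.
- apply/seteqP; split => u.
    move=> ou; have h0 := (cell_osimplexP u nK).1 ou; split; first exact: osimplexS.
    by move=> [|[|]] /= e; [have := h0 _ aK|have := h0 _ bK|have := h0 _ cK]; rewrite e ltxx.
  move=> [Ku nN]; apply/cell_osimplexP => // v vK; rewrite lt_neqAle (cell_simplexP u nK).1// andbT.
  apply/eqP => e; apply: nN; have [E|E|E] := vertices_mem h vK; rewrite E in e;
    by [left|right; left|right; right].
Qed.

Lemma integral_osimplex K (f : pt R -> R) : K \in cells M ->
  leb.-integrable (simplex K) (EFin \o f) ->
  \int[leb]_(x in osimplex K) f x = \int[leb]_(x in simplex K) f x.
Proof.
move=> KM fi; have [N [mN N0 ->]] := simplex_osimplex_null KM.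
have mK := measurable_cell (cell_triangular hM KM).
by rewrite /Rintegral (negligible_integral mN mK fi N0).
Qed.

(** A segment is the part of a line between two parallel lines orthogonal to it. *)
Lemma measurable_segment x y : measurable (segment x y : set (mpt R)).
Proof.
have [->|xy] := eqVneq x y.
  rewrite (_ : segment y y = [set u | aff_eval (- y.1, (1, 0)) u = 0] `&`
     [set u | aff_eval (- y.2, (0, 1)) u = 0]).
    by apply: measurableI; exact: measurable_aff_eq0.
  apply/seteqP; split => u; rewrite /aff_eval /dot /=.
    by move=> [t _ ->]; rewrite !ptE; split; ring.
  move=> [e1 e2]; exists 0; first by rewrite lexx ler01.
  by apply: ptP; rewrite !ptE; lra.
have d0 : 0 < dot (y - x) (y - x).
  rewrite lt_neqAle dot_ge0 andbT eq_sym; apply: contra_neq xy => /dot_eq0 e.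
  by apply/esym/eqP; rewrite -subr_eq0 e.
pose q : pt R := (- (y - x).2, (y - x).1).
rewrite (_ : segment x y = [set u | aff_eval (- dot q x, q) u = 0] `&`
  ([set u | 0 <= aff_eval (- dot (y - x) x, y - x) u] `&`
   [set u | 0 <= aff_eval (dot (y - x) y, x - y) u])).
  apply: measurableI; first exact: measurable_aff_eq0.
  by apply: measurableI; exact: measurable_aff_ge0.
apply/seteqP; split => u.
  move=> [t /andP[t0 t1] ->]; split; [|split] => /=.
  - by rewrite /aff_eval /q /dot !ptE /=; ring.
  - rewrite (_ : aff_eval _ _ = t * dot (y - x) (y - x)); last by rewrite /aff_eval /dot !ptE /=; ring.
    by rewrite mulr_ge0// ltW.
  - rewrite (_ : aff_eval _ _ = (1 - t) * dot (y - x) (y - x)); last by rewrite /aff_eval /dot !ptE /=; ring.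
    by rewrite mulr_ge0 ?subr_ge0// ltW.
move=> [/= e1 [e2 e3]]; exists (dot (y - x) (u - x) / dot (y - x) (y - x)).
  have e2' : 0 <= dot (y - x) (u - x) by move: e2; rewrite /aff_eval addrC -dotNr -dotDr.
  rewrite divr_ge0 ?(ltW d0)//=.
    rewrite ler_pdivrMr// mul1r -subr_ge0 -dotNr -dotDr.
    by rewrite (le_trans e3)// le_eqVlt; apply/orP; left; apply/eqP; rewrite /aff_eval /dot !ptE /=; ring.
have e1' : dot q (u - x) = 0 by move: e1; rewrite /aff_eval addrC -dotNr -dotDr.
have key (k : R) : k * dot (y - x) (y - x) = 0 -> k = 0.
  by move=> /eqP; rewrite mulf_eq0 (gt_eqF d0) orbF => /eqP.
have inv : dot (y - x) (y - x) / dot (y - x) (y - x) = 1 by rewrite divff// gt_eqF.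
set s := _ / _.
have sE : s * dot (y - x) (y - x) = dot (y - x) (u - x) by rewrite /s divfK// gt_eqF.
apply: ptP; apply/eqP; rewrite -subr_eq0; apply/eqP; apply: key.
  transitivity (- (y - x).2 * dot q (u - x) + (y - x).1 * (dot (y - x) (u - x) - s * dot (y - x) (y - x))).
    by rewrite /q /dot !ptE /=; ring.
  by rewrite e1' sE subrr; ring.
transitivity ((y - x).1 * dot q (u - x) + (y - x).2 * (dot (y - x) (u - x) - s * dot (y - x) (y - x))).
  by rewrite /q /dot !ptE /=; ring.
by rewrite e1' sE subrr; ring.
Qed.

(** The domain is a finite union of closed triangles minus a finite union of
    segments. *)
Lemma measurable_Om : measurable (Om : set (mpt R)).
Proof.
have [_ [_ [s hs]]] := hOm.
have -> : Om = (\bigcup_(K in [set` cells M]) simplex K) `\` (\bigcup_(ab in [set` s]) segment ab.1 ab.2).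
  have [_ _ <- _ _] := hM; rewrite -hs; apply/seteqP; split => x.
    by move=> Ox; split; [exact: subset_closure|move=> []].
  by move=> [cx nx]; apply: contrapT => Ox; apply: nx.
apply: measurableD; apply: fin_bigcup_measurable => //.
- by move=> K /= KM; exact: measurable_cell (cell_triangular hM KM).
- by move=> ab _; exact: measurable_segment.
Qed.

(** The boundaries of the triangles form a null set. *)
Lemma integral_pw (f : sx M -> pt R -> R) :
  (forall K, K \in cells M -> leb.-integrable (simplex K) (EFin \o f K)) ->
  leb.-integrable Om (EFin \o pw f) /\
  \int[leb]_(x in Om) pw f x = \sum_(K in cells M) \int[leb]_(x in simplex K) f K x.
Proof.
move=> fi.
pose h K x := if K \in cells M then ((f K \_ (osimplex K)) x)%:E else 0%E.
have hE : EFin \o pw f = fun x => (\sum_(K : sx M) h K x)%E.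
  apply/funext => x /=; rewrite pwE -sumEFin big_mkcond; apply: eq_bigr => K _.
  by rewrite /h; case: ifP.
have mO := measurable_Om.
have OK K : K \in cells M -> Om `&` osimplex K = osimplex K.
  by move=> KM; apply/seteqP; split => [x []//|x Kx]; split => //; exact: (osimplex_Om hOm hM KM).
have hi K : leb.-integrable Om (h K).
  have [KM|KM] := boolP (K \in cells M); last first.
    rewrite (_ : h K = cst 0%E); first exact: integrable0.
    by apply/funext => x; rewrite /h (negbTE KM).
  rewrite (_ : h K = (EFin \o f K) \_ (osimplex K)); last first.
    by apply/funext => x; rewrite /h KM restrict_EFin.
  apply/integrable_restrict => //; first exact: measurable_osimplex KM.
  rewrite OK//; apply: (integrableS _ _ _ (fi K KM)) => //.
  - exact: measurable_cell (cell_triangular hM KM).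
  - exact: measurable_osimplex.
  - exact: osimplexS.
split; first by rewrite hE; exact: integrable_sum.
rewrite /Rintegral (_ : (\int[leb]_(x in Om) (pw f x)%:E)%E =
   (\int[leb]_(x in Om) \sum_(K : sx M) h K x)%E); last by rewrite -hE.
rewrite integral_sum//.
transitivity (\sum_(K : sx M) fine (\int[leb]_(x in Om) h K x)%E).
  by rewrite sum_fine// => K _; exact: integrable_fin_num.
rewrite [RHS]big_mkcond; apply: eq_bigr => K _; case: ifPn => KM.
  rewrite -[RHS]/(\int[leb]_(x in simplex K) f K x).
  rewrite -integral_osimplex//; last exact: fi.
  rewrite -[in RHS](OK K KM) Rintegral_mkcondr /Rintegral; congr fine.
  by apply: eq_integral => x _; rewrite /h KM.
by rewrite integral0_eq// => x _; rewrite /h (negbTE KM).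
Qed.

(** * Square-integrable functions *)

(** Membership in L^2 in terms of the values on the domain only, without the
    extension by 0. *)
Definition sq_integrable (g : pt R -> R) :=
  measurable_fun Om (g : mpt R -> R) /\ leb.-integrable Om (EFin \o (fun x => g x ^+ 2)).

Lemma in_L2_sq_integrable g : in_Lp Om 2%:E g -> sq_integrable g.
Proof.
have mO := measurable_Om.
move=> gL; split.
  apply/(measurable_restrictT _ mO).
  by move: gL => /andP[]; rewrite inE.
have := Lfun2_integrable_sqr gL.
rewrite (_ : EFin \o _ = (EFin \o (fun x => g x ^+ 2)) \_ Om); last first.
  apply/funext => x /=; rewrite !patchE; case: ifP => //= _.
  by rewrite expr0n.
by move/integrable_restrict; rewrite setTI; apply.
Qed.

Lemma sq_integrableM g h : sq_integrable g -> sq_integrable h ->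
  leb.-integrable Om (EFin \o (fun x => g x * h x)).
Proof.
have mO := measurable_Om.
move=> [mg ig] [mh ih]; have ii := integrableD mO ig ih.
apply: (le_integrable mO _ _ ii).
  by apply/measurable_EFinP; exact: measurable_funM.
move=> x _ /=; rewrite lee_fin normrM.
rewrite [X in _ <= X]ger0_norm ?addr_ge0 ?sqr_ge0//.
rewrite -(real_normK (num_real (g x))) -(real_normK (num_real (h x))).
have := sqr_ge0 (`|g x| - `|h x|); have := mulr_ge0 (normr_ge0 (g x)) (normr_ge0 (h x)).
by rewrite sqrrB; lra.
Qed.

Lemma sq_integrableD g h : sq_integrable g -> sq_integrable h -> sq_integrable (fun x => g x + h x).
Proof.
have mO := measurable_Om.
move=> Hg Hh; have [mg ig] := Hg; have [mh ih] := Hh; split; first exact: measurable_funD.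
have igh := sq_integrableM Hg Hh.
have := integrableD mO (integrableD mO ig ih) (integrableD mO igh igh).
congr (integrable _ _ _); apply/funext => x /=; rewrite -!EFinD; congr EFin; ring.
Qed.

Lemma sq_integrableN g : sq_integrable g -> sq_integrable (fun x => - g x).
Proof.
move=> [mg ig]; split.
  by rewrite (_ : (fun x => _) = \- g)//; exact: measurable_funN.
by move: ig; congr (integrable _ _ _); apply/funext => x /=; rewrite sqrrN.
Qed.

Lemma sq_integrable_pw (q : sx M -> aff R) : sq_integrable (P1fun q).
Proof.
have mO := measurable_Om.
split.
  apply: measurable_funTS; apply: measurable_pw => K _; exact: measurable_aff.
have [] := @integral_pw (fun K x => aff_eval (q K) x ^+ 2).
  move=> K KM; rewrite (_ : (fun x => aff_eval (q K) x ^+ 2) =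
    (fun x => aff_eval (q K) x * aff_eval (q K) x))//.
  exact: integrable_cell (cell_triangular hM KM).
move=> + _; congr (integrable _ _ _); apply/funext => x /=; congr EFin.
have [[K KM Kx]|h] := pw_case x; first by rewrite /P1fun !(pw_in _ KM Kx).
by rewrite /P1fun !pw_out// expr0n.
Qed.

Lemma P0_P1fun (q : sx M -> R) : P0fun q = P1fun (fun K => (q K, 0)).
Proof.
apply/funext => x; have [[K KM Kx]|h] := pw_case x.
  by rewrite /P1fun /P0fun !(pw_in _ KM Kx) /aff_eval dot0l addr0.
by rewrite /P1fun /P0fun !pw_out.
Qed.

Lemma fst_P0fun (v : sx M -> pt R) x : (P0fun v x).1 = P0fun (fun K => (v K).1) x.
Proof.
have [[K KM Kx]|h] := pw_case x; first by rewrite /P0fun !(pw_in _ KM Kx).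
by rewrite /P0fun !pw_out.
Qed.

Lemma snd_P0fun (v : sx M -> pt R) x : (P0fun v x).2 = P0fun (fun K => (v K).2) x.
Proof.
have [[K KM Kx]|h] := pw_case x; first by rewrite /P0fun !(pw_in _ KM Kx).
by rewrite /P0fun !pw_out.
Qed.

Lemma fst_RTfun (v : sx M -> affv R) x : (RTfun v x).1 = P1fun (fun K => (v K).1) x.
Proof.
have [[K KM Kx]|h] := pw_case x; first by rewrite /RTfun /P1fun !(pw_in _ KM Kx).
by rewrite /RTfun /P1fun !pw_out.
Qed.

Lemma snd_RTfun (v : sx M -> affv R) x : (RTfun v x).2 = P1fun (fun K => (v K).2) x.
Proof.
have [[K KM Kx]|h] := pw_case x; first by rewrite /RTfun /P1fun !(pw_in _ KM Kx).
by rewrite /RTfun /P1fun !pw_out.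
Qed.

Lemma P1funM (q r : sx M -> aff R) x :
  P1fun q x * P1fun r x = pw (fun K x => aff_eval (q K) x * aff_eval (r K) x) x.
Proof.
have [[K KM Kx]|h] := pw_case x; first by rewrite /P1fun !(pw_in _ KM Kx).
by rewrite /P1fun !pw_out// mul0r.
Qed.

Lemma ip_P1 (q r : sx M -> aff R) : ip Om (P1fun q) (P1fun r) =
  \sum_(K in cells M) area K / 3 * \sum_(sg in cell_edges K)
     aff_eval (q K) (midpoint sg) * aff_eval (r K) (midpoint sg).
Proof.
rewrite /ip (_ : (fun x => _) = pw (fun K x => aff_eval (q K) x * aff_eval (r K) x)); last first.
  by apply/funext => x; exact: P1funM.
have [|_ ->] := @integral_pw (fun K x => aff_eval (q K) x * aff_eval (r K) x).
  by move=> K KM; exact: integrable_cell (cell_triangular hM KM).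
by apply: eq_bigr => K KM; rewrite cell_quad//; exact: (cell_triangular hM KM).
Qed.

Lemma sum_cell_edges_const K (t : R) : K \in cells M -> \sum_(sg in cell_edges K) t = t * 3.
Proof.
move=> KM; have nK := cell_triangular hM KM.
by rewrite big_cell_edges// sumr_const (card_triangle nK) mulr_natr.
Qed.

Lemma ip_P0_P1 (s : sx M -> R) (r : sx M -> aff R) : ip Om (P0fun s) (P1fun r) =
  \sum_(K in cells M) area K / 3 * \sum_(sg in cell_edges K) s K * aff_eval (r K) (midpoint sg).
Proof.
rewrite P0_P1fun ip_P1; apply: eq_bigr => K _; congr (_ * _); apply: eq_bigr => sg _.
by rewrite /(aff_eval (_, _)) dot0l addr0.
Qed.

Lemma ip_P0 (s r : sx M -> R) : ip Om (P0fun s) (P0fun r) =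
  \sum_(K in cells M) area K * (s K * r K).
Proof.
rewrite [P0fun r]P0_P1fun ip_P0_P1; apply: eq_bigr => K KM.
under eq_bigr do rewrite /aff_eval dot0l addr0.
by rewrite sum_cell_edges_const//=; field.
Qed.

Lemma ipvE (g h : pt R -> pt R) :
  sq_integrable (fun x => (g x).1) -> sq_integrable (fun x => (g x).2) ->
  sq_integrable (fun x => (h x).1) -> sq_integrable (fun x => (h x).2) ->
  ipv Om g h = ip Om (fun x => (g x).1) (fun x => (h x).1) +
               ip Om (fun x => (g x).2) (fun x => (h x).2).
Proof.
have mO := measurable_Om.
by move=> g1 g2 h1 h2; rewrite /ipv /ip -RintegralD//; exact: sq_integrableM.
Qed.

Lemma sq_integrable_P0v (v : sx M -> pt R) :
  sq_integrable (fun x => (P0fun v x).1) /\ sq_integrable (fun x => (P0fun v x).2).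
Proof.
split.
  by under eq_fun do rewrite fst_P0fun; rewrite P0_P1fun; exact: sq_integrable_pw.
by under eq_fun do rewrite snd_P0fun; rewrite P0_P1fun; exact: sq_integrable_pw.
Qed.

Lemma sq_integrable_RT (v : sx M -> affv R) :
  sq_integrable (fun x => (RTfun v x).1) /\ sq_integrable (fun x => (RTfun v x).2).
Proof.
split.
  by under eq_fun do rewrite fst_RTfun; exact: sq_integrable_pw.
by under eq_fun do rewrite snd_RTfun; exact: sq_integrable_pw.
Qed.

Lemma ipv_P0 (v w : sx M -> pt R) : ipv Om (P0fun v) (P0fun w) =
  \sum_(K in cells M) area K * dot (v K) (w K).
Proof.
have [v1 v2] := sq_integrable_P0v v; have [w1 w2] := sq_integrable_P0v w.
rewrite ipvE//.
under [X in ip Om X _]eq_fun do rewrite fst_P0fun.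
under [X in ip Om _ X]eq_fun do rewrite fst_P0fun.
under [X in _ + ip Om X _]eq_fun do rewrite snd_P0fun.
under [X in _ + ip Om _ X]eq_fun do rewrite snd_P0fun.
by rewrite !ip_P0 -big_split/=; apply: eq_bigr => K _; rewrite -mulrDr.
Qed.

Lemma ipv_RT (v w : sx M -> affv R) : ipv Om (RTfun v) (RTfun w) =
  \sum_(K in cells M) area K / 3 * \sum_(sg in cell_edges K)
     dot (affv_eval (v K) (midpoint sg)) (affv_eval (w K) (midpoint sg)).
Proof.
have [v1 v2] := sq_integrable_RT v; have [w1 w2] := sq_integrable_RT w.
rewrite ipvE//.
under [X in ip Om X _]eq_fun do rewrite fst_RTfun.
under [X in ip Om _ X]eq_fun do rewrite fst_RTfun.
under [X in _ + ip Om X _]eq_fun do rewrite snd_RTfun.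
under [X in _ + ip Om _ X]eq_fun do rewrite snd_RTfun.
rewrite !ip_P1 -big_split/=; apply: eq_bigr => K _; rewrite -mulrDr; congr (_ * _).
by rewrite -big_split.
Qed.

Lemma P0v_RT (v : sx M -> pt R) :
  P0fun v = RTfun (fun K => (((v K).1, 0), ((v K).2, 0))).
Proof.
apply/funext => x; apply: ptP.
  by rewrite fst_P0fun fst_RTfun P0_P1fun.
by rewrite snd_P0fun snd_RTfun P0_P1fun.
Qed.

(** * Orthogonal projections do not increase the norm *)

Lemma ip_sub (g q : pt R -> R) : sq_integrable g -> sq_integrable q ->
  ip Om (fun x => g x - q x) q = ip Om g q - ip Om q q.
Proof.
have mO := measurable_Om.
move=> g2 q2; rewrite /ip -RintegralB//; [|exact: sq_integrableM|exact: sq_integrableM].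
by apply: eq_Rintegral => x _; rewrite mulrBl.
Qed.

Lemma ip_ge0 (g : pt R -> R) : 0 <= ip Om g g.
Proof. by apply: Rintegral_ge0 => x _; rewrite -expr2 sqr_ge0. Qed.

(** With [g - q] orthogonal to [q], this says that a projection does not increase the
    norm. *)
Lemma ip_proj_le (g q : pt R -> R) : sq_integrable g -> sq_integrable q ->
  2 * ip Om g q <= ip Om g g + ip Om q q.
Proof.
have mO := measurable_Om.
move=> g2 q2; have := ip_ge0 (fun x => g x - q x).
have gq := sq_integrableM g2 q2; have gg := sq_integrableM g2 g2; have qq := sq_integrableM q2 q2.
have -> : ip Om (fun x => g x - q x) (fun x => g x - q x) =
    ip Om g g + ip Om q q - (ip Om g q + ip Om g q).
  rewrite /ip -!RintegralD// -RintegralB//.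
  - by apply: eq_Rintegral => x _; ring.
  - exact: (integrableD mO gg qq).
  - exact: (integrableD mO gq gq).
by lra.
Qed.

Lemma proj_P0_norm (g : pt R -> R) (q : sx M -> R) : in_Lp Om 2%:E g -> proj_P0 Om g q ->
  \sum_(K in cells M) area K * q K ^+ 2 <= ip Om g g.
Proof.
move=> /in_L2_sq_integrable g2 [_ /(_ q I)].
have q2 : sq_integrable (P0fun q) by rewrite P0_P1fun; exact: sq_integrable_pw.
rewrite ip_sub// => e; have := ip_proj_le g2 q2.
have -> : \sum_(K in cells M) area K * q K ^+ 2 = ip Om (P0fun q) (P0fun q) by rewrite ip_P0.
by lra.
Qed.

Lemma proj_P0v_norm (g : pt R -> pt R) (q : sx M -> pt R) : in_L2v Om g -> proj_P0v Om g q ->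
  \sum_(K in cells M) area K * dot (q K) (q K) <= ipv Om g g.
Proof.
move=> [/in_L2_sq_integrable g1 /in_L2_sq_integrable g2] [_ /(_ q I)].
have [q1 q2] := sq_integrable_P0v q.
rewrite ipvE//; [|exact: sq_integrableD g1 (sq_integrableN q1)|
   exact: sq_integrableD g2 (sq_integrableN q2)].
rewrite -ipv_P0 ipvE// ipvE//.
rewrite (ip_sub g1 q1) (ip_sub g2 q2) => e.
have := ip_proj_le g1 q1; have := ip_proj_le g2 q2; lra.
Qed.

End Integrals.

(** * Consequences of mesh regularity *)

Section Regular.
Variables (R : realType) (Om : set (pt R)) (M : mesh R) (Creg : R).
Notation V := 'I_(nv M).
Implicit Types (K L S sg : sx M) (a b c v w : V) (l : aff R) (x y z : pt R).
Local Notation pos := (@pos R M).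
Hypothesis hOm : bounded_polygonal_domain Om.
Hypothesis hM : acute_mesh Om M.
Hypothesis hC : 0 < Creg.
Hypothesis hR : mesh_regular Om M Creg.
Notation int_edges := (int_edges Om M).
Notation h := (mesh_size M).

(** [mesh_size] is the largest diameter of a circumscribed circle. *)
Lemma circumcenter_le K v : K \in cells M -> v \in K -> enorm (circumcenter K - pos v) <= h / 2.
Proof.
move=> KM vK; rewrite ler_pdivlMr// mulrC.
apply: (@le_trans _ _ (hK K)).
  exact: (le_bigmax_cond _ (fun v => 2 * enorm (circumcenter K - pos v)) vK).
exact: (le_bigmax_cond _ (fun K => hK K) KM).
Qed.

Lemma simplex_diam K x y : K \in cells M -> simplex K x -> simplex K y -> enorm (x - y) <= h.
Proof.
move=> KM Kx Ky.
have key z : simplex K z -> enorm (z - circumcenter K) <= h / 2.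
  move=> [t [t0 t1 ->]].
  have -> : circumcenter K = \sum_(v in K) t v *: circumcenter K.
    by rewrite -scaler_suml t1 scale1r.
  have -> : h / 2 = \sum_(v in K) t v * (h / 2) by rewrite -mulr_suml t1 mul1r.
  rewrite -sumrB; apply: (le_trans (enorm_sum _ _)); apply: ler_sum => v vK.
  rewrite -scalerBr enormZ ger0_norm ?t0// ler_wpM2l ?t0// enormB.
  exact: circumcenter_le.
have -> : x - y = (x - circumcenter K) + (circumcenter K - y) by rewrite addrA subrK.
apply: (le_trans (enormD _ _)); rewrite (enormB _ y).
by have := key x Kx; have := key y Ky; lra.
Qed.

Lemma vertex_dist_le K a b : K \in cells M -> a \in K -> b \in K -> enorm (pos a - pos b) <= h.
Proof. by move=> KM aK bK; apply: (simplex_diam KM); exact: simplex_vertex. Qed.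

Lemma edge_length_vertices K a b c : K \in cells M -> vertices K a b c ->
  Creg * h <= enorm (pos a - pos b).
Proof.
move=> KM hK; have [ab _ _] := vertices_neq hK; have [aK bK _] := in_vertices hK.
have esg : [set a; b]%SET \in edges M.
  apply/edgesP; exists K; split => //; last by rewrite cards2 ab.
  by apply/fintype.subsetP => v; rewrite !inE => /orP[]/eqP->.
by have [_] := hR esg; rewrite edge_lengthE.
Qed.

Lemma mesh_size_gt0 : 0 < h.
Proof.
have [[_ _ [x Ox] _] _] := hOm.
have [K KM Kx] := (closure_cells hM x).1 (@subset_closure _ Om _ Ox).
have [a [b [c hv]]] := cell_triangular hM KM; have [aK bK _] := in_vertices hv.
apply: (lt_le_trans _ (vertex_dist_le KM aK bK)); apply: enorm_gt0.
rewrite subr_eq0; have [inj _ _ _ _] := hM.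
by have [ab _ _] := vertices_neq hv; apply: contra_neq ab => /inj.
Qed.

(** Acuteness excludes flat triangles: the edges being at least [Creg * mesh_size]
    long, [acute_det] applies. *)
Lemma area_ge K : K \in cells M -> Creg ^+ 2 * h ^+ 2 <= 4 * area K.
Proof.
move=> KM; have [a [b [c [hv d1 d2 d3]]]] := acute_vertices hM KM.
rewrite (area_vertices hv) -exprMn.
have e0 : 0 <= Creg * h by rewrite mulr_ge0// ltW// mesh_size_gt0.
have h' := verticesC hv; have h'' := verticesC h'.
have := acute_det d1 d2 d3 e0 (edge_length_vertices KM hv) (edge_length_vertices KM h')
  (edge_length_vertices KM h'').
by move=> /le_trans; apply; lra.
Qed.

Lemma edge_length_le sg : sg \in edges M -> edge_length sg <= h.
Proof.
move=> /edgesP[K [KM sK s2]]; have [a [b [c [hK ->]]]] := edge_of_cell hM KM sK s2.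
have [aK bK _] := in_vertices hK.
by rewrite edge_lengthE; exact: (vertex_dist_le KM aK bK).
Qed.

Lemma edge_length_gt0 sg : sg \in edges M -> 0 < edge_length sg.
Proof.
move=> esg; have [_ h2] := hR esg; apply: lt_le_trans h2.
by rewrite mulr_gt0// mesh_size_gt0.
Qed.

Lemma dist_gt0 sg : sg \in edges M -> 0 < dist Om sg.
Proof.
move=> esg; have [h1 _] := hR esg; apply: lt_le_trans h1.
by rewrite mulr_gt0// edge_length_gt0.
Qed.

(** Both circumcenters are within half the mesh size of a common vertex. *)
Lemma dist_le sg : sg \in int_edges -> dist Om sg <= h.
Proof.
move=> isg; rewrite /dist isg; have esg := int_edges_edges isg.
have [KM sK] := cellKP esg; have [LM sL _] := cellLP hOm hM isg.
have [v vsg] : exists v, v \in sg.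
  by apply/set0Pn; rewrite -card_gt0 (edge_card esg).
have vK := fintype.subsetP sK v vsg; have vL := fintype.subsetP sL v vsg.
set K := cellK sg in KM vK *; set L := cellL sg in LM vL *.
have -> : circumcenter K - circumcenter L =
   (circumcenter K - pos v) + (pos v - circumcenter L) by rewrite addrA subrK.
apply: (le_trans (enormD _ _)); rewrite (enormB (pos v)).
by have := circumcenter_le KM vK; have := circumcenter_le LM vL; lra.
Qed.

(** * Variation of a nonconforming function along a segment *)

(** The definition of the space fixes an order of the two triangles on each edge. *)
Lemma P1nc_midpoint (p : sx M -> aff R) K L sg : P1nc Om p -> K \in cells M -> L \in cells M ->
  K != L -> sg \subset K -> sg \subset L -> #|sg| = 2%N ->
  aff_eval (p K) (midpoint sg) = aff_eval (p L) (midpoint sg).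
Proof.
move=> hp KM LM KL sK sL s2; have isg := int_edge_two hOm hM KM LM KL sK sL s2.
have [KM0 sK0] := cellKP (int_edges_edges isg); have [LM0 sL0 LK0] := cellLP hOm hM isg.
have := hp sg isg.
have [eK|nK] := eqVneq K (cellK sg).
  have eL : L = cellL sg by apply: (neighbor_uniq hOm hM isg KM0 LM sK0 sL); rewrite -eK eq_sym.
  by rewrite -eK -eL.
have eK : K = cellL sg by exact: (neighbor_uniq hOm hM isg KM0 KM sK0 sK nK).
have eL : L = cellK sg.
  apply: contraNeq KL => nL; rewrite eK.
  by rewrite (neighbor_uniq hOm hM isg KM0 LM sK0 sL nL).
by rewrite -eK -eL => ->.
Qed.

(** Steps of a path through the triangles of [S]. *)
Definition adjacent (S : {set sx M}) : rel (sx M) := fun K L =>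
  [&& K \in S, L \in S, K \in cells M, L \in cells M, K != L & #|(K :&: L)%SET| == 2%N].

Lemma aff_var (l : aff R) K x y : K \in cells M -> simplex K x -> simplex K y ->
  `|aff_eval l x - aff_eval l y| <= h * enorm l.2.
Proof.
move=> KM Kx Ky; rewrite aff_evalB (le_trans (dot_le _ _))// mulrC.
by rewrite ler_wpM2r ?enorm_ge0// (simplex_diam KM).
Qed.

Lemma simplex_midpoint K sg : sg \subset K -> #|sg| = 2%N -> simplex K (midpoint sg).
Proof.
move=> sK s2; have [t [t0 t1 e]] := midpoint_osimplex s2.
exists (fun v => if v \in sg then t v else 0); split.
- by move=> v _; case: ifP => // /t0/ltW.
- rewrite (big_setID sg)/= (finset.setIidPr sK) [X in _ + X]big1 ?addr0; last first.
    by move=> v; rewrite inE => /andP[/negbTE->].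
  by rewrite -[RHS]t1; apply: eq_bigr => v ->.
- rewrite e [RHS](big_setID sg)/= (finset.setIidPr sK) [X in _ + X]big1 ?addr0; last first.
    by move=> v; rewrite inE => /andP[/negbTE-> _]; rewrite scale0r.
  by apply: eq_bigr => v vs; rewrite vs.
Qed.

(** Consecutive triangles of a path share an edge, at the midpoint of which the two
    affine functions agree: each entry of the path contributes its own variation. *)
Lemma path_variation (p : sx M -> aff R) (S : {set sx M}) (s : seq (sx M)) K x y : P1nc Om p ->
  K \in cells M -> path (adjacent S) K s -> simplex K x -> simplex (last K s) y ->
  `|aff_eval (p K) x - aff_eval (p (last K s)) y| <= h * \sum_(L <- K :: s) enorm (p L).2.
Proof.
move=> hp; elim: s K x => [|L s IH] K x KM /=.
  by move=> _ Kx Ky; rewrite big_seq1; exact: aff_var KM Kx Ky.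
move=> /andP[/and5P[_ _ _ LM /andP[KL /eqP c2]] ps] Kx Ly.
rewrite big_cons mulrDr.
have mK := simplex_midpoint (finset.subsetIl K L) c2.
have mL := simplex_midpoint (finset.subsetIr K L) c2.
have := IH L _ LM ps mL Ly; rewrite -(P1nc_midpoint hp KM LM KL (finset.subsetIl K L) (finset.subsetIr K L) c2).
have := aff_var (p K) KM Kx mK.
set u := aff_eval _ x; set m := aff_eval _ (midpoint _); set w := aff_eval _ y => h1 h2.
by rewrite (_ : u - w = (u - m) + (m - w)) ?(le_trans (ler_normD _ _)) ?lerD//; ring.
Qed.

Section Segment.
Variables (x y : pt R).
Let z (t : R) : pt R := (1 - t) *: x + t *: y.
Hypothesis zOm : forall t : R, 0 <= t <= 1 -> closure Om (z t).
Hypothesis zV : forall (t : R) K v, 0 <= t <= 1 -> K \in cells M -> v \in K -> z t <> pos v.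

Definition met : {set sx M} :=
  [set K in cells M | `[< exists2 t : R, 0 <= t <= 1 & simplex K (z t) >]]%SET.

Lemma segment_cvg t : z t' @[t' --> t] --> z t.
Proof.
move=> P /near_box[e e0 hP].
pose r : R := 1 + `|y.1 - x.1| + `|y.2 - x.2|.
have r0 : 0 < r by rewrite /r -addrA ltr_pwDl// addr_ge0.
apply/nbhs_ballP; exists (e / r) => /=; first by rewrite divr_gt0.
move=> t' tt'; have {}tt' : `|t' - t| < e / r by rewrite distrC.
have key (a b : R) : `|b - a| <= r -> `|(1 - t') * a + t' * b - ((1 - t) * a + t * b)| < e.
  move=> abr; rewrite (_ : _ - _ = (t' - t) * (b - a)); last by ring.
  rewrite normrM; have [->|ab0] := eqVneq `|b - a| 0; first by rewrite mulr0.
  have ab : 0 < `|b - a| by rewrite lt_neqAle eq_sym ab0 normr_ge0.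
  apply: (@lt_le_trans _ _ (e / r * `|b - a|)); first by rewrite ltr_pM2r.
  apply: (@le_trans _ _ (e / r * r)); first by rewrite ler_wpM2l// divr_ge0// ltW.
  by rewrite divfK// gt_eqF.
have hx := normr_ge0 (y.1 - x.1); have hy := normr_ge0 (y.2 - x.2).
by apply: hP; rewrite !ptE; apply: key; rewrite /r; lra.
Qed.

Lemma near_segment_notin K t : K \in cells M -> ~ simplex K (z t) ->
  \forall t' \near t, ~ simplex K (z t').
Proof. by move=> KM nK; exact: (segment_cvg (near_notin hM KM nK)). Qed.

Definition met_at (S : {set sx M}) : set R :=
  [set t | exists K, [/\ K \in S, K \in cells M & simplex K (z t)]].

Lemma closed_met_at (S : {set sx M}) : closed (met_at S).
Proof.
rewrite -[met_at S]setCK; apply: open_closedC; rewrite openE => t nt.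
have : \forall t' \near t, forall K : sx M, K \in S -> K \in cells M -> ~ simplex K (z t').
  have := @filter_forall _ (sx M) (fun K t' => K \in S -> K \in cells M -> ~ simplex K (z t')) (nbhs t).
  apply => K; have [KS|KS] := boolP (K \in S); last exact: nearW.
  have [KM|KM] := boolP (K \in cells M); last exact: nearW.
  have : ~ simplex K (z t) by move=> Kz; apply: nt; exists K.
  by move=> /(near_segment_notin KM); apply: filterS => t' h' _ _.
by apply: filterS => t' h' [K [KS KM Kz]]; exact: (h' K KS KM).
Qed.

(** Two nonempty closed sets cannot cover the segment without meeting, and where they
    meet two triangles have a point in common that is not a vertex, hence an edge. *)
Lemma met_connected K L : K \in cells M -> L \in cells M -> simplex K x -> simplex L y ->
  connect (adjacent met) K L.
Proof.
move=> KM LM Kx Ly; apply: contraT => nKL.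
have z0 : z 0 = x by rewrite /z subr0 scale1r scale0r addr0.
have z1 : z 1 = y by rewrite /z subrr scale1r scale0r add0r.
have Kmet : K \in met by rewrite inE KM; apply/asboolP; exists 0; rewrite ?z0// lexx ler01.
have Lmet : L \in met by rewrite inE LM; apply/asboolP; exists 1; rewrite ?z1// lexx ler01.
(* The triangles that can be reached from [K], and the others. *)
pose S1 := [set K' in met | connect (adjacent met) K K']%SET.
pose S2 := [set K' in met | ~~ connect (adjacent met) K K']%SET.
have cover t : 0 <= t <= 1 -> met_at S1 t \/ met_at S2 t.
  move=> t01; have [K' KM' Kz] := (closure_cells hM _).1 (zOm t01).
  have Kmet' : K' \in met by rewrite inE KM'; apply/asboolP; exists t.
  have [c|c] := boolP (connect (adjacent met) K K'); [left|right]; exists K'; split => //;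
    by rewrite inE Kmet'.
have disj t : 0 <= t <= 1 -> met_at S1 t -> met_at S2 t -> False.
  move=> t01 [K1 [+ KM1 Kz1]] [K2 [+ KM2 Kz2]]; rewrite !inE => /andP[/andP[_ m1] c1] /andP[/andP[_ m2] c2].
  have K12 : K1 != K2 by apply: contraNneq c2 => <-.
  have sI := simplexI hM KM1 KM2 Kz1 Kz2.
  have /negP[] := c2; apply: (connect_trans c1); apply: connect1.
  have c1' := card_triangle (cell_triangular hM KM1); have c2' := card_triangle (cell_triangular hM KM2).
  apply/and5P; split; rewrite ?inE ?KM1 ?KM2 ?m1 ?m2//; apply/andP; split => //.
  have le3 : (#|(K1 :&: K2)%SET| < 3)%N.
    rewrite -c1'; apply: proper_card; rewrite properE finset.subsetIl/=.
    apply: contra K12 => s; rewrite eqEcard c1' c2' leqnn andbT.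
    by apply: (fintype.subset_trans s); exact: finset.subsetIr.
  move: le3; rewrite !ltnS leq_eqVlt => /orP[//|]; rewrite ltnS leq_eqVlt => /orP[|].
    move=> /cards1P[v Iv]; exfalso.
    have vI : v \in (K1 :&: K2)%SET by rewrite Iv finset.set11.
    move: (vI); rewrite inE => /andP[vK1 _]; apply: (zV t01 KM1 vK1).
    by have [a [_]] := sI; rewrite Iv !big_set1 => -> ->; rewrite scale1r.
  rewrite ltnS leqn0 cards_eq0 => /eqP I0; exfalso.
  by have [a [_]] := sI; rewrite I0 big_set0 => /esym/eqP; rewrite oner_eq0.
have I01 : connected (`[0, 1]%classic : set R) by exact: segment_connected.
have E : `[0, 1]%classic `&` met_at S1 = `[0, 1]%classic.
  apply: I01.
  - exists 0; split; first by rewrite /= in_itv/= lexx ler01.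
    by exists K; split => //; [rewrite inE Kmet connect0|rewrite z0].
  - exists (~` met_at S2); first exact/closed_openC/closed_met_at.
    apply/seteqP; split => t [t01 h1]; split => //.
      by move=> h2; apply: (disj t) => //; move: t01; rewrite /= in_itv.
    by have [] := cover t; first by move: t01; rewrite /= in_itv.
  - by exists (met_at S1) => //; exact: closed_met_at.
have [_ m1] : (`[0, 1]%classic `&` met_at S1) (1 : R) by rewrite E /= in_itv/= lexx ler01.
have m2 : met_at S2 (1 : R).
  by exists L; split => //; [rewrite inE Lmet nKL|rewrite z1].
by case: (disj 1); rewrite ?lexx ?ler01.
Qed.

(** A chain without repetition exists between the end triangles. *)
Lemma segment_variation (p : sx M -> aff R) K L : P1nc Om p ->
  K \in cells M -> L \in cells M -> simplex K x -> simplex L y ->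
  `|aff_eval (p K) x - aff_eval (p L) y| <= h * \sum_(K' in met) enorm (p K').2.
Proof.
move=> hp KM LM Kx Ly.
have /connectP[s0 ps0 eL] := met_connected KM LM Kx Ly.
move: Ly; rewrite eL; case: (shortenP ps0) => s ps us _ Ly.
apply: (le_trans (path_variation hp KM ps Kx Ly)).
rewrite ler_wpM2l//; first exact: ltW mesh_size_gt0.
have Kmet : K \in met.
  rewrite inE KM; apply/asboolP; exists 0; first by rewrite lexx ler01.
  by rewrite /z subr0 scale1r scale0r addr0.
have sub L' : L' \in K :: s -> L' \in met.
  rewrite inE => /orP[/eqP->//|Ls].
  elim: s K {KM Kx eL ps0 Kmet us Ly} ps Ls => // L1 s IH K0 /= /andP[/and3P[_ L1m _] ps].
  by rewrite inE => /orP[/eqP->//|]; exact: (IH _ ps).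
rewrite big_uniq//= big_mkcond [X in _ <= X]big_mkcond; apply: ler_sum => K' _.
case: ifP => [/sub->//|_]; case: ifP => // _; exact: enorm_ge0.
Qed.
End Segment.
End Regular.

(** * Translations of at most the mesh size *)

Section Null.
Variable R : realType.
Notation leb := (@leb2 R).
Implicit Types (x y v : pt R) (N A : set (mpt R)).

Definition null N := measurable N /\ leb N = 0%E.

Lemma nullU A N : null A -> null N -> null (A `|` N).
Proof. by move=> [mA A0] [mN N0]; split; [exact: measurableU|rewrite measureU0]. Qed.

Lemma null_bigsetU (I : Type) (s : seq I) (P : pred I) (F : I -> set (mpt R)) :
  (forall i, P i -> null (F i)) -> null (\big[setU/set0]_(i <- s | P i) F i).
Proof.
by move=> F0; apply: big_ind => //; exact: nullU.
Qed.

Lemma in_bigsetU (I : finType) (P : pred I) (F : I -> set (mpt R)) i x :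
  P i -> F i x -> (\big[setU/set0]_(i | P i) F i) x.
Proof. by move=> Pi Fx; rewrite (bigD1 i Pi); left. Qed.

Lemma null_translate N v : null N -> null ((fun x : mpt R => (x.1 + v.1, x.2 + v.2)) @^-1` N).
Proof.
move=> [mN N0]; have [mf hf] := scales_translate v; split.
  by rewrite -[X in measurable X]setTI; exact: mf.
by rewrite hf// N0 mule0.
Qed.

Lemma null_segment x y : null (segment x y).
Proof.
split; first exact: measurable_segment.
have [l [z lz] sl] : exists2 l : aff R, (exists z, aff_eval l z != 0) &
    segment x y `<=` [set u | aff_eval l u = 0].
  have [->|xy] := eqVneq x y.
    exists (- y.1, (1, 0)).
      by exists (y.1 + 1, 0); rewrite /aff_eval /dot /= (_ : - y.1 + (1 * (y.1 + 1) + 0 * 0) = 1) ?oner_neq0//; ring.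
    by move=> u [t _ ->]; rewrite /= /aff_eval /dot !ptE /=; ring.
  pose q : pt R := (- (y - x).2, (y - x).1).
  exists (- dot q x, q).
    exists (x + q); rewrite (_ : aff_eval _ _ = dot (y - x) (y - x)).
      by apply: contra_neq xy => /dot_eq0 e; apply/esym/eqP; rewrite -subr_eq0 e.
    by rewrite /aff_eval /q /dot !ptE /=; ring.
  by move=> u [t _ ->]; rewrite /= /aff_eval /q /dot !ptE /=; ring.
apply/eqP; rewrite -measure_le0 -(null_line lz); apply: le_measure; rewrite ?inE//.
- exact: measurable_segment.
- exact: measurable_aff_eq0.
Qed.

Definition box x (r : R) : set (mpt R) := [set u | `|u.1 - x.1| <= r /\ `|u.2 - x.2| <= r].

Lemma boxE x r : box x r = `[x.1 - r, x.1 + r]%classic `*` `[x.2 - r, x.2 + r]%classic.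
Proof.
apply/seteqP; split => u; rewrite /box /= !in_itv/= !ler_norml.
  by move=> [/andP[h1 h2] /andP[h3 h4]]; split; apply/andP; split; lra.
by move=> [/andP[h1 h2] /andP[h3 h4]]; split; apply/andP; split; lra.
Qed.

Lemma measurable_box x r : measurable (box x r).
Proof. by rewrite boxE; apply: measurableX; exact: measurable_itv. Qed.

Lemma leb_box x r : 0 <= r -> leb (box x r) = (4 * r ^+ 2)%:E.
Proof.
move=> r0; rewrite boxE [LHS]product_measure1E; [|exact: measurable_itv|exact: measurable_itv].
rewrite /= !lebesgue_measure_itv/= !lte_fin.
have [r00|rp] := eqVneq r 0.
  by rewrite r00 !addr0 !subr0 !ltxx mule0 expr0n/= mulr0.
have {}rp : 0 < r by rewrite lt_neqAle eq_sym rp.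
rewrite !ifT; [|by lra|by lra].
by rewrite -!EFinD -EFinM; congr EFin; ring.
Qed.
End Null.

Section LocalTranslation.
Variables (R : realType) (Om : set (pt R)) (M : mesh R) (Creg : R).
Notation V := 'I_(nv M).
Notation leb := (@leb2 R).
Implicit Types (K L S sg : sx M) (a b c v w : V) (l : aff R) (x y z : pt R).
Local Notation pos := (@pos R M).
Hypothesis hOm : bounded_polygonal_domain Om.
Hypothesis hM : acute_mesh Om M.
Hypothesis hC : 0 < Creg.
Hypothesis hR : mesh_regular Om M Creg.
Notation h := (mesh_size M).

(** The lines carrying the edges rather than the edges: level sets of affine functions
    are simpler, and are null as well. *)
Definition skeleton : set (mpt R) :=
  \big[setU/set0]_(K in cells M) \big[setU/set0]_(v in K) [set u : mpt R | aff_eval (bary K v) u = 0].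

Lemma null_skeleton : null skeleton.
Proof.
apply: null_bigsetU => K KM; apply: null_bigsetU => v vK.
split; first exact: measurable_aff_eq0.
exact: bary_null (cell_triangular hM KM) vK.
Qed.

Lemma off_skeleton x : closure Om x -> ~ skeleton x -> exists2 K, K \in cells M & osimplex K x.
Proof.
move=> /(closure_cells hM)[K KM Kx] nS; exists K => //.
have nK := cell_triangular hM KM.
rewrite cell_osimplexP// => v vK; rewrite lt_neqAle (cell_simplexP x nK).1// andbT eq_sym.
by apply/eqP => e; apply: nS; apply: (in_bigsetU KM); exact: (in_bigsetU vK).
Qed.

Lemma leb_cells (s : seq (sx M)) : uniq s -> {subset s <= cells M} ->
  measurable (\big[setU/set0]_(K <- s) (osimplex K : set (mpt R))) /\
  leb (\big[setU/set0]_(K <- s) (osimplex K : set (mpt R))) = (\sum_(K <- s) area K)%:E.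
Proof.
elim: s => [|K s IH] /=.
  by rewrite !big_nil measure0.
move=> /andP[Ks us] sub; rewrite !big_cons.
have [|mU eU] := IH us; first by move=> L Ls; apply: sub; rewrite inE Ls orbT.
have KM : K \in cells M by apply: sub; rewrite inE eqxx.
have mK := measurable_osimplex hM KM.
split; first exact: measurableU.
have disj : osimplex K `&` \big[setU/set0]_(L <- s) osimplex L = set0.
  apply/seteqP; split => // x [Kx]; rewrite -bigcup_seq => -[L /= Ls Lx].
  have LM : L \in cells M by apply: sub; rewrite inE Ls orbT.
  by move: Ks; rewrite (osimplex_disjoint hM KM LM Kx (osimplexS Lx)) Ls.
rewrite [LHS](measureU _ mK mU disj) EFinD; congr (_ + _)%E; last exact: eU.
have [N [mN N0 oE]] := simplex_osimplex_null hM KM.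
have nK := cell_triangular hM KM; have mKc := measurable_cell nK.
rewrite -(leb_cell nK) [in LHS]oE [LHS](measureD mKc mN (leb_cell_fin nK)).
suff /eqP e0 : leb (simplex K `&` N) == 0%E by rewrite [X in (_ - X)%E]e0 sube0.
by rewrite -measure_le0 -N0; apply: le_measure; rewrite ?inE//; exact: measurableI.
Qed.

Definition anchor K : pt R := if [pick v in K] is Some v then pos v else 0.

Lemma anchor_simplex K : K \in cells M -> simplex K (anchor K).
Proof.
move=> KM; rewrite /anchor; case: pickP => [v vK|h0]; first exact: simplex_vertex.
have := card_triangle (cell_triangular hM KM).
by rewrite (eq_card0 h0).
Qed.

(** The triangles anchored in the box are disjoint and contained in a box of half-side
    [3 * h], of area [36 * h ^+ 2], while each has area at least
    [Creg ^+ 2 * h ^+ 2 / 4]; and [144 = 36 * 4]. *)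
Lemma card_near x : (#|[set K in cells M | `[< box (anchor K) (2 * h) x >]]%SET|)%:R * Creg ^+ 2 <= 144.
Proof.
set T := [set K in cells M | _]%SET.
have h0 := mesh_size_gt0 hOm hM.
have TM : {subset enum T <= cells M} by move=> K; rewrite mem_enum inE => /andP[].
have [mU eU] := leb_cells (enum_uniq T) TM.
have : (leb (\big[setU/set0]_(K <- enum T) (osimplex K : set (mpt R))) <= leb (box x (3 * h)))%E.
  apply: le_measure; rewrite ?inE//; first exact: measurable_box.
  move=> u; rewrite -bigcup_seq => -[K /= KT Ku].
  have KM := TM K KT; move: KT; rewrite mem_enum inE => /andP[_ /asboolP[b1 b2]].
  have d := simplex_diam KM (osimplexS Ku) (anchor_simplex KM).
  have [d1 d2] := enorm_coord (u - anchor K); move: d1 d2; rewrite !ptE => d1 d2.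
  split.
    rewrite (_ : u.1 - x.1 = (u.1 - (anchor K).1) - (x.1 - (anchor K).1)); last by ring.
    by rewrite (le_trans (ler_normB _ _))//; lra.
  rewrite (_ : u.2 - x.2 = (u.2 - (anchor K).2) - (x.2 - (anchor K).2)); last by ring.
  by rewrite (le_trans (ler_normB _ _))//; lra.
rewrite eU leb_box; last by rewrite mulr_ge0// ltW.
rewrite lee_fin => le1.
have le2 : #|T|%:R * (Creg ^+ 2 * h ^+ 2 / 4) <= \sum_(K <- enum T) area K.
  rewrite big_enum/= -sum1_card natr_sum mulr_suml; apply: ler_sum => K; rewrite inE => /andP[KM _].
  by rewrite mul1r ler_pdivrMr// [area K * 4]mulrC (area_ge hOm hM hC hR KM).
have h2 : 0 < h ^+ 2 by rewrite exprn_gt0.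
rewrite -(ler_pM2r h2) -mulrA.
have := le_trans le2 le1; rewrite exprMn; lra.
Qed.

(** The squared L^2 norm of the broken gradient. *)
Definition grad_energy (p : sx M -> aff R) : R := \sum_(K in cells M) area K * dot (p K).2 (p K).2.

Lemma grad_energy_ge0 p : 0 <= grad_energy p.
Proof.
apply: sumr_ge0 => K KM; rewrite mulr_ge0 ?dot_ge0//.
by rewrite ltW// area_gt0//; exact: (cell_triangular hM KM).
Qed.

Lemma measurable_P1 (p : sx M -> aff R) : measurable_fun setT (P1fun p : mpt R -> R).
Proof. by apply: (measurable_pw hM) => K _; exact: measurable_aff. Qed.

Lemma measurable_shift (v : pt R) : measurable_fun setT (fun x : mpt R => x + v : mpt R).
Proof. by have [] := scales_translate v. Qed.

(** Cauchy-Schwarz, from the sum of the squares of all differences. *)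
Lemma sum_sq_le (I : finType) (T : {set I}) (g : I -> R) :
  (\sum_(K in T) g K) ^+ 2 <= #|T|%:R * \sum_(K in T) g K ^+ 2.
Proof.
rewrite -subr_ge0.
have : 0 <= \sum_(K in T) \sum_(L in T) (g K - g L) ^+ 2.
  by apply: sumr_ge0 => K _; apply: sumr_ge0 => L _; exact: sqr_ge0.
have -> : \sum_(K in T) \sum_(L in T) (g K - g L) ^+ 2 =
    2 * (#|T|%:R * (\sum_(K in T) g K ^+ 2) - (\sum_(K in T) g K) ^+ 2).
  set S := \sum_(K in T) g K; set Q := \sum_(K in T) g K ^+ 2.
  transitivity (\sum_(K in T) (#|T|%:R * g K ^+ 2 + (Q - 2 * g K * S))).
    apply: eq_bigr => K _.
    rewrite (eq_bigr (fun j => g K ^+ 2 + (g j ^+ 2 - 2 * g K * g j))); last by move=> j _; ring.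
    by rewrite big_split/= sumrB -[X in _ - X]mulr_sumr [X in X + _]sumr_const -(mulr_natl (g K ^+ 2) #|T|).
  rewrite big_split/= sumrB [X in _ + (X - _)]sumr_const -[X in X + _]mulr_sumr -[X in _ - X]mulr_suml.
  by rewrite -[X in _ - X * _]mulr_sumr -/S -/Q -(mulr_natl Q #|T|); ring.
by rewrite pmulr_rge0.
Qed.

(** The first factor bounds the number of triangles near a point ([card_near]). In the
    second one, a box of half-side [2 * h] has area [16 * h ^+ 2], which is at most
    [64 / Creg ^+ 2] times the area of any triangle. *)
Definition translation_const : R := 144 / Creg ^+ 2 * (64 / Creg ^+ 2).

(** Two points at distance at most [h] are joined by a segment meeting boundedly
    many triangles; integrating in [x], each triangle counts on a set of measure
    of order [h ^+ 2]. *)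
Lemma local_translation (p : sx M -> aff R) (A : set (mpt R)) (e : pt R) : P1nc Om p ->
  measurable A -> enorm e <= h ->
  (forall x, A x -> forall t : R, 0 <= t <= 1 -> closure Om (x + t *: e)) ->
  (\int[leb]_(x in A) ((P1fun p (x + e) - P1fun p x) ^+ 2)%:E <=
   (translation_const * h ^+ 2 * grad_energy p)%:E)%E.
Proof.
move=> hp mA eh AOm.
have h0 := mesh_size_gt0 hOm hM.
have C2 : 0 < Creg ^+ 2 by rewrite exprn_gt0.
pose c : R := 144 / Creg ^+ 2.
have c0 : 0 < c by rewrite divr_gt0.
pose f K (x : mpt R) : \bar R := ((h ^+ 2 * c * dot (p K).2 (p K).2)%:E * (\1_(box (anchor K) (2 * h)) x)%:E)%E.
have w0 K : 0 <= h ^+ 2 * c * dot (p K).2 (p K).2.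
  by apply: mulr_ge0; [apply: mulr_ge0; [exact: sqr_ge0|exact: ltW]|exact: dot_ge0].
have f0 K x : (0 <= f K x)%E by rewrite mule_ge0// lee_fin.
have mf K : measurable_fun setT (f K).
  apply: emeasurable_funM; first exact: measurable_cst.
  by apply/measurable_EFinP; apply: measurable_indic; exact: measurable_box.
(* The points whose segment has an end on the skeleton or passes through a vertex. *)
pose N : set (mpt R) := (skeleton `|` ((fun x : mpt R => (x.1 + e.1, x.2 + e.2)) @^-1` skeleton)) `|`
  \big[setU/set0]_(v : V) segment (pos v) (pos v - e).
have [mN N0] : null N.
  apply: nullU; first by apply: nullU; [exact: null_skeleton|exact/null_translate/null_skeleton].
  by apply: null_bigsetU => v _; exact: null_segment.
apply: (@le_trans _ _ (\int[leb]_(x in A) (\sum_(K <- enum (cells M)) f K x))%E).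
  apply: ae_ge0_le_integral => //.
  - by move=> x _; rewrite lee_fin sqr_ge0.
  - apply: measurable_funTS; apply/measurable_EFinP; apply: measurable_funX.
    apply: measurable_funB; last exact: measurable_P1.
    by apply: measurableT_comp; [exact: measurable_P1|exact: measurable_shift].
  - by move=> x _; apply: sume_ge0 => K _.
  - by apply: measurable_funTS; apply: emeasurable_sum => K; exact: mf.
  exists N; split => // x /= /not_implyP[Ax nle]; apply: contrapT => nN; apply: nle.
  have nS : ~ skeleton x by move=> Sx; apply: nN; left; left.
  have nSe : ~ skeleton (x + e) by move=> Sx; apply: nN; left; right.
  have nV v : ~ segment (pos v) (pos v - e) x.
    by move=> Sx; apply: nN; right; exact: (in_bigsetU (P := xpredT) _ Sx).
  have Ox : closure Om x by have := AOm x Ax 0; rewrite scale0r addr0; apply; rewrite lexx ler01.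
  have Oxe : closure Om (x + e) by have := AOm x Ax 1; rewrite scale1r; apply; rewrite lexx ler01.
  have [K KM Kx] := off_skeleton Ox nS; have [L LM Lx] := off_skeleton Oxe nSe.
  have zE t : (1 - t) *: x + t *: (x + e) = x + t *: e by apply: ptP; rewrite !ptE; ring.
  have zOm (t : R) : 0 <= t <= 1 -> closure Om ((1 - t) *: x + t *: (x + e)).
    by move=> t01; rewrite zE; exact: AOm.
  have zV (t : R) K' v : 0 <= t <= 1 -> K' \in cells M -> v \in K' ->
      (1 - t) *: x + t *: (x + e) <> pos v.
    move=> t01 _ _; rewrite zE => E; apply: (nV v); exists t => //.
    by rewrite -E; apply: ptP; rewrite !ptE; ring.
  have var := segment_variation hOm hM zOm zV hp KM LM (osimplexS Kx) (osimplexS Lx).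
  rewrite /P1fun (pw_in hM _ KM Kx) (pw_in hM _ LM Lx).
  set T := met _ _ _ in var.
  set T' := [set K' in cells M | `[< box (anchor K') (2 * h) x >]]%SET.
  have TT' : T \subset T'.
    apply/fintype.subsetP => K'; rewrite !inE => /andP[KM' /asboolP[t t01 Kz]].
    rewrite KM'; apply/asboolP; rewrite zE in Kz.
    have d := simplex_diam KM' Kz (anchor_simplex KM').
    have [t0 t1] := andP t01.
    have d' : enorm (x - anchor K') <= 2 * h.
      have -> : x - anchor K' = (x + t *: e - anchor K') + (- t) *: e.
        by apply: ptP; rewrite !ptE; ring.
      apply: (le_trans (enormD _ _)); rewrite enormZ normrN ger0_norm//.
      have : t * enorm e <= 1 * h by apply: ler_pM => //; exact: enorm_ge0.
      by lra.
    by have [d1 d2] := enorm_coord (x - anchor K'); split; [exact: le_trans d1 d'|exact: le_trans d2 d'].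
  have fE : (\sum_(K <- enum (cells M)) f K x)%E =
      (h ^+ 2 * c * \sum_(K in T') dot (p K).2 (p K).2)%:E.
    rewrite big_enum/= mulr_sumr.
    rewrite (eq_bigr (fun K => (if K \in T' then h ^+ 2 * c * dot (p K).2 (p K).2 else 0)%:E)).
      rewrite sumEFin; congr EFin; rewrite [RHS]big_mkcond [LHS]big_mkcond; apply: eq_bigr => K' _.
      by rewrite inE; case: (K' \in cells M).
    move=> K' KM'; rewrite /f indicE inE KM'/=; case: asboolP => hb.
      by rewrite mem_set// mule1.
    by rewrite memNset// mule0.
  rewrite fE lee_fin -real_normK ?num_real// distrC.
  apply: (@le_trans _ _ ((h * \sum_(K' in T') enorm (p K').2) ^+ 2)).
    rewrite ler_pXn2r ?nnegrE ?normr_ge0 ?mulr_ge0 ?(ltW h0)//; last first.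
      by apply: sumr_ge0 => K' _; exact: enorm_ge0.
    apply: (le_trans var); rewrite ler_pM2l// (big_setID T (A := T'))/= (finset.setIidPr TT').
    by rewrite lerDl; apply: sumr_ge0 => K' _; exact: enorm_ge0.
  rewrite exprMn -mulrA ler_pM2l ?exprn_gt0//.
  apply: (le_trans (sum_sq_le _ _)).
  rewrite (eq_bigr (fun K => dot (p K).2 (p K).2)); last by move=> K' _; rewrite enorm_sq.
  apply: ler_wpM2r; first by apply: sumr_ge0 => K' _; exact: dot_ge0.
  by rewrite /c ler_pdivlMr//; exact: card_near.
rewrite ge0_integral_sum//; last by move=> K; exact: measurable_funTS.
have -> : translation_const * h ^+ 2 * grad_energy p =
    \sum_(K <- enum (cells M)) translation_const * h ^+ 2 * (area K * dot (p K).2 (p K).2).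
  by rewrite big_enum/= -mulr_sumr.
rewrite -sumEFin; rewrite !big_enum/=; apply: lee_sum => K KM.
apply: (@le_trans _ _ (\int[leb]_x f K x)%E).
  by apply: ge0_subset_integral.
rewrite ge0_integralZl//=; last 2 first.
- by apply/measurable_EFinP; apply: measurable_indic; exact: measurable_box.
- by rewrite lee_fin.
rewrite integral_indic//; last exact: measurable_box.
rewrite setIT leb_box; last by rewrite mulr_ge0// ltW.
rewrite -EFinM lee_fin.
have ar := area_ge hOm hM hC hR KM.
have dg := dot_ge0 (p K).2; set g := dot _ _ in dg *.
have -> : h ^+ 2 * c * g * (4 * (2 * h) ^+ 2) = (translation_const / 4) * h ^+ 2 * g * (Creg ^+ 2 * h ^+ 2).
  by rewrite /c /translation_const; field; rewrite gt_eqF.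
have -> : translation_const * h ^+ 2 * (area K * g) = (translation_const / 4) * h ^+ 2 * g * (4 * area K).
  by field.
have w1 : 0 <= translation_const / 4 * h ^+ 2 * g.
  apply: mulr_ge0; last exact: dg; apply: mulr_ge0; last exact: sqr_ge0.
  have i0 : 0 <= (Creg ^+ 2)^-1 by rewrite invr_ge0 ltW.
  by apply: divr_ge0; [apply: mulr_ge0; apply: mulr_ge0; rewrite ?ler0n|exact: ler0n].
exact: (ler_wpM2l w1 ar).
Qed.

End LocalTranslation.

(** * Arbitrary translations *)

Lemma enorm_le_sum (R : realType) (u : pt R) : enorm u <= `|u.1| + `|u.2|.
Proof.
rewrite -(ler_pXn2r (n := 2)) ?nnegrE ?enorm_ge0 ?addr_ge0// enorm_sq sqrrD !real_normK ?num_real//.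
by rewrite /dot -!expr2; have := mulr_ge0 (normr_ge0 u.1) (normr_ge0 u.2); lra.
Qed.

Section Translation.
Variables (R : realType) (Om : set (pt R)) (Creg : R).
Notation leb := (@leb2 R).
Implicit Types (x y z e : pt R).
Hypothesis hOm : bounded_polygonal_domain Om.
Hypothesis hC : 0 < Creg.

Lemma translation_const_ge0 : 0 <= translation_const Creg.
Proof.
have i0 : 0 <= (Creg ^+ 2)^-1 by rewrite invr_ge0 exprn_ge0// ltW.
by apply: mulr_ge0; apply: mulr_ge0; rewrite ?ler0n.
Qed.

Lemma measurable_sq_diff (M : mesh R) (hM : acute_mesh Om M) (p : sx M -> aff R) e (A : set (mpt R)) :
  measurable_fun A (fun x : mpt R => ((P1fun p (x + e) - P1fun p x) ^+ 2)%:E).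
Proof.
apply: measurable_funTS; apply/measurable_EFinP; apply: measurable_funX.
apply: measurable_funB; last exact: (measurable_P1 hM).
by apply: measurableT_comp; [exact: (measurable_P1 hM)|exact: measurable_shift].
Qed.

(** The translation is divided into [n] equal ones of length at most [h], with
    [n * h <= enorm e + h]. The differences are summed by Cauchy-Schwarz, which costs
    a factor [n], and each contributes [h ^+ 2]: in all [(n * h) ^+ 2]. *)
Lemma translation (M : mesh R) (p : sx M -> aff R) (A : set (mpt R)) e (d : R) :
  acute_mesh Om M -> mesh_regular Om M Creg -> P1nc Om p -> measurable A ->
  enorm e + mesh_size M <= d ->
  (forall x, A x -> forall t : R, 0 <= t <= 1 -> closure Om (x + t *: e)) ->
  (\int[leb]_(x in A) ((P1fun p (x + e) - P1fun p x) ^+ 2)%:E <=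
   (translation_const Creg * d ^+ 2 * grad_energy p)%:E)%E.
Proof.
move=> hM hR hp mA ed AOm; set h := mesh_size M in ed.
have h0 : 0 < h by exact: (mesh_size_gt0 hOm hM).
pose n := (Num.truncn (enorm e / h)).+1.
have eh0 : 0 <= enorm e / h by rewrite divr_ge0 ?enorm_ge0// ltW.
have n1 : enorm e / h < n%:R by exact: truncnS_gt.
have n2 : n%:R * h <= d.
  apply: le_trans ed; rewrite -ler_pdivlMr// mulrDl divff ?gt_eqF// /n -addn1 natrD lerD2r.
  by have := truncn_itv eh0 => /andP[].
have n0 : (0 : R) < n%:R by rewrite ltr0n.
pose e' := n%:R^-1 *: e.
have e'h : enorm e' <= h.
  rewrite enormZ ger0_norm ?invr_ge0 ?ler0n// ler_pdivrMl//.
  by rewrite mulrC -ler_pdivrMl// mulrC ltW.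
pose P := P1fun p.
pose F (v x : mpt R) : \bar R := ((P (x + v + e') - P (x + v)) ^+ 2)%:E.
have F0 v x : (0 <= F v x)%E by rewrite lee_fin sqr_ge0.
have mF v : measurable_fun setT (F v).
  have := measurableT_comp (measurable_sq_diff hM p e' (A := setT)) (measurable_shift v).
  exact.
apply: (@le_trans _ _ (\int[leb]_(x in A) (\sum_(i <- enum 'I_n) (n%:R%:E * F ((i : nat)%:R *: e') x)))%E).
  apply: ge0_le_integral => //.
  - by move=> x _; rewrite lee_fin sqr_ge0.
  - exact: measurable_sq_diff.
  - by apply: emeasurable_sum => i; apply: measurable_funeM; exact: measurable_funTS.
  move=> x _.
  have -> : P1fun p (x + e) - P1fun p x =
      \sum_(i in [set: 'I_n]%SET) (P (x + (i : nat)%:R *: e' + e') - P (x + (i : nat)%:R *: e')).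
    transitivity (\sum_(0 <= i < n) (P (x + i.+1%:R *: e') - P (x + i%:R *: e'))).
      rewrite telescope_sumr// scale0r addr0 /e' scalerA divff ?scale1r// gt_eqF//.
    rewrite big_mkord; apply: eq_big => [i|i _]; first by rewrite finset.in_setT.
    by congr (P _ - _); apply: ptP; rewrite !ptE -natr1; ring.
  under [leRHS]eq_bigr do rewrite /F -EFinM.
  rewrite sumEFin lee_fin; apply: (le_trans (sum_sq_le _ _)).
  rewrite big_enum/= -mulr_sumr cardsT card_ord ler_wpM2l ?ler0n//.
  by rewrite le_eqVlt; apply/orP; left; apply/eqP; apply: eq_bigl => i; rewrite finset.in_setT.
rewrite ge0_integral_sum//; first last.
- by move=> i x _; rewrite mule_ge0// lee_fin ler0n.
- by move=> i; apply: measurable_funeM; exact: measurable_funTS.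
have step (i : 'I_n) : (\int[leb]_(x in A) (n%:R%:E * F ((i : nat)%:R *: e') x) <=
    (n%:R * (translation_const Creg * h ^+ 2 * grad_energy p))%:E)%E.
  rewrite ge0_integralZl//; last exact: measurable_funTS.
  rewrite EFinM; apply: lee_wpmul2l; first by rewrite lee_fin ler0n.
  set v := (i : nat)%:R *: e'.
  pose A' : set (mpt R) := (fun y : mpt R => y + (- v)) @^-1` A.
  have mA' : measurable A'.
    by rewrite -[X in measurable X]setTI; exact: measurable_shift.
  have := @scales_ge0_integral R _ 1 A' (F 0) (scales_translate v) ltr01 mA'.
  rewrite invr1 mul1e => /(_ (measurable_funTS (mF 0)) (fun x _ => F0 0 x)).
  have -> : (fun x : mpt R => (x.1 + v.1, x.2 + v.2)) @^-1` A' = A.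
    have E (x : pt R) : A' (x + v) = A x by rewrite /A' /preimage/= addrK.
    by apply/seteqP; split => x; [move=> h1; rewrite -E|move=> h1; rewrite -E in h1].
  have -> : (\int[leb]_(x in A) F 0%R (x.1 + v.1, x.2 + v.2)%R = \int[leb]_(x in A) F v x)%E.
    by apply: eq_integral => x _; rewrite /F addr0.
  move=> <-; have := local_translation hOm hM hC hR hp mA' e'h.
  rewrite (_ : (\int[leb]_(x in A') F 0%R x)%E = (\int[leb]_(x in A') ((P1fun p (x + e') - P1fun p x) ^+ 2)%:E)%E).
    apply => y Ay t /andP[t0 t1].
    have -> : y + t *: e' = y - v + ((i%:R + t) / n%:R) *: e.
      by apply: ptP; rewrite /v /e' !ptE; ring.
    apply: AOm => //; rewrite divr_ge0 ?addr_ge0 ?ler0n//= ler_pdivrMr// mul1r.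
    have : (i.+1%:R : R) <= n%:R by rewrite ler_nat.
    by rewrite -natr1; lra.
  by apply: eq_integral => x _; rewrite /F addr0.
apply: (@le_trans _ _ (\sum_(i <- enum 'I_n) (n%:R * (translation_const Creg * h ^+ 2 * grad_energy p))%:E)%E).
  by apply: lee_sum => i _; exact: step.
rewrite sumEFin lee_fin big_enum/= sumr_const card_ord -[X in X <= _]mulr_natl.
have -> : n%:R * (n%:R * (translation_const Creg * h ^+ 2 * grad_energy p)) =
   translation_const Creg * (n%:R * h) ^+ 2 * grad_energy p by ring.
apply: ler_wpM2r; first exact: (grad_energy_ge0 hM).
apply: ler_wpM2l; first exact: translation_const_ge0.
by rewrite ler_pXn2r// nnegrE ?mulr_ge0 ?ler0n ?(ltW h0)// (le_trans _ n2)// mulr_ge0 ?ler0n// ltW.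
Qed.

Lemma domain_bounded : exists2 r : R, 0 < r & forall x, closure Om x -> box 0 r x.
Proof.
have [[_ _ _ bO] _] := hOm; have [r [_ hr]] := bO.
have r1 : r < `|r| + 1 by rewrite (le_lt_trans (ler_norm r))// ltrDl.
exists (`|r| + 1); first by rewrite ltr_pwDr.
have cb : closed (box 0 (`|r| + 1) : set (pt R)).
  rewrite -[box _ _]setCK; apply: open_closedC; rewrite openE => x nx.
  have [y1|y1] := leP `|x.1| (`|r| + 1); last first.
    have [e e0 he] : exists2 e, 0 < e & forall y : pt R, `|y.1 - x.1| < e -> `|r| + 1 < `|y.1|.
      exists (`|x.1| - (`|r| + 1)); first by lra.
      by move=> y; have := ler_normD (x.1 - y.1) y.1; rewrite subrK (distrC x.1); lra.
    apply/near_box; exists e => // y h1 _; rewrite /box /= !subr0 => -[h2 _].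
    by have := he y h1; lra.
  have [y2|y2] := leP `|x.2| (`|r| + 1); first by exfalso; apply: nx; split; rewrite /= subr0.
  have [e e0 he] : exists2 e, 0 < e & forall y : pt R, `|y.2 - x.2| < e -> `|r| + 1 < `|y.2|.
    exists (`|x.2| - (`|r| + 1)); first by lra.
    by move=> y; have := ler_normD (x.2 - y.2) y.2; rewrite subrK (distrC x.2); lra.
  apply/near_box; exists e => // y _ h1; rewrite /box /= !subr0 => -[_ h2].
  by have := he y h1; lra.
have sub : Om `<=` box 0 (`|r| + 1).
  move=> x Ox; have := hr _ r1 x Ox; rewrite /= prod_normE/= ge_max => /andP[h1 h2].
  by split; rewrite /= subr0.
by move=> x cx; apply: cb; exact: (closure_subset sub cx).
Qed.

Lemma mesh_size_bounded (M : mesh R) (r : R) : acute_mesh Om M -> mesh_regular Om M Creg ->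
  (forall x, closure Om x -> box 0 r x) -> mesh_size M <= 4 * r / Creg.
Proof.
move=> hM hR hr; have [[_ _ [x Ox] _] _] := hOm.
have [K KM _] := (closure_cells hM x).1 (@subset_closure _ Om _ Ox).
have [a [b [c hv]]] := cell_triangular hM KM; have [aK bK _] := in_vertices hv.
rewrite ler_pdivlMr// mulrC; apply: (le_trans (edge_length_vertices hR KM hv)).
have inb v : v \in K -> box 0 r (pos v).
  by move=> vK; apply/hr/(closure_cells hM); exists K => //; exact: simplex_vertex.
have := inb a aK; have := inb b bK; rewrite /box /= !subr0 => -[b1 b2] [a1 a2].
apply: (le_trans (enorm_le_sum _)); rewrite !ptE.
by have := ler_normB (pos a).1 (pos b).1; have := ler_normB (pos a).2 (pos b).2; lra.
Qed.

End Translation.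

(** * Closeness to a constant by averaging *)

Section Poincare.
Variables (R : realType) (Om : set (pt R)) (Creg : R).
Notation leb := (@leb2 R).
Implicit Types (x y z e : pt R) (A B U : set (mpt R)).
Hypothesis hOm : bounded_polygonal_domain Om.
Hypothesis hC : 0 < Creg.

Lemma sigma_finite_leb : sigma_finite setT leb.
Proof.
exists (fun n => box 0 n%:R) => [|n]; last first.
  split; first exact: measurable_box.
  by have := @leb_box R 0 n%:R (ler0n _ _) => ->; rewrite ltry.
apply/seteqP; split => // x _; exists (Num.truncn (`|x.1| + `|x.2|)).+1 => //.
have h1 := truncnS_gt (`|x.1| + `|x.2|).
have := normr_ge0 x.1; have := normr_ge0 x.2; rewrite /box /= !subr0 => h2 h3.
by split; lra.
Qed.

Lemma tonelli (F : mpt R * mpt R -> \bar R) : measurable_fun setT F -> (forall w, 0 <= F w)%E ->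
  measurable_fun setT (fun x => \int[leb]_y F (x, y))%E /\
  (\int[leb]_x \int[leb]_y F (x, y) = \int[leb]_y \int[leb]_x F (x, y))%E.
Proof.
move=> mF F0.
pose m := HB.pack_for {sigma_finite_measure set (mpt R) -> \bar R} (Measure.sort leb)
  (Measure_isSigmaFinite.Build _ _ _ leb sigma_finite_leb).
split; first exact: (@measurable_fun_fubini_tonelli_F _ _ _ _ R m F mF F0).
exact: (@fubini_tonelli _ _ _ _ R m m F mF F0).
Qed.

Lemma measurable_add2 : measurable_fun setT (fun w : mpt R * mpt R => w.1 + w.2 : mpt R).
Proof.
apply/measurable_fun_pairP; split => /=.
  rewrite (_ : _ \o _ = fun w : mpt R * mpt R => w.1.1 + w.2.1)//.
  apply: measurable_funD.
    by apply: (measurableT_comp (f := fst)) => //; exact: measurable_fst.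
  by apply: (measurableT_comp (f := fst)) => //; exact: measurable_snd.
rewrite (_ : _ \o _ = fun w : mpt R * mpt R => w.1.2 + w.2.2)//.
apply: measurable_funD.
  by apply: (measurableT_comp (f := snd)) => //; exact: measurable_fst.
by apply: (measurableT_comp (f := snd)) => //; exact: measurable_snd.
Qed.

Section Averaging.
Variables (P : mpt R -> R) (U : set (mpt R)).
Hypotheses (mP : measurable_fun setT P) (mU : measurable U).

Let F (w : mpt R * mpt R) : \bar R :=
  ((P (w.1 + w.2) - P w.1) ^+ 2 * (\1_U w.1 * \1_U (w.1 + w.2)))%:E.

Let F0 w : (0 <= F w)%E.
Proof. by rewrite lee_fin mulr_ge0 ?sqr_ge0// !indicE mulr_ge0. Qed.

Let mF : measurable_fun setT F.
Proof.
have mI : measurable_fun setT (\1_U : mpt R -> R) by exact: measurable_indic.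
apply/measurable_EFinP; apply: measurable_funM.
  apply: measurable_funX; apply: measurable_funB.
    exact: (measurableT_comp mP measurable_add2).
  exact: (measurableT_comp mP measurable_fst).
apply: measurable_funM; first exact: (measurableT_comp mI measurable_fst).
exact: (measurableT_comp mI measurable_add2).
Qed.

Let integral_F_in x : U x ->
  (\int[leb]_y F (x, y) = \int[leb]_(y in U) ((P y - P x) ^+ 2)%:E)%E.
Proof.
move=> Ux.
have := @scales_ge0_integral R _ 1 U (fun w => ((P w - P x) ^+ 2)%:E) (scales_translate x) ltr01 mU.
rewrite invr1 mul1e => ->.
- rewrite [RHS]integral_mkcond; apply: eq_integral => w _.
  rewrite patchE /F /= [\1_U x]indicE mem_set// mul1r indicE.
  have -> : (w \in (fun z : mpt R => (z.1 + x.1, z.2 + x.2)) @^-1` U) = (x + w \in U).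
    by rewrite [x + w]addrC; apply/idP/idP; rewrite !inE.
  rewrite (_ : (w.1 + x.1, w.2 + x.2) = x + w); last by rewrite [x + w]addrC.
  by case: ifP => _; rewrite ?mulr1 ?mulr0.
- apply: measurable_funTS; apply/measurable_EFinP; apply: measurable_funX.
  by apply: measurable_funB.
- by move=> w _; rewrite lee_fin sqr_ge0.
Qed.

Let average_lower (c : R) : 0 <= c ->
  (forall a, c%:E <= \int[leb]_(x in U) ((P x - a) ^+ 2)%:E)%E ->
  (c%:E * leb U <= \int[leb]_x \int[leb]_y F (x, y))%E.
Proof.
move=> c0 Jc.
have mI : measurable_fun setT (fun x => (\1_U x)%:E : \bar R).
  by apply/measurable_EFinP; exact: measurable_indic.
have -> : (c%:E * leb U = \int[leb]_x (c%:E * (\1_U x)%:E))%E.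
  rewrite (ge0_integralZl leb measurableT mI); [|by move=> ? _; rewrite lee_fin|by rewrite lee_fin].
  by rewrite integral_indic// setIT.
apply: ge0_le_integral; first exact: measurableT.
- by move=> x _; rewrite mule_ge0// lee_fin.
- exact: measurable_funeM.
- by have [] := tonelli mF F0.
move=> x _; rewrite indicE; have [xU|xU] := boolP (x \in U); last first.
  by rewrite mule0; apply: integral_ge0 => y _; exact: F0.
rewrite mule1 integral_F_in; first exact: Jc.
by move: xU; rewrite inE.
Qed.

Let average_upper (k r : R) : 0 <= k -> 0 <= r -> U `<=` box 0 r ->
  (forall y, (\int[leb]_(x in U `&` (fun x : mpt R => (x + y)%R) @^-1` U)
     ((P (x + y)%R - P x) ^+ 2)%:E <= k%:E)%E) ->
  (\int[leb]_y \int[leb]_x F (x, y) <= (k * (4 * (2 * r) ^+ 2))%:E)%E.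
Proof.
move=> k0 r0 Ubox Hk.
have mB := @measurable_box R 0 (2 * r).
have mI : measurable_fun setT (fun y => (\1_(box 0 (2 * r)) y)%:E : \bar R).
  by apply/measurable_EFinP; exact: measurable_indic.
have -> : ((k * (4 * (2 * r) ^+ 2))%:E =
    \int[leb]_y (k%:E * (\1_(box 0%R (2 * r)) y)%:E))%E.
  rewrite (ge0_integralZl leb measurableT mI); [|by move=> ? _; rewrite lee_fin|by rewrite lee_fin].
  rewrite integral_indic// setIT EFinM; congr (_ * _)%E.
  by rewrite leb_box// mulr_ge0.
apply: ge0_le_integral; first exact: measurableT.
- by move=> y _; apply: integral_ge0 => x _; exact: F0.
- have := (@tonelli (fun w => F (w.2, w.1)) _ _).1; apply => //.
  apply: (measurableT_comp mF); apply/measurable_fun_pairP; split => /=.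
    exact: measurable_snd.
  exact: measurable_fst.
- exact: measurable_funeM.
move=> y _.
have -> : (\int[leb]_x F (x, y) =
    \int[leb]_(x in U `&` (fun x : mpt R => (x + y)%R) @^-1` U) ((P (x + y)%R - P x) ^+ 2)%:E)%E.
  rewrite [RHS]integral_mkcond; apply: eq_integral => x _.
  rewrite patchE /F /= !indicE -natrM mulnb.
  have -> : (x \in U `&` (fun x : mpt R => (x + y)%R) @^-1` U) = (x \in U) && (x + y \in U).
    by apply/idP/andP; rewrite !inE.
  by case: ifP => _; rewrite ?mulr1 ?mulr0.
rewrite indicE; have [yb|yb] := boolP (y \in box 0 (2 * r)).
  by rewrite mule1; exact: Hk.
rewrite mule0 (_ : U `&` _ = set0) ?integral_set0//.
apply/seteqP; split => // x [Ux Uxy]; move: yb => /negP; apply; rewrite inE.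
have hb (z : mpt R) : U z -> `|z.1| <= r /\ `|z.2| <= r.
  by move=> /Ubox; rewrite /box /= !subr0.
have [x1 x2] := hb _ Ux; have [y1 y2] : `|x.1 + y.1| <= r /\ `|x.2 + y.2| <= r := hb _ Uxy.
rewrite /box /= !subr0; split.
  have := ler_normB (x.1 + y.1) x.1.
  by rewrite (_ : x.1 + y.1 - x.1 = y.1); [lra|ring].
have := ler_normB (x.2 + y.2) x.2.
by rewrite (_ : x.2 + y.2 - x.2 = y.2); [lra|ring].
Qed.

(** A function whose translates are close to it in the mean is close to a constant.
    Its own values are candidates: if none of them would do, integrating over the
    value taken would give too large a double integral, which becomes a single one
    over translations; the differences of two points of [U] lie in a box of area
    [16 * r ^+ 2]. *)
Lemma exists_constant (u k r c : R) : 0 <= k -> 0 <= r -> U `<=` box 0 r -> leb U = u%:E ->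
  (forall y, (\int[leb]_(x in U `&` (fun x : mpt R => (x + y)%R) @^-1` U)
     ((P (x + y)%R - P x) ^+ 2)%:E <= k%:E)%E) ->
  0 <= c -> 16 * r ^+ 2 * k < c * u ->
  exists a, (\int[leb]_(x in U) ((P x - a) ^+ 2)%:E <= c%:E)%E.
Proof.
move=> k0 r0 Ubox uE Hk c0 cu; apply: contrapT => nex.
have Jc a : (c%:E <= \int[leb]_(x in U) ((P x - a) ^+ 2)%:E)%E.
  by rewrite leNgt; apply/negP => /ltW le1; apply: nex; exists a.
have := average_lower c0 Jc; rewrite (tonelli mF F0).2 uE => /le_trans.
move=> /(_ _ (average_upper k0 r0 Ubox Hk)); rewrite -EFinM lee_fin leNgt => /negP; apply.
by apply: le_lt_trans cu; rewrite le_eqVlt; apply/orP; left; apply/eqP; ring.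
Qed.

End Averaging.

(** Sets on which every nonconforming function, on every regular mesh, is close
    to a constant in terms of its broken gradient. The added 1 makes the bound
    positive, as the strict inequality in [exists_constant] requires. *)
Definition good A := exists2 C : R, 0 <= C &
  forall (M : mesh R), acute_mesh Om M -> mesh_regular Om M Creg ->
  forall p : sx M -> aff R, P1nc Om p -> exists a : R,
    (\int[leb]_(x in A) ((P1fun p x - a) ^+ 2)%:E <= (C * (grad_energy p + 1))%:E)%E.

(** Convexity keeps the segments between a point and its translate inside the domain,
    and boundedness limits the translations that occur. *)
Lemma good_convex U : measurable U -> U `<=` Om ->
  (forall x y (t : R), U x -> U y -> 0 <= t <= 1 -> U ((1 - t) *: x + t *: y)) -> good U.
Proof.
move=> mU UOm cU.
have [r r0 hr] := domain_bounded hOm.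
have Ubox : U `<=` box 0 r by move=> x /UOm Ox; apply/hr/subset_closure.
have Ufin : (leb U < +oo)%E.
  apply: (@le_lt_trans _ _ (leb (box 0 r))).
    by apply: le_measure; rewrite ?inE//; exact: measurable_box.
  by rewrite leb_box ?ltry// ltW.
have [U0|U0] := eqVneq (leb U) 0%E.
  exists 0 => // M hM _ p _; exists 0; rewrite null_set_integral ?mul0r//.
  apply: measurable_funTS; apply/measurable_EFinP; apply: measurable_funX.
  by apply: measurable_funB => //; exact: (measurable_P1 hM).
have [u uE u0] : exists2 u, leb U = u%:E & 0 < u.
  exists (fine (leb U)); first by rewrite fineK// ge0_fin_numE.
  by rewrite fine_gt0// lt0e U0 Ufin measure_ge0.
(* A bound of the translations between points of [U], plus the mesh size. *)
have [d dE] : exists d, d = 4 * r + 4 * r / Creg by eexists.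
have [k kE] : exists k, k = translation_const Creg * d ^+ 2 by eexists.
have k0 : 0 <= k by rewrite kE mulr_ge0 ?sqr_ge0// translation_const_ge0.
have rk : 0 <= 16 * r ^+ 2 * k by rewrite mulr_ge0// mulr_ge0 ?sqr_ge0.
exists ((16 * r ^+ 2 * k + 1) / u); first by rewrite divr_ge0 ?(ltW u0)// addr_ge0.
move=> M hM hR p hp; have G0 := grad_energy_ge0 hM p.
have kG : 0 <= k * grad_energy p by exact: mulr_ge0.
apply: (exists_constant (measurable_P1 hM p) mU kG (ltW r0) Ubox uE).
- move=> y; have [A AE] : exists A : set (mpt R), A = U `&` (fun x : mpt R => (x + y)%R) @^-1` U.
    by eexists.
  rewrite -AE; have [A0|/set0P[x0 Ax0]] := eqVneq A set0.
    by rewrite A0 integral_set0 lee_fin.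
  have [Ux0 Uxy0] : U x0 /\ U (x0 + y) by move: Ax0; rewrite AE.
  have mA : measurable A.
    rewrite AE; apply: measurableI => //; rewrite -[X in measurable X]setTI; exact: measurable_shift.
  rewrite kE; apply: (translation hOm hC hM hR hp mA).
    have yh := mesh_size_bounded hOm hC hM hR hr.
    have hb (z : mpt R) : U z -> `|z.1| <= r /\ `|z.2| <= r.
      by move=> /Ubox; rewrite /box /= !subr0.
    have [x1 x2] := hb _ Ux0.
    have [y1 y2] : `|x0.1 + y.1| <= r /\ `|x0.2 + y.2| <= r := hb _ Uxy0.
    have n1 := ler_normB (x0.1 + y.1) x0.1; have n2 := ler_normB (x0.2 + y.2) x0.2.
    rewrite (_ : x0.1 + y.1 - x0.1 = y.1) in n1; last by ring.
    rewrite (_ : x0.2 + y.2 - x0.2 = y.2) in n2; last by ring.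
    by have := enorm_le_sum y; rewrite dE; lra.
  move=> x; rewrite AE => -[Ux Uxy] t t01; apply/subset_closure/UOm.
  have -> : x + t *: y = (1 - t) *: x + t *: (x + y) by apply: ptP; rewrite !ptE; ring.
  exact: cU.
- by rewrite mulr_ge0 ?addr_ge0// divr_ge0 ?(ltW u0)// addr_ge0.
- have -> : (16 * r ^+ 2 * k + 1) / u * (grad_energy p + 1) * u =
    (16 * r ^+ 2 * k) * grad_energy p + 16 * r ^+ 2 * k + grad_energy p + 1.
    by field; rewrite gt_eqF.
  by rewrite mulrA; lra.
Qed.

End Poincare.

(** * The discrete Poincare inequality *)

Section Chain.
Variables (R : realType) (Om : set (pt R)) (Creg : R).
Notation leb := (@leb2 R).
Implicit Types (x y z e : pt R) (A B U : set (mpt R)).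
Hypothesis hOm : bounded_polygonal_domain Om.
Hypothesis hC : 0 < Creg.
Notation good := (good Om Creg).

Lemma sq_sub_le (a b z : R) : (a - b) ^+ 2 <= 2 * (z - a) ^+ 2 + 2 * (z - b) ^+ 2.
Proof. by have := sqr_ge0 ((z - a) + (z - b)); rewrite !expr2; nra. Qed.

Lemma integral_le2 (D : set (mpt R)) (f g h : mpt R -> R) (k l : R) : measurable D ->
  measurable_fun setT f -> measurable_fun setT g -> measurable_fun setT h ->
  (forall x, 0 <= f x) -> (forall x, 0 <= g x) -> (forall x, 0 <= h x) ->
  (forall x, f x <= 2 * g x + 2 * h x) ->
  (\int[leb]_(x in D) (g x)%:E <= k%:E)%E -> (\int[leb]_(x in D) (h x)%:E <= l%:E)%E ->
  (\int[leb]_(x in D) (f x)%:E <= (2 * k + 2 * l)%:E)%E.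
Proof.
move=> mD /measurable_EFinP mf /measurable_EFinP mg /measurable_EFinP mh f0 g0 h0 fgh hk hl.
have mg2 : measurable_fun D (fun x => 2%:E * (g x)%:E)%E.
  by apply: measurable_funTS; exact: measurable_funeM.
have mh2 : measurable_fun D (fun x => 2%:E * (h x)%:E)%E.
  by apply: measurable_funTS; exact: measurable_funeM.
apply: (@le_trans _ _ (\int[leb]_(x in D) (2%:E * (g x)%:E + 2%:E * (h x)%:E))%E).
  apply: ge0_le_integral => //.
  - by move=> x _; rewrite lee_fin.
  - exact: measurable_funTS.
  - exact: emeasurable_funD.
  - by move=> x _; rewrite -!EFinM -EFinD lee_fin.
rewrite (ge0_integralD leb mD _ mg2 _ mh2); first last.
- by move=> x _; rewrite -EFinM lee_fin mulr_ge0.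
- by move=> x _; rewrite -EFinM lee_fin mulr_ge0.
rewrite (EFinD (2 * k)); apply: leeD.
  rewrite (ge0_integralZl leb mD (measurable_funTS mg)).
  - by rewrite (EFinM 2) lee_pmul2l.
  - by move=> x _; rewrite lee_fin.
  - by rewrite lee_fin.
rewrite (ge0_integralZl leb mD (measurable_funTS mh)).
- by rewrite (EFinM 2) lee_pmul2l.
- by move=> x _; rewrite lee_fin.
- by rewrite lee_fin.
Qed.

Lemma measurable_sq_sub (P : mpt R -> R) (a : R) : measurable_fun setT P ->
  measurable_fun setT (fun x => (P x - a) ^+ 2).
Proof. by move=> mP; apply: measurable_funX; exact: measurable_funB. Qed.

Lemma subset_sq_integral (P : mpt R -> R) (a : R) A B : measurable A -> measurable B ->
  measurable_fun setT P -> A `<=` B ->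
  (\int[leb]_(x in A) ((P x - a) ^+ 2)%:E <= \int[leb]_(x in B) ((P x - a) ^+ 2)%:E)%E.
Proof.
move=> mA mB mP AB; apply: ge0_subset_integral => //.
  by apply: measurable_funTS; apply/measurable_EFinP; exact: measurable_sq_sub.
by move=> x _; rewrite lee_fin sqr_ge0.
Qed.

(** On a box contained in both sets the two constants are close to each other. *)
Lemma good_union A B x (e r : R) : measurable A -> measurable B -> 0 < e -> 0 <= r ->
  B `<=` box 0 r -> box x e `<=` A -> box x e `<=` B -> good A -> good B -> good (A `|` B).
Proof.
move=> mA mB e0 r0 Br xA xB [CA CA0 hA] [CB CB0 hB].
have [D DE] : exists D, D = (2 * CA + 2 * CB) / (4 * e ^+ 2) by eexists.
have D0 : 0 <= D.
  by rewrite DE; apply: divr_ge0; [apply: addr_ge0; exact: mulr_ge0|rewrite mulr_ge0 ?sqr_ge0].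
have [F FE] : exists F, F = 4 * r ^+ 2 by eexists.
have F0 : 0 <= F by rewrite FE; apply: mulr_ge0; [|exact: sqr_ge0].
exists (CA + (2 * CB + 2 * (D * F))); first by rewrite !addr_ge0// mulr_ge0// mulr_ge0.
move=> M hM hR p hp.
have [a ha] := hA M hM hR p hp; have [b hb] := hB M hM hR p hp.
have mP := measurable_P1 hM p; have [P PE] : exists P : mpt R -> R, P = P1fun p by eexists.
have [G GE] : exists G, G = grad_energy p + 1 by eexists.
rewrite -!PE -!GE in ha hb mP *.
have G0 : 0 <= G by rewrite GE addr_ge0// (grad_energy_ge0 hM).
have mX := @measurable_box R x e; have mY := @measurable_box R 0 r.
have ab : (a - b) ^+ 2 <= D * G.
  have := @integral_le2 (box x e) (fun=> (a - b) ^+ 2) (fun x => (P x - a) ^+ 2)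
    (fun x => (P x - b) ^+ 2) (CA * G) (CB * G) mX.
  rewrite integral_cst// leb_box ?(ltW e0)// -EFinM lee_fin => h.
  rewrite DE -mulrAC ler_pdivlMr ?mulr_gt0 ?exprn_gt0//.
  apply: (le_trans (h _ _ _ _ _ _ _ _ _)).
  - exact: measurable_cst.
  - exact: measurable_sq_sub.
  - exact: measurable_sq_sub.
  - by move=> ?; exact: sqr_ge0.
  - by move=> ?; exact: sqr_ge0.
  - by move=> ?; exact: sqr_ge0.
  - by move=> z; exact: sq_sub_le.
  - exact: le_trans (subset_sq_integral a mX mA mP xA) ha.
  - exact: le_trans (subset_sq_integral b mX mB mP xB) hb.
  - by rewrite le_eqVlt; apply/orP; left; apply/eqP; ring.
exists a.
have hBa : (\int[leb]_(x in B) ((P x - a) ^+ 2)%:E <= (2 * (CB * G) + 2 * (D * G * F))%:E)%E.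
  apply: (@integral_le2 B _ (fun x => (P x - b) ^+ 2) (fun=> (a - b) ^+ 2)) => //.
  - exact: measurable_sq_sub.
  - exact: measurable_sq_sub.
  - by move=> ?; exact: sqr_ge0.
  - by move=> ?; exact: sqr_ge0.
  - by move=> ?; exact: sqr_ge0.
  - by move=> z; have := sq_sub_le (P z) a b; rewrite -(sqrrN (b - a)) -(sqrrN (b - P z)) !opprB.
  - rewrite integral_cst// [X in (_ <= X)%E]EFinM; apply: lee_pmul; rewrite ?lee_fin ?sqr_ge0//.
    apply: (@le_trans _ _ (leb (box 0 r))).
      by apply: le_measure; rewrite ?inE.
    by rewrite leb_box// FE.
have mPa : measurable_fun (A `|` (B `\` A)) (fun x => ((P x - a) ^+ 2)%:E).
  by apply: measurable_funTS; apply/measurable_EFinP; exact: measurable_sq_sub.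
have mBA := measurableD mB mA.
have -> : A `|` B = A `|` (B `\` A).
  apply/seteqP; split => z; first by move=> [Az|Bz]; [left|have [Az|nAz] := pselect (A z); [left|right]].
  by move=> [Az|[Bz _]]; [left|right].
rewrite (ge0_integral_setU leb mA mBA mPa).
- apply: (@le_trans _ _ ((CA * G)%:E + (2 * (CB * G) + 2 * (D * G * F))%:E)%E).
    apply: leeD ha _; apply: le_trans hBa.
    by apply: (subset_sq_integral a mBA mB mP) => z [].
  by rewrite -EFinD lee_fin le_eqVlt; apply/orP; left; apply/eqP; ring.
- by move=> z _; rewrite lee_fin sqr_ge0.
- by apply/disj_setPS => z [Az []].
Qed.

Lemma box_subset x (e f : R) : e <= f -> box x e `<=` box x f.
Proof. by move=> ef z [z1 z2]; split; [exact: le_trans ef|exact: le_trans ef]. Qed.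

Lemma box_near x (P : pt R -> Prop) : (\forall z \near x, P z) ->
  exists2 e : R, 0 < e & box x e `<=` P.
Proof.
move=> /near_box[e e0 h]; exists (e / 2); first by rewrite divr_gt0.
move=> z [z1 z2]; apply: h.
  by apply: le_lt_trans z1 _; rewrite ltr_pdivrMr// ltr_pMr// ltr1n.
by apply: le_lt_trans z2 _; rewrite ltr_pdivrMr// ltr_pMr// ltr1n.
Qed.

Lemma box_convex x (r : R) y z (t : R) : box x r y -> box x r z -> 0 <= t <= 1 ->
  box x r ((1 - t) *: y + t *: z).
Proof.
have h1 (a b c : R) : 0 <= t <= 1 -> `|b - a| <= r -> `|c - a| <= r ->
    `|(1 - t) * b + t * c - a| <= r.
  move=> /andP[t0 t1] hb hc.
  have -> : (1 - t) * b + t * c - a = (1 - t) * (b - a) + t * (c - a) by ring.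
  apply: (le_trans (ler_normD _ _)); rewrite !normrM ger0_norm ?subr_ge0// (ger0_norm t0).
  have u0 : 0 <= 1 - t by rewrite subr_ge0.
  by have := ler_wpM2l u0 hb; have := ler_wpM2l t0 hc; lra.
by move=> [y1 y2] [z1 z2] ht; split; exact: h1.
Qed.

Definition piece A := [/\ measurable A, A `<=` Om & good A].

Lemma piece_union A B x (e f : R) : 0 < e -> 0 < f -> box x e `<=` A -> box x f `<=` B ->
  piece A -> piece B -> piece (A `|` B).
Proof.
move=> e0 f0 xA xB [mA AOm gA] [mB BOm gB]; split; first exact: measurableU.
  by move=> z [/AOm|/BOm].
have [r r0 hr] := domain_bounded hOm.
have Br : B `<=` box 0 r by move=> z /BOm Oz; apply/hr/subset_closure.
have m0 : 0 < Num.min e f by rewrite lt_min e0.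
apply: (good_union mA mB m0 (ltW r0) Br _ _ gA gB).
  by apply: subset_trans xA; apply: box_subset; rewrite ge_min lexx.
by apply: subset_trans xB; apply: box_subset; rewrite ge_min lexx orbT.
Qed.

Lemma piece_box x : Om x -> exists2 e : R, 0 < e & piece (box x e).
Proof.
move=> Ox; have [e e0 h] := box_near (near_Om hOm Ox); exists e => //; split => //.
  exact: measurable_box.
apply: (good_convex hOm hC) => //; first exact: measurable_box.
by move=> y z t; exact: box_convex.
Qed.

(** Connectedness: the points that lie with [x] in a common good set form a
    relatively open and closed part of the domain. *)
Lemma piece_through x y : Om x -> Om y -> exists2 A, piece A &
  exists2 e : R, 0 < e & box x e `<=` A /\ box y e `<=` A.
Proof.
move=> Ox; have [e0 e00 pe0] := piece_box Ox.
pose B := [set y | Om y /\ exists2 A, piece A &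
  exists2 e : R, 0 < e & box x e `<=` A /\ box y e `<=` A].
have sub y' : B y' -> \forall z \near y', B z.
  move=> [Oy [A pA [e e1 [xA yA]]]].
  apply/near_box; exists (e / 2); first by rewrite divr_gt0.
  move=> z z1 z2.
  have zA : box z (e / 2) `<=` A.
    move=> w [w1 w2]; apply: yA; split.
      have -> : w.1 - y'.1 = (w.1 - z.1) + (z.1 - y'.1) by ring.
      by apply: (le_trans (ler_normD _ _)); lra.
    have -> : w.2 - y'.2 = (w.2 - z.2) + (z.2 - y'.2) by ring.
    by apply: (le_trans (ler_normD _ _)); lra.
  have [_ AOm _] := pA; split.
    by apply/AOm/zA; split; rewrite subrr normr0; lra.
  exists A => //; exists (e / 2); first by rewrite divr_gt0.
  by split => //; apply: subset_trans xA; apply: box_subset; lra.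
have oB : open B by rewrite openE => z Bz; exact: sub.
have [[_ cOm _ _] _] := hOm.
suff -> : Om = B by move=> [].
symmetry; apply: cOm.
- by exists x; split; [|exists (box x e0) => //; exists e0 => //; split => z].
- exists B => //; apply/seteqP; split => z; last by move=> [].
  by move=> Bz; split => //; have [] := Bz.
exists (closure B); first exact: closed_closure.
apply/seteqP; split => z; first by move=> Bz; split; [have [] := Bz|exact: subset_closure].
move=> [Oz cz]; split => //.
have [e e1 pe] := piece_box Oz.
have [|w [[Ow [A pA [f f0 [xA wA]]]] [w1 w2]]] := cz [set w | `|w.1 - z.1| < e / 2 /\ `|w.2 - z.2| < e / 2].
  apply/near_box; exists (e / 2); first by rewrite divr_gt0.
  by move=> w.
have wz : box w (e / 2) `<=` box z e.
  move=> v [v1 v2]; split.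
    have -> : v.1 - z.1 = (v.1 - w.1) + (w.1 - z.1) by ring.
    by apply: (le_trans (ler_normD _ _)); lra.
  have -> : v.2 - z.2 = (v.2 - w.2) + (w.2 - z.2) by ring.
  by apply: (le_trans (ler_normD _ _)); lra.
have e20 : 0 < e / 2 by rewrite divr_gt0.
exists (A `|` box z e); first exact: (piece_union f0 e20 wA wz pA pe).
exists (Num.min f e); first by rewrite lt_min f0.
split => v hv; [left; apply: xA|right]; apply: box_subset hv; rewrite ge_min lexx ?orbT//.
Qed.

(** The cells of one fixed mesh are convex, and finitely many sets through the
    domain connect them. *)
Lemma piece_cells (M : mesh R) (s : seq (sx M)) x : acute_mesh Om M -> Om x ->
  {subset s <= cells M} -> exists2 A, piece A &
    (exists2 e : R, 0 < e & box x e `<=` A) /\ forall K, K \in s -> osimplex K `<=` A.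
Proof.
move=> hM Ox; elim: s => [_|K s IH hs].
  have [e e0 pe] := piece_box Ox; exists (box x e) => //; split; first by exists e.
  by move=> K; rewrite in_nil.
have [|A pA [[e e0 xA] sA]] := IH; first by move=> L Ls; apply: hs; rewrite inE Ls orbT.
have KM : K \in cells M by apply: hs; rewrite inE eqxx.
have nK := cell_triangular hM KM.
have mK := measurable_osimplex hM KM.
have OK : osimplex K `<=` Om by move=> z; exact: (osimplex_Om hOm hM KM).
have pK : piece (osimplex K : set (mpt R)).
  split => //; apply: (good_convex hOm hC) => // y z t yK zK /andP[t0 t1].
  have {}yK := (cell_osimplexP _ nK).1 yK; have {}zK := (cell_osimplexP _ nK).1 zK.
  apply/(cell_osimplexP _ nK) => v vK; have := yK v vK; have := zK v vK.
  rewrite aff_eval_line => z0 y0; have [->|tn0] := eqVneq t 0.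
    by rewrite subr0 mul1r mul0r addr0.
  have tp : 0 < t by rewrite lt0r tn0.
  by rewrite ltr_wpDl ?mulr_gt0// mulr_ge0 ?subr_ge0// ltW.
have [y yK] : exists y, osimplex K y.
  exists (\sum_(v in K) 3^-1 *: pos v); exists (fun=> 3^-1); split => //.
  by rewrite sumr_const (card_triangle nK); field.
have Oy := OK _ yK; have [f f0 fK] := box_near (near_osimplex hM KM yK).
have [B pB [g g0 [xB yB]]] := piece_through Ox Oy.
have pAB := piece_union e0 g0 xA xB pA pB.
have yAB : box y g `<=` A `|` B by move=> z /yB; right.
exists ((A `|` B) `|` osimplex K); first exact: (piece_union g0 f0 yAB fK pAB pK).
split; first by exists e => // z /xA; left; left.
move=> L; rewrite inE => /orP[/eqP->|Ls] z zL; first by right.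
by left; left; apply: (sA _ Ls).
Qed.

Lemma integrable_P1 (M : mesh R) (p : sx M -> aff R) : acute_mesh Om M ->
  leb.-integrable Om (EFin \o P1fun p).
Proof.
move=> hM; have [|] := @integral_pw _ _ _ hOm hM (fun K x => aff_eval (p K) x); last by [].
move=> K KM; have := @integrable_cell _ _ K (1, 0) (p K) (cell_triangular hM KM).
by congr (integrable _ _ _); apply/funext => x /=; rewrite /(aff_eval (1, 0)) dot0l addr0 mul1r.
Qed.

(** A function with mean zero is at least as close to 0 as to any other constant. *)
Lemma ip_shift (M : mesh R) (p : sx M -> aff R) (a b : R) : acute_mesh Om M ->
  \int[leb]_(x in Om) P1fun p x = 0 ->
  (\int[leb]_(x in Om) ((P1fun p x - a) ^+ 2)%:E <= b%:E)%E ->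
  ip Om (P1fun p) (P1fun p) <= b.
Proof.
move=> hM p0 hb; have mO := measurable_Om hOm hM.
have ip1 := integrable_P1 p hM.
have ipa : leb.-integrable Om (EFin \o (fun x => 2 * a * P1fun p x)).
  by have := integrableZl mO (2 * a) ip1.
have ipp := sq_integrableM hOm hM (sq_integrable_pw hOm hM p) (sq_integrable_pw hOm hM p).
have mPa : measurable_fun Om (EFin \o (fun x => (P1fun p x - a) ^+ 2)).
  apply: measurable_funTS; apply/measurable_EFinP.
  exact: measurable_sq_sub (measurable_P1 hM p).
have ips : leb.-integrable Om (EFin \o (fun x => (P1fun p x - a) ^+ 2)).
  apply/integrableP; split => //; apply: le_lt_trans (ltry b); apply: le_trans hb.
  rewrite le_eqVlt; apply/orP; left; apply/eqP; apply: eq_integral => x _.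
  by rewrite /= ger0_norm ?sqr_ge0.
have isum : leb.-integrable Om (EFin \o (fun x => (P1fun p x - a) ^+ 2 + 2 * a * P1fun p x)).
  by have := integrableD mO ips ipa.
apply: (le_trans (le_Rintegral mO ipp isum _)).
  by move=> x _; have := sqr_ge0 a; rewrite !expr2; nra.
rewrite (RintegralD mO ips ipa) (RintegralZl _ mO ip1) p0 mulr0 addr0.
rewrite /Rintegral -lee_fin fineK//; exact: integrable_fin_num ips.
Qed.

(** The constant is that of a single set which covers the domain up to a null set. It
    is built from one mesh and serves for all. *)
Lemma poincare : exists2 C : R, 0 <= C &
  forall (M : mesh R), acute_mesh Om M -> mesh_regular Om M Creg ->
  forall p : sx M -> aff R, P1nc Om p -> \int[leb]_(x in Om) P1fun p x = 0 ->
    ip Om (P1fun p) (P1fun p) <= C * (grad_energy p + 1).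
Proof.
have [[_ _ [x Ox] _] _] := hOm.
have [[M0 hM0]|noM] := pselect (exists M : mesh R, acute_mesh Om M); last first.
  by exists 0 => // M hM; case: noM; exists M.
have [|A [mA AOm [C C0 hA]] [_ sA]] := @piece_cells M0 (enum (cells M0)) x hM0 Ox.
  by move=> K; rewrite mem_enum.
exists C => // M hM hR p hp p0; have [a ha] := hA M hM hR p hp.
apply: (ip_shift hM p0 (a := a)); apply: le_trans ha.
have mO := measurable_Om hOm hM0; have [mS S0] := null_skeleton hM0.
have mPa : measurable_fun setT (fun x => ((P1fun p x - a) ^+ 2)%:E).
  by apply/measurable_EFinP; exact: measurable_sq_sub (measurable_P1 hM p).
rewrite (ge0_negligible_integral mS mO (measurable_funTS mPa) _ S0); last first.
  by move=> z _; rewrite lee_fin sqr_ge0.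
apply: (subset_sq_integral a (measurableD mO mS) mA (measurable_P1 hM p)).
move=> z [Oz nz]; have [K KM Kz] := off_skeleton hM0 (@subset_closure _ Om _ Oz) nz.
by apply: (sA K) Kz; rewrite mem_enum.
Qed.
End Chain.

(** * Pressure and velocity *)

Section Flow.
Variables (R : realType) (Om : set (pt R)) (M : mesh R).
Implicit Types (K L sg : sx M) (x y : pt R).
Hypothesis hOm : bounded_polygonal_domain Om.
Hypothesis hM : acute_mesh Om M.

Let areaK K : K \in cells M -> 0 < area K.
Proof. by move=> KM; apply: area_gt0; exact: (cell_triangular hM KM). Qed.

(** Green's formula on each triangle ([cell_gradient]), regrouped by edges: both
    functions have a single value at the midpoint of an interior edge, and the sum of
    the two normal components there is the jump in the definition of [div_h]. *)
Lemma divh_adjoint (v : sx M -> pt R) (q r : sx M -> aff R) : is_divh Om v q -> P1nc Om r ->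
  ip Om (P1fun q) (P1fun r) = - \sum_(K in cells M) area K * dot (v K) (r K).2.
Proof.
move=> [q1 qi qe] r1; rewrite (ip_P1 hOm hM).
have -> : \sum_(K in cells M) area K * dot (v K) (r K).2 =
    \sum_(K in cells M) \sum_(sg in cell_edges K)
      edge_length sg * aff_eval (r K) (midpoint sg) * dot (v K) (normal K sg).
  by apply: eq_bigr => K KM; rewrite (cell_gradient hM).
under eq_bigr do rewrite mulr_sumr.
rewrite (sum_cell_edges hOm hM) (sum_cell_edges hOm hM) opprD -!sumrN.
congr (_ + _); apply: eq_bigr => sg.
  move=> isg; have [LM sL LK] := cellLP hOm hM isg.
  have esg := int_edges_edges isg; have [KM sK] := cellKP esg.
  have KL : cellK sg != cellL sg by rewrite eq_sym.
  rewrite -(q1 _ isg) -(r1 _ isg) (qi _ isg) (normal_opp hM KM LM KL sK sL (edge_card esg)).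
  rewrite dotNr dotDl dotNl; have := areaK KM; have := areaK LM => a1 a2.
  move: (area _) (area _) (edge_length _) (aff_eval _ _) (dot _ _) (dot _ _) a1 a2.
  by move=> aL aK l w s t a1 a2; field; rewrite gt_eqF// addr_gt0.
move=> /andP[esg nsg]; have [KM sK] := cellKP esg.
rewrite (qe _ (ext_edgeP hOm hM esg nsg)); have := areaK KM => a1.
by field; rewrite gt_eqF.
Qed.

Lemma P1funB (q r : sx M -> aff R) x : P1fun q x - P1fun r x = P1fun (fun K => q K - r K) x.
Proof.
have [[K KM Kx]|h] := pw_case M x; last by rewrite /P1fun !pw_out// subr0.
by rewrite /P1fun !(pw_in hM _ KM Kx) /aff_eval /dot /=; ring.
Qed.

Lemma young (a s t : R) : 0 < a -> s * t <= a * s ^+ 2 + t ^+ 2 / (4 * a).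
Proof.
move=> a0; rewrite -subr_ge0.
have -> : a * s ^+ 2 + t ^+ 2 / (4 * a) - s * t = (2 * a * s - t) ^+ 2 / (4 * a).
  by field; rewrite gt_eqF.
by rewrite divr_ge0 ?sqr_ge0// mulr_ge0// ltW.
Qed.

Lemma dot_young (a : R) x y : 0 < a -> dot x y <= a * dot x x + dot y y / (4 * a).
Proof.
move=> a0; have := young x.1 y.1 a0; have := young x.2 y.2 a0.
by rewrite /dot -!expr2 mulrDl; lra.
Qed.

End Flow.

Section Pressure.
Variables (R : realType) (d : problem_data R) (M : mesh R).
Notation Om := (Omega d).
Implicit Types (K L sg : sx M) (x y : pt R).
Hypothesis hOm : bounded_polygonal_domain Om.
Hypothesis hM : acute_mesh Om M.

Let areaK K : K \in cells M -> 0 < area K.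
Proof. by move=> KM; apply: area_gt0; exact: (cell_triangular hM KM). Qed.

(** The pressure equation tested with the pressure. *)
Lemma pressure_identity (sh kh : sx M -> R) (fh : sx M -> pt R) (p : sx M -> aff R) :
  pressure_eq d sh fh kh p ->
  \sum_(K in cells M) area K * (kh K * dot (p K).2 (p K).2) =
  \sum_(K in cells M) area K * dot (fh K) (p K).2 + ip Om (P0fun sh) (P1fun p).
Proof.
move=> [p1 p0 [qp [qf [qs [dp df [qs1 hqs] e]]]]].
have ep := divh_adjoint hOm hM dp p1; have ef := divh_adjoint hOm hM df p1.
have es : ip Om (P1fun (fun K => (sh K, 0) - qs K)) (P1fun p) = 0.
  rewrite -(hqs _ p1); congr (ip _ _ _); apply/funext => x.
  by rewrite (P0_P1fun hM) (P1funB hM).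
rewrite (ip_P1 hOm hM) in es.
have -> : ip Om (P0fun sh) (P1fun p) = ip Om (P1fun qs) (P1fun p).
  apply/eqP; rewrite -subr_eq0 -{}es (ip_P0_P1 hOm hM) (ip_P1 hOm hM) -sumrB.
  apply/eqP; apply: eq_bigr => K _; rewrite -mulrBr -sumrB; congr (_ * _).
  by apply: eq_bigr => sg _; rewrite /aff_eval /dot /=; ring.
have e2 : ip Om (P1fun qp) (P1fun p) = ip Om (P1fun qf) (P1fun p) - ip Om (P1fun qs) (P1fun p).
  rewrite !(ip_P1 hOm hM) -sumrB; apply: eq_bigr => K KM; rewrite -mulrBr -sumrB (e _ KM).
  by congr (_ * _); apply: eq_bigr => sg _; rewrite /aff_eval /dot /=; ring.
have -> : \sum_(K in cells M) area K * (kh K * dot (p K).2 (p K).2) =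
    - ip Om (P1fun qp) (P1fun p).
  by rewrite ep opprK; apply: eq_bigr => K _; rewrite dotZl.
by rewrite e2 ef; ring.
Qed.

(** Young's inequality absorbs half of the left-hand side: a quarter pays for the force
    and, through the Poincare inequality, a quarter for the source. *)
Lemma pressure_bound (sh kh : sx M -> R) (fh : sx M -> pt R) (p : sx M -> aff R)
    (CP kinf F S : R) : 0 <= CP -> 0 < kinf ->
  (forall K, K \in cells M -> kinf <= kh K) ->
  pressure_eq d sh fh kh p ->
  \sum_(K in cells M) area K * dot (fh K) (fh K) <= F ->
  \sum_(K in cells M) area K * sh K ^+ 2 <= S ->
  ip Om (P1fun p) (P1fun p) <= CP * (grad_energy p + 1) ->
  grad_energy p <= 2^-1 + 2 * F / kinf ^+ 2 + 2 * S * (CP + 1) / kinf ^+ 2.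
Proof.
move=> CP0 k0 hk hp hF hS hPo; have e := pressure_identity hp.
have G0 := grad_energy_ge0 hM p; have CP1 : 0 < CP + 1 by rewrite ltr_wpDl.
have lower : kinf * grad_energy p <= \sum_(K in cells M) area K * (kh K * dot (p K).2 (p K).2).
  rewrite /grad_energy mulr_sumr; apply: ler_sum => K KM.
  rewrite mulrCA ler_pM2l ?areaK// ler_wpM2r ?hk//; exact: dot_ge0.
have upper1 : \sum_(K in cells M) area K * dot (fh K) (p K).2 <=
    F / kinf + kinf / 4 * grad_energy p.
  apply: (@le_trans _ _ (\sum_(K in cells M) (area K * dot (fh K) (fh K) / kinf +
      kinf / 4 * (area K * dot (p K).2 (p K).2)))).
    apply: ler_sum => K KM; have a0 := areaK KM.
    have -> : area K * dot (fh K) (fh K) / kinf + kinf / 4 * (area K * dot (p K).2 (p K).2) =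
      area K * (dot (fh K) (fh K) / kinf + kinf / 4 * dot (p K).2 (p K).2) by ring.
    rewrite ler_pM2l//.
    have := dot_young (fh K) (p K).2 (a := kinf^-1); rewrite invr_gt0 => /(_ k0) h.
    by apply: (le_trans h); rewrite invfM invrK; lra.
  rewrite big_split /= -mulr_suml -mulr_sumr lerD2r ler_pM2r// invr_gt0//.
have upper2 : ip Om (P0fun sh) (P1fun p) <=
    S * (CP + 1) / kinf + kinf / 4 * (grad_energy p + 1).
  apply: (@le_trans _ _ ((CP + 1) / kinf * (\sum_(K in cells M) area K * sh K ^+ 2) +
      kinf / (4 * (CP + 1)) * ip Om (P1fun p) (P1fun p))).
    rewrite (ip_P0_P1 hOm hM) (ip_P1 hOm hM) !mulr_sumr -big_split; apply: ler_sum => K KM.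
    have a0 : 0 < area K / 3 by rewrite divr_gt0// areaK.
    have -> : area K * sh K ^+ 2 = area K / 3 * \sum_(sg in cell_edges K) sh K ^+ 2.
      by rewrite (sum_cell_edges_const hM _ KM); field.
    rewrite /= !(mulrCA _ (area K / 3)) -mulrDr ler_pM2l// !mulr_sumr -big_split /=.
    apply: ler_sum => sg _; have := young (sh K) (aff_eval (p K) (midpoint sg)) (a := (CP + 1) / kinf).
    rewrite divr_gt0// => /(_ isT) h; apply: (le_trans h).
    by rewrite expr2 !invfM invrK; lra.
  apply: lerD; first by rewrite (_ : S * (CP + 1) / kinf = (CP + 1) / kinf * S); [rewrite ler_pM2l ?divr_gt0|ring].
  have c0 : 0 < kinf / (4 * (CP + 1)) by rewrite divr_gt0// mulr_gt0.
  apply: (le_trans (ler_wpM2l (ltW c0) hPo)).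
  rewrite mulrA ler_wpM2r ?addr_ge0// mulrAC ler_pdivrMr ?mulr_gt0//.
  by rewrite [X in _ <= X](_ : _ = kinf * (CP + 1)); [rewrite ler_pM2l//; lra|field].
have fin : grad_energy p * (kinf / 2) <= F / kinf + S * (CP + 1) / kinf + kinf / 4 by lra.
rewrite -ler_pdivlMr ?divr_gt0// in fin; apply: (le_trans fin).
by rewrite le_eqVlt; apply/orP; left; apply/eqP; field; rewrite gt_eqF.
Qed.

Lemma RTfunB (v w : sx M -> affv R) x : RTfun v x - RTfun w x = RTfun (fun K => v K - w K) x.
Proof.
have [[K KM Kx]|h] := pw_case M x; last by rewrite /RTfun !pw_out// subr0.
rewrite /RTfun !(pw_in hM _ KM Kx) /affv_eval /aff_eval /dot /=.
by apply: ptP; rewrite /=; ring.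
Qed.

(** The velocity is an orthogonal projection of the flux, so its norm is at most that
    of the flux. *)
Lemma velocity_bound (kh : sx M -> R) (fh : sx M -> pt R) (p : sx M -> aff R) (u : sx M -> affv R)
    (kmax F : R) :
  (forall K, K \in cells M -> 0 <= kh K <= kmax) ->
  velocity_eq d fh kh p u ->
  \sum_(K in cells M) area K * dot (fh K) (fh K) <= F ->
  ipv Om (RTfun u) (RTfun u) <= 2 * F + 2 * kmax ^+ 2 * grad_energy p.
Proof.
move=> hk [u1 /(_ u u1) hu] hF.
pose w K := fh K - kh K *: (p K).2.
have wu : ipv Om (RTfun u) (RTfun u) <= \sum_(K in cells M) area K * dot (w K) (w K).
  rewrite -(ipv_P0 hOm hM) (P0v_RT hM); pose w' K : affv R := (((w K).1, 0), ((w K).2, 0)).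
  have {}hu : ipv Om (RTfun (fun K => w' K - u K)) (RTfun u) = 0.
    rewrite -hu; congr (ipv _ _ _); apply/funext => x.
    by rewrite -RTfunB (P0v_RT hM).
  have : 0 <= ipv Om (RTfun (fun K => w' K - u K)) (RTfun (fun K => w' K - u K)).
    by apply: Rintegral_ge0 => x _; exact: dot_ge0.
  have -> : ipv Om (RTfun w') (RTfun w') =
      ipv Om (RTfun (fun K => w' K - u K)) (RTfun (fun K => w' K - u K)) +
      2 * ipv Om (RTfun (fun K => w' K - u K)) (RTfun u) + ipv Om (RTfun u) (RTfun u).
    rewrite !(ipv_RT hOm hM) mulr_sumr -!big_split; apply: eq_bigr => K _ /=.
    rewrite mulrCA -!mulrDr; congr (_ * _); rewrite mulr_sumr -!big_split; apply: eq_bigr => sg _ /=.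
    by rewrite /affv_eval /aff_eval /dot /=; ring.
  by rewrite hu mulr0 addr0; lra.
apply: (le_trans wu).
apply: (@le_trans _ _ (\sum_(K in cells M) (2 * (area K * dot (fh K) (fh K)) +
    2 * kmax ^+ 2 * (area K * dot (p K).2 (p K).2)))).
  apply: ler_sum => K KM; have a0 := areaK KM; have /andP[k0 k1] := hk _ KM.
  have -> : 2 * (area K * dot (fh K) (fh K)) + 2 * kmax ^+ 2 * (area K * dot (p K).2 (p K).2) =
    area K * (2 * dot (fh K) (fh K) + 2 * (kmax ^+ 2 * dot (p K).2 (p K).2)) by ring.
  rewrite ler_pM2l//; apply: (@le_trans _ _ (2 * dot (fh K) (fh K) + 2 * (kh K ^+ 2 * dot (p K).2 (p K).2))).
    have := dot_ge0 (fh K + kh K *: (p K).2); rewrite /w /dot /= /GRing.scale /=; lra.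
  rewrite lerD2l ler_pM2l// ler_wpM2r ?dot_ge0//.
  by rewrite ler_pXn2r ?nnegrE// (le_trans k0).
by rewrite big_split /= -!mulr_sumr lerD2r ler_pM2l.
Qed.

End Pressure.

(** * The energy of a convected scalar *)

Section Energy.
Variables (R : realType) (Om : set (pt R)) (M : mesh R) (Creg : R).
Implicit Types (K L sg : sx M) (x y : pt R).
Hypothesis hOm : bounded_polygonal_domain Om.
Hypothesis hM : acute_mesh Om M.
Hypothesis hC : 0 < Creg.
Hypothesis hR : mesh_regular Om M Creg.
Notation int_edges := (int_edges Om M).

Let areaK K : K \in cells M -> 0 < area K.
Proof. by move=> KM; apply: area_gt0; exact: (cell_triangular hM KM). Qed.

Lemma trans_gt0 sg : sg \in int_edges -> 0 < trans Om sg.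
Proof.
move=> isg; have esg := int_edges_edges isg.
by rewrite divr_gt0// ?(edge_length_gt0 hOm hM hC hR)// (dist_gt0 hOm hM hC hR).
Qed.

Lemma normh_sq (q : sx M -> R) :
  normh Om q ^+ 2 = \sum_(sg in int_edges) trans Om sg * (q (cellL sg) - q (cellK sg)) ^+ 2.
Proof.
rewrite sqr_sqrtr//; apply: sumr_ge0 => sg isg.
by rewrite mulr_ge0 ?sqr_ge0// ltW// trans_gt0.
Qed.

(** Summation by parts. *)
Lemma laph_test (q : sx M -> R) :
  \sum_(K in cells M) area K * (laph Om q K * q K) = - normh Om q ^+ 2.
Proof.
rewrite normh_sq -sumrN.
transitivity (\sum_(K in cells M) \sum_(sg in cell_edges K :&: int_edges)
    trans Om sg * (q (neighbor K sg) - q K) * q K).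
  apply: eq_bigr => K KM; have := areaK KM => a0.
  by rewrite /laph mulrA mulVKf ?gt_eqF// mulr_suml.
rewrite (sum_int_edges hOm hM); apply: eq_bigr => sg isg.
by rewrite (neighbor_cellL hOm hM isg) -/(cellL sg); ring.
Qed.

Lemma flux_cellL (u : sx M -> affv R) sg : RT0 Om u -> sg \in int_edges ->
  flux u (cellL sg) sg = - flux u (cellK sg) sg.
Proof.
move=> [_ u2 _] isg; have [LM sL LK] := cellLP hOm hM isg.
have esg := int_edges_edges isg; have [KM sK] := cellKP esg.
have KL : cellK sg != cellL sg by rewrite eq_sym.
rewrite /flux (normal_opp hM KM LM KL sK sL (edge_card esg)) dotNr.
congr (- _); rewrite -u2//; apply: osimplexS; exact/midpoint_osimplex/(edge_card esg).
Qed.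

(** The upwind flux is the same, up to the sign, seen from both triangles. *)
Lemma bh_test (u : sx M -> affv R) (q : sx M -> R) : RT0 Om u ->
  \sum_(K in cells M) area K * (bh Om u q K * q K) =
  \sum_(sg in int_edges) edge_length sg *
    ((Num.max (flux u (cellK sg) sg) 0 * q (cellK sg) +
      Num.min (flux u (cellK sg) sg) 0 * q (cellL sg)) * (q (cellK sg) - q (cellL sg))).
Proof.
move=> hu.
transitivity (\sum_(K in cells M) \sum_(sg in cell_edges K :&: int_edges)
    edge_length sg * (Num.max (flux u K sg) 0 * q K +
                      Num.min (flux u K sg) 0 * q (neighbor K sg)) * q K).
  apply: eq_bigr => K KM; have := areaK KM => a0.
  by rewrite /bh mulrA mulVKf ?gt_eqF// mulr_suml.
rewrite (sum_int_edges hOm hM); apply: eq_bigr => sg isg.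
rewrite (neighbor_cellL hOm hM isg) -/(cellL sg) (flux_cellL hu isg).
have -> : Num.max (- flux u (cellK sg) sg) 0 = - Num.min (flux u (cellK sg) sg) 0.
  by rewrite -[X in Num.max _ X]oppr0 -oppr_min.
have -> : Num.min (- flux u (cellK sg) sg) 0 = - Num.max (flux u (cellK sg) sg) 0.
  by rewrite -[X in Num.min _ X]oppr0 -oppr_max.
by ring.
Qed.

Lemma flux_le (u : sx M -> affv R) K sg : K \in cells M -> sg \in cell_edges K ->
  flux u K sg ^+ 2 <= dot (affv_eval (u K) (midpoint sg)) (affv_eval (u K) (midpoint sg)).
Proof.
move=> KM; rewrite in_cell_edges => /andP[/eqP s2 sK].
have := dot_le (affv_eval (u K) (midpoint sg)) (normal K sg).
rewrite (normal_norm hM KM sK s2) mulr1 => h.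
by rewrite -enorm_sq -(real_normK (num_real (flux u K sg))) ler_pXn2r ?nnegrE ?enorm_ge0.
Qed.

(** The weights [edge_length * dist] are bounded by the areas, and the midpoint
    rule turns the sum over the edges into the norm of the velocity. *)
Lemma flux_sum (u : sx M -> affv R) :
  \sum_(sg in int_edges) edge_length sg * dist Om sg * flux u (cellK sg) sg ^+ 2 <=
  12 / Creg ^+ 2 * ipv Om (RTfun u) (RTfun u).
Proof.
have C2 : 0 < Creg ^+ 2 by rewrite exprn_gt0.
pose v K sg := dot (affv_eval (u K) (midpoint sg)) (affv_eval (u K) (midpoint sg)).
have v0 K sg : 0 <= v K sg by exact: dot_ge0.
apply: (@le_trans _ _ (\sum_(sg in int_edges) 4 / Creg ^+ 2 * (area (cellK sg) * v (cellK sg) sg))).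
  apply: ler_sum => sg isg; have esg := int_edges_edges isg; have [KM sK] := cellKP esg.
  have h1 := edge_length_le hM esg; have h2 := dist_le hOm hM isg.
  have l0 := edge_length_gt0 hOm hM hC hR esg; have d0 := dist_gt0 hOm hM hC hR esg.
  have ha := area_ge hOm hM hC hR KM; have a0 := areaK KM.
  have fv : flux u (cellK sg) sg ^+ 2 <= v (cellK sg) sg.
    by apply: flux_le KM _; rewrite in_cell_edges sK (edge_card esg) eqxx.
  have ld : edge_length sg * dist Om sg <= 4 / Creg ^+ 2 * area (cellK sg).
    apply: (@le_trans _ _ (mesh_size M ^+ 2)).
      by rewrite expr2; apply: ler_pM => //; exact: ltW.
    by rewrite mulrAC ler_pdivlMr// mulrC.
  rewrite [X in _ <= X]mulrA; apply: ler_pM fv => //; [by rewrite mulr_ge0// ltW|exact: sqr_ge0].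
rewrite -mulr_sumr.
have -> : 12 / Creg ^+ 2 * ipv Om (RTfun u) (RTfun u) =
    4 / Creg ^+ 2 * (3 * ipv Om (RTfun u) (RTfun u)) by rewrite mulrA; congr (_ * _); field; rewrite gt_eqF.
rewrite ler_pM2l ?divr_gt0//.
have -> : 3 * ipv Om (RTfun u) (RTfun u) = \sum_(K in cells M) \sum_(sg in cell_edges K) area K * v K sg.
  rewrite (ipv_RT hOm hM) mulr_sumr; apply: eq_bigr => K _; rewrite -mulr_sumr mulrA.
  by congr (_ * _); field.
rewrite (sum_cell_edges hOm hM) big_split /= -addrA lerDl addr_ge0// sumr_ge0// => sg.
  by move=> isg; have [LM _ _] := cellLP hOm hM isg; rewrite mulr_ge0// ltW// areaK.
by move=> /andP[esg _]; have [KM _] := cellKP esg; rewrite mulr_ge0// ltW// areaK.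
Qed.

Lemma upwind_le (F a b B : R) : `|a| <= B -> `|b| <= B ->
  `|Num.max F 0 * a + Num.min F 0 * b| <= B * `|F|.
Proof.
move=> ha hb; have [F0|F0] := leP F 0.
  by rewrite mul0r add0r normrM mulrC ler_wpM2r.
by rewrite mul0r addr0 normrM mulrC ler_wpM2r.
Qed.

(** Young's inequality on each edge, weighted so that the squared jump appears with
    the transmissibility [edge_length / dist] of the Dirichlet norm. *)
Lemma convection_bound (u : sx M -> affv R) (q : sx M -> R) (B e : R) : RT0 Om u -> 0 < e ->
  (forall K, K \in cells M -> `|q K| <= B) ->
  - \sum_(K in cells M) area K * (bh Om u q K * q K) <=
  e * normh Om q ^+ 2 + B ^+ 2 / (4 * e) * (12 / Creg ^+ 2 * ipv Om (RTfun u) (RTfun u)).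
Proof.
move=> hu e0 hB; rewrite (bh_test _ hu) normh_sq -sumrN.
have B4 : 0 <= B ^+ 2 / (4 * e) by rewrite divr_ge0 ?sqr_ge0// mulr_ge0// ltW.
apply: (le_trans _ (lerD (lexx _) (ler_wpM2l B4 (flux_sum u)))).
rewrite !mulr_sumr -big_split; apply: ler_sum => sg isg /=.
have esg := int_edges_edges isg; have [KM _] := cellKP esg; have [LM _ _] := cellLP hOm hM isg.
have l0 := edge_length_gt0 hOm hM hC hR esg; have d0 := dist_gt0 hOm hM hC hR esg.
have hF := upwind_le (flux u (cellK sg) sg) (hB _ KM) (hB _ LM).
rewrite -mulrN /trans.
move: hF l0 d0; move: (q (cellK sg)) (q (cellL sg)) (flux u (cellK sg) sg).
move: (edge_length sg) (dist Om sg) => l t a b F; set W := _ + _ => hF l0 t0.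
have -> : e * (l / t * (b - a) ^+ 2) + B ^+ 2 / (4 * e) * (l * t * F ^+ 2) =
    l * (e / t * (b - a) ^+ 2 + (B * `|F|) ^+ 2 / (4 * (e / t))).
  by rewrite (exprMn _ B `|F|) real_normK ?num_real//; field; rewrite !gt_eqF.
rewrite ler_pM2l//; have et0 : 0 < e / t by rewrite divr_gt0.
have := young `|b - a| (B * `|F|) et0; rewrite real_normK ?num_real// => h.
apply: le_trans h; rewrite -mulrN opprB; apply: (le_trans (ler_norm _)).
by rewrite normrM mulrC ler_wpM2l.
Qed.

(** The scheme is tested with the new unknown, and
    [2 * (q' - q) * q' >= q' ^+ 2 - q ^+ 2]. Half of the diffusion absorbs the
    convection. *)
Lemma energy_step (u : sx M -> affv R) (q q' rho : sx M -> R) (k D B Z U : R) :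
  0 < k -> 0 < D -> RT0 Om u -> (forall K, K \in cells M -> `|q' K| <= B) ->
  (forall K, K \in cells M ->
     (q' K - q K) / k - D * laph Om q' K = rho K - bh Om u q' K) ->
  \sum_(K in cells M) area K * (rho K * q' K) <= Z ->
  ipv Om (RTfun u) (RTfun u) <= U ->
  \sum_(K in cells M) area K * q' K ^+ 2 + k * D * normh Om q' ^+ 2 <=
  \sum_(K in cells M) area K * q K ^+ 2 + k * (2 * (Z + B ^+ 2 / (2 * D) * (12 / Creg ^+ 2 * U))).
Proof.
move=> k0 D0 hu hB hq hZ hU.
have hb := convection_bound hu (divr_gt0 D0 (ltr0n _ 2)) hB.
have {}hb : - \sum_(K in cells M) area K * (bh Om u q' K * q' K) <=
    D / 2 * normh Om q' ^+ 2 + B ^+ 2 / (2 * D) * (12 / Creg ^+ 2 * U).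
  apply: (le_trans hb); rewrite lerD2l.
  have -> : 4 * (D / 2) = 2 * D by field.
  apply: ler_wpM2l; first by rewrite divr_ge0 ?sqr_ge0// mulr_ge0// ltW.
  by rewrite ler_pM2l// divr_gt0// exprn_gt0.
have e : \sum_(K in cells M) area K * ((q' K - q K) / k * q' K) + D * normh Om q' ^+ 2 =
    \sum_(K in cells M) area K * (rho K * q' K) - \sum_(K in cells M) area K * (bh Om u q' K * q' K).
  rewrite -[normh _ _ ^+ 2]opprK -laph_test mulrN mulr_sumr -!sumrB.
  apply: eq_bigr => K KM; have := hq K KM => hqK.
  have -> : area K * ((q' K - q K) / k * q' K) - D * (area K * (laph Om q' K * q' K)) =
    area K * (((q' K - q K) / k - D * laph Om q' K) * q' K) by ring.
  by rewrite hqK; ring.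
have t : \sum_(K in cells M) area K * q' K ^+ 2 - \sum_(K in cells M) area K * q K ^+ 2 <=
    2 * k * \sum_(K in cells M) area K * ((q' K - q K) / k * q' K).
  rewrite -sumrB mulr_sumr; apply: ler_sum => K KM.
  have -> : 2 * k * (area K * ((q' K - q K) / k * q' K)) = area K * (2 * ((q' K - q K) * q' K)).
    by field; rewrite gt_eqF.
  by rewrite -mulrBr ler_pM2l ?areaK//; have := sqr_ge0 (q' K - q K); rewrite !expr2; lra.
rewrite -(ler_pM2l k0) in hb; rewrite -(ler_pM2l k0) in hZ.
have {}e := congr1 (fun z => k * z) e; rewrite /= in e.
by move: t hb hZ e; lra.
Qed.

Lemma energy_sum (u : nat -> sx M -> affv R) (q rho : nat -> sx M -> R) (k D B Z U A : R) (N : nat) :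
  0 < k -> 0 < D ->
  (forall n, (n <= N)%N -> RT0 Om (u n)) ->
  (forall n, (n <= N)%N -> forall K, K \in cells M -> `|q n K| <= B) ->
  (forall n, (n < N)%N -> forall K, K \in cells M ->
     (q n.+1 K - q n K) / k - D * laph Om (q n.+1) K = rho n K - bh Om (u n) (q n.+1) K) ->
  (forall n, (n < N)%N -> \sum_(K in cells M) area K * (rho n K * q n.+1 K) <= Z) ->
  (forall n, (n <= N)%N -> ipv Om (RTfun (u n)) (RTfun (u n)) <= U) ->
  \sum_(K in cells M) area K <= A ->
  forall m, (m <= N)%N ->
  D * (k * \sum_(1 <= n < m.+1) normh Om (q n) ^+ 2) <=
  B ^+ 2 * A + m%:R * k * (2 * (Z + B ^+ 2 / (2 * D) * (12 / Creg ^+ 2 * U))).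
Proof.
move=> k0 D0 hu hB hq hZ hU hA.
have [W WE] : exists W, W = 2 * (Z + B ^+ 2 / (2 * D) * (12 / Creg ^+ 2 * U)) by eexists.
have start : \sum_(K in cells M) area K * q 0%N K ^+ 2 <= B ^+ 2 * A.
  apply: (@le_trans _ _ (B ^+ 2 * \sum_(K in cells M) area K)); last first.
    by rewrite ler_wpM2l ?sqr_ge0.
  rewrite mulr_sumr; apply: ler_sum => K KM; rewrite mulrC ler_pM2r ?areaK//.
  have hK := hB 0%N (leq0n _) K KM.
  by rewrite -(real_normK (num_real (q 0%N K))) ler_pXn2r ?nnegrE// (le_trans _ hK).
suff h m : (m <= N)%N -> \sum_(K in cells M) area K * q m K ^+ 2 +
    D * (k * \sum_(1 <= n < m.+1) normh Om (q n) ^+ 2) <= B ^+ 2 * A + m%:R * k * W.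
  move=> m mN; rewrite -WE; apply: le_trans (h m mN); rewrite lerDr sumr_ge0// => K KM.
  by rewrite mulr_ge0 ?sqr_ge0// ltW// areaK.
elim: m => [_|m IH mN]; first by rewrite big_geq// !mulr0 mul0r mul0r !addr0.
rewrite big_nat_recr //= -natr1.
have := energy_step k0 D0 (hu m (ltnW mN)) (hB _ mN) (hq m mN) (hZ m mN) (hU m (ltnW mN)).
rewrite -WE; have := IH (ltnW mN); lra.
Qed.
End Energy.

(** * Bounds for the data and conclusion *)

Section DataBounds.
Variables (R : realType) (d : problem_data R) (M : mesh R).
Notation Om := (Omega d).
Implicit Types (K L sg : sx M) (x y : pt R).
Hypothesis hOm : bounded_polygonal_domain Om.
Hypothesis hM : acute_mesh Om M.

Lemma area_total (r : R) : 0 <= r -> (forall x, closure Om x -> box 0 r x) ->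
  \sum_(K in cells M) area K <= 4 * r ^+ 2.
Proof.
move=> r0 hr.
have [|mU eU] := leb_cells hM (s := enum (cells M)) (enum_uniq _).
  by move=> K; rewrite mem_enum.
have -> : \sum_(K in cells M) area K = \sum_(K <- enum (cells M)) area K by rewrite big_enum.
rewrite -lee_fin -eU -(@leb_box R 0)//.
apply: le_measure; rewrite ?inE//; first exact: measurable_box.
move=> x; rewrite -bigcup_seq => -[K /=]; rewrite mem_enum => KM Kx.
by apply: hr; apply/subset_closure; exact: (osimplex_Om hOm hM KM).
Qed.

Lemma ip_dist (g h : pt R -> R) : sq_integrable Om g -> sq_integrable Om h ->
  ip Om g g <= 2 * ip Om (fun x => g x - h x) (fun x => g x - h x) + 2 * ip Om h h.
Proof.
move=> g2 h2; have mO := measurable_Om hOm hM.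
have d2 := sq_integrableD hOm hM g2 (sq_integrableN h2).
have igg := sq_integrableM hOm hM g2 g2; have ihh := sq_integrableM hOm hM h2 h2.
have idd := sq_integrableM hOm hM d2 d2.
rewrite /ip -!(RintegralZl _ mO)// -RintegralD//; first last.
- exact: (integrableZl mO 2 ihh).
- exact: (integrableZl mO 2 idd).
apply: le_Rintegral => //.
  exact: (integrableD mO (integrableZl mO 2 idd) (integrableZl mO 2 ihh)).
by move=> x _; have := sqr_ge0 ((g x - h x) - h x); rewrite expr2; nra.
Qed.

(** A norm which is locally bounded on the compact interval of time is bounded. *)
Lemma force_bounded : 0 <= Tfin d -> in_C_L2v (Tfin d) Om (force d) ->
  exists2 F : R, 0 <= F & forall t, t \in `[0, Tfin d] -> ipv Om (force d t) (force d t) <= F.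
Proof.
move=> T0 hf.
have ipvd (t t' : R) : t \in `[0, Tfin d] -> t' \in `[0, Tfin d] ->
    ipv Om (force d t') (force d t') <=
    2 * ipv Om (fun x => force d t' x - force d t x) (fun x => force d t' x - force d t x) +
    2 * ipv Om (force d t) (force d t).
  move=> /hf[[/(in_L2_sq_integrable hOm hM) a1 /(in_L2_sq_integrable hOm hM) a2] _].
  move=> /hf[[/(in_L2_sq_integrable hOm hM) b1 /(in_L2_sq_integrable hOm hM) b2] _].
  have d1 := sq_integrableD hOm hM b1 (sq_integrableN a1).
  have d2 := sq_integrableD hOm hM b2 (sq_integrableN a2).
  rewrite !(ipvE hOm hM)//; have := ip_dist b1 a1; have := ip_dist b2 a2 => /=; lra.
have := (compact_near_coveringP _).1 (@segment_compact R 0 (Tfin d)).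
move=> /(_ _ (+oo : set_system R) (fun i t => t \in `[0, Tfin d] -> ipv Om (force d t) (force d t) <= i) _).
case.
- move=> t tT; have [_ /cvgrPdist_lt/(_ 1 ltr01) hn] := hf t tT.
  exists ([set t' | t' \in `[0, Tfin d] -> `|0 - L2normv Om (fun x => force d t' x - force d t x)| < 1],
    [set i : R | 2 + 2 * ipv Om (force d t) (force d t) <= i]).
    by split; [exact: hn|apply: nbhs_pinfty_ge; exact: num_real].
  move=> [t' i] /= [h1 h2] t'T; apply: le_trans (ipvd _ _ tT t'T) _; apply: le_trans h2.
  rewrite lerD2r -[X in _ <= X]mulr1 ler_pM2l//.
  have {}h1 := h1 t'T; rewrite sub0r normrN ger0_norm ?sqrtr_ge0// in h1.
  have v0 : 0 <= ipv Om (fun x => force d t' x - force d t x) (fun x => force d t' x - force d t x).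
    by apply: Rintegral_ge0 => x _; exact: dot_ge0.
  by rewrite -(sqr_sqrtr v0) exprn_ile1 ?sqrtr_ge0// ltW.
move=> x [_ h].
have h1 : x < `|x| + 1 by rewrite (le_lt_trans (ler_norm x))// ltrDl.
exists (`|x| + 1); first by rewrite addr_ge0.
by move=> t tT; exact: (h _ h1 t tT tT).
Qed.

End DataBounds.

(** A Lipschitz function is bounded on the bounded set of values that the discrete
    solutions take. *)
Lemma kappa_bounded (R : realType) (d : problem_data R) : 0 <= thmax d ->
  (exists k : R, k.-lipschitz_(`[0, 1] `*` `[0, +oo[) (kappa d)) ->
  exists B : R, forall c th, 0 <= c <= 1 -> 0 <= th <= thmax d -> kappa d (c, th) <= B.
Proof.
move=> t0 [k hk]; exists (kappa d (0, 0) + `|k| * (1 + thmax d)) => c th /andP[c0 c1] /andP[th0 th1].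
have /= := hk ((c, th), (0, 0)); rewrite !in_itv /= c0 c1 th0 lexx ler01 => h.
have {}h : `|kappa d (c, th) - kappa d (0, 0)| <= k * `|(c, th) - (0, 0) : R * R| by exact: h.
rewrite -lerBlDl; apply: (le_trans (ler_norm _)); apply: (le_trans h).
apply: (le_trans (ler_wpM2r (normr_ge0 _) (ler_norm k))); rewrite ler_wpM2l// subr0.
by rewrite prod_normE /= ge_max !ger0_norm//; apply/andP; split; lra.
Qed.

(** From [`|s| <= s ^+ 2 + 1]. *)
Lemma source_bound (R : realType) (M : mesh R) (s1 s2 f : sx M -> R) (a b S1 S2 A : R)
    (X : {set sx M}) :
  (forall K, K \in X -> 0 < area K) -> 0 <= a -> 0 <= b ->
  (forall K, K \in X -> f K <= a * `|s1 K| + b * `|s2 K|) ->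
  \sum_(K in X) area K * s1 K ^+ 2 <= S1 -> \sum_(K in X) area K * s2 K ^+ 2 <= S2 ->
  \sum_(K in X) area K <= A ->
  \sum_(K in X) area K * f K <= a * (S1 + A) + b * (S2 + A).
Proof.
move=> ar a0 b0 hf h1 h2 hA.
apply: (@le_trans _ _ (\sum_(K in X) (a * (area K * s1 K ^+ 2 + area K) +
    b * (area K * s2 K ^+ 2 + area K)))).
  apply: ler_sum => K KX; have aK := ar K KX.
  have -> : a * (area K * s1 K ^+ 2 + area K) + b * (area K * s2 K ^+ 2 + area K) =
    area K * (a * (s1 K ^+ 2 + 1) + b * (s2 K ^+ 2 + 1)) by ring.
  rewrite ler_pM2l//; apply: (le_trans (hf K KX)).
  have n (s : R) : `|s| <= s ^+ 2 + 1.
    have := sqr_ge0 (`|s| - 1); have := sqr_ge0 s.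
    by rewrite -(real_normK (num_real s)); have := normr_ge0 s; rewrite !expr2; nra.
  by apply: lerD; rewrite ler_wpM2l.
rewrite !big_split /= -!mulr_sumr !big_split /=.
by rewrite !lerD// ler_wpM2l// lerD.
Qed.

(** The reaction term has a favourable sign. *)
Lemma concentration_source (R : realType) (s sc l c : R) : 0 <= l -> 0 <= c -> c <= 1 ->
  (sc - (s + l) * c) * c <= `|sc| + `|s|.
Proof.
move=> l0 c0 c1; have c2 : 0 <= c * c <= 1 by rewrite mulr_ge0//= mulr_ile1.
have /andP[c20 c21] := c2.
have -> : (sc - (s + l) * c) * c = sc * c - s * (c * c) - l * (c * c) by ring.
have lc : 0 <= l * (c * c) by exact: mulr_ge0.
have h1 : sc * c <= `|sc|.
  by apply: (le_trans (ler_norm _)); rewrite normrM (ger0_norm c0) ler_piMr.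
have h2 : - s * (c * c) <= `|s|.
  by apply: (le_trans (ler_norm _)); rewrite normrM normrN (ger0_norm c20) ler_piMr.
by rewrite mulNr in h2; lra.
Qed.

Lemma temperature_source (R : realType) (s sth t ts tM : R) : 0 <= t -> t <= tM -> 0 <= ts ->
  (- sth - s * (t - ts)) * t <= tM * `|sth| + (tM + ts) * tM * `|s|.
Proof.
move=> t0 tt ts0; have tM0 := le_trans t0 tt.
rewrite mulrBl; apply: lerD.
  by apply: (le_trans (ler_norm _)); rewrite normrM normrN mulrC (ger0_norm t0) ler_wpM2r.
apply: (le_trans (ler_norm _)); rewrite normrN.
rewrite (_ : s * (t - ts) * t = (t - ts) * t * s); last by ring.
rewrite normrM ler_wpM2r// normrM.
by rewrite (ger0_norm t0); apply: ler_pM => //; rewrite ler_norml; apply/andP; split; lra.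
Qed.

Theorem proposition6p2 (R : realType) (d : problem_data R) (Creg : R)
    (hd : admissible d) (hCreg : 0 < Creg) :
  exists2 C : R, 0 < C &
    forall (M : mesh R), acute_mesh (Omega d) M ->
      mesh_regular (Omega d) M Creg ->
    forall (N : nat), (0 < N)%N ->
    forall (c th : nat -> sx M -> R) (p : nat -> sx M -> aff R)
      (u : nat -> sx M -> affv R),
      scheme_solution d N c th p u ->
    forall m : nat, (1 <= m <= N)%N ->
      let k := Tfin d / N%:R in
      k * (\sum_(1 <= n < m.+1) normh (Omega d) (c n) ^+ 2) +
      k * (\sum_(1 <= n < m.+1) normh (Omega d) (th n) ^+ 2) <= C /\
      L2normv (Omega d) (RTfun (u m)) +
      L2normv (Omega d) (P0fun (gradh (p m))) <= C.
Proof.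
have hOm := adm_Omega hd; have T0 := adm_T hd; have k0 := adm_kinf hd.
(* An existing mesh makes the domain measurable; without one there is nothing to prove. *)
have [[M0 [hM0 _]]|noM] := pselect (exists M : mesh R,
    acute_mesh (Omega d) M /\ mesh_regular (Omega d) M Creg); last first.
  by exists 1 => // M hM hR; case: noM; exists M.
have tm0 := adm_thmin hd; have tmM := adm_thmax hd; have ts0 := adm_thstar hd.
have tM0 : 0 <= thmax d by rewrite (le_trans _ tmM)// ltW.
have [r r0 hr] := domain_bounded hOm.
have [CP CP0 hPoincare] := poincare hOm hCreg.
have [F F0 hF] := force_bounded hOm hM0 (ltW T0) (adm_force hd).
have [kmax hkmax] := kappa_bounded tM0 (adm_kappa_lip hd).
have [S SE] : exists S, S = ip (Omega d) (src d) (src d) by eexists.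
have [Sc ScE] : exists S, S = ip (Omega d) (srcc d) (srcc d) by eexists.
have [Sth SthE] : exists S, S = ip (Omega d) (srcth d) (srcth d) by eexists.
have S0 : 0 <= S by rewrite SE ip_ge0.
have Sc0 : 0 <= Sc by rewrite ScE ip_ge0.
have Sth0 : 0 <= Sth by rewrite SthE ip_ge0.
have [A AE] : exists A, A = 4 * r ^+ 2 by eexists.
have A0 : 0 <= A by rewrite AE mulr_ge0// sqr_ge0.
(* [G] bounds the gradient energies and [U] the squared norms of the velocities. *)
have [G GE] : exists G, G = 2^-1 + 2 * F / kinf d ^+ 2 + 2 * S * (CP + 1) / kinf d ^+ 2 by eexists.
have ki0 : 0 <= (kinf d ^+ 2)^-1 by rewrite invr_ge0 sqr_ge0.
have G0 : 0 <= G.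
  rewrite GE; apply: addr_ge0; first by rewrite addr_ge0 ?invr_ge0// mulr_ge0// mulr_ge0.
  by rewrite mulr_ge0// mulr_ge0 ?addr_ge0// mulr_ge0.
have [U UE] : exists U, U = 2 * F + 2 * kmax ^+ 2 * G by eexists.
have U0 : 0 <= U by rewrite UE addr_ge0 ?(mulr_ge0 _ F0)// mulr_ge0// mulr_ge0// sqr_ge0.
have bconv B D : 0 < D -> 0 <= B ^+ 2 / (2 * D) * (12 / Creg ^+ 2 * U).
  move=> D0; apply: mulr_ge0; first by rewrite divr_ge0 ?sqr_ge0// mulr_ge0// ltW.
  by rewrite mulr_ge0// divr_ge0// sqr_ge0.
(* [Zc] and [Zt] bound the sources tested with the solution, [Wc] and [Wt] the
   increase of the energies per unit of time, [Ec] and [Et] the Dirichlet norms. *)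
have [Zc ZcE] : exists Z, Z = 1 * (Sc + A) + 1 * (S + A) by eexists.
have Zc0 : 0 <= Zc by rewrite ZcE !mul1r !addr_ge0.
have b0 : 0 <= (thmax d + thstar d) * thmax d by rewrite mulr_ge0// addr_ge0// ltW.
have [Zt ZtE] : exists Z, Z = thmax d * (Sth + A) + (thmax d + thstar d) * thmax d * (S + A).
  by eexists.
have Zt0 : 0 <= Zt by rewrite ZtE addr_ge0// mulr_ge0// addr_ge0.
have [Wc WcE] : exists W, W = 2 * (Zc + 1 ^+ 2 / (2 * Dc d) * (12 / Creg ^+ 2 * U)) by eexists.
have Wc0 : 0 <= Wc by rewrite WcE mulr_ge0// addr_ge0// bconv// (adm_Dc hd).
have [Wt WtE] : exists W, W = 2 * (Zt + thmax d ^+ 2 / (2 * Dth d) * (12 / Creg ^+ 2 * U)).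
  by eexists.
have Wt0 : 0 <= Wt by rewrite WtE mulr_ge0// addr_ge0// bconv// (adm_Dth hd).
have [Ec EcE] : exists E, E = (1 ^+ 2 * A + Tfin d * Wc) / Dc d by eexists.
have Ec0 : 0 <= Ec.
  by rewrite EcE divr_ge0 ?(ltW (adm_Dc hd))// addr_ge0 ?mulr_ge0 ?sqr_ge0// ltW.
have [Et EtE] : exists E, E = (thmax d ^+ 2 * A + Tfin d * Wt) / Dth d by eexists.
have Et0 : 0 <= Et.
  by rewrite EtE divr_ge0 ?(ltW (adm_Dth hd))// addr_ge0 ?mulr_ge0 ?sqr_ge0// ltW.
exists (1 + Ec + Et + Num.sqrt U + Num.sqrt G).
  by rewrite -!addrA ltr_pwDl// !addr_ge0 ?sqrtr_ge0.
move=> M hM hR N N0 c th p u [_ _ hc hth [sh [sch [sth [fh]]]]].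
cbv zeta; set k := Tfin d / N%:R; move=> [[psh psch psth pfh] eqc eqt eqf].
have NR : 0 < N%:R :> R by rewrite ltr0n.
have kp : 0 < k by rewrite divr_gt0.
have areaM K : K \in cells M -> 0 < area K.
  by move=> KM; apply: area_gt0; exact: (cell_triangular hM KM).
have mT m : (m <= N)%N -> m%:R * k <= Tfin d.
  move=> mN; rewrite /k mulrCA -[leRHS]mulr1 ler_pM2l// ler_pdivrMr// mul1r ler_nat//.
have hS := proj_P0_norm hOm hM (adm_src hd) psh; rewrite -SE in hS.
have hSc := proj_P0_norm hOm hM (adm_srcc hd) psch; rewrite -ScE in hSc.
have hSth := proj_P0_norm hOm hM (adm_srcth hd) psth; rewrite -SthE in hSth.
have hA := area_total hOm hM (ltW r0) hr; rewrite -AE in hA.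
have flow m : (m <= N)%N -> [/\ RT0 (Omega d) (u m), grad_energy (p m) <= G &
    ipv (Omega d) (RTfun (u m)) (RTfun (u m)) <= U].
  move=> mN; have [hp hu] := eqf m mN.
  have tm : m%:R * k \in `[0, Tfin d] by rewrite in_itv /= mT// mulr_ge0// ltW.
  have hf := proj_P0v_norm hOm hM (adm_force hd tm).1 (pfh m mN).
  have {}hf := le_trans hf (hF _ tm).
  have kb K : K \in cells M -> kinf d <= kappah d (c m) (th m) K <= kmax.
    move=> KM; have cK := hc m mN K KM; have /andP[t1 t2] := hth m mN K KM.
    have tK : 0 <= th m K by rewrite (le_trans (ltW tm0)).
    apply/andP; split; last by apply: hkmax => //; rewrite tK.
    by apply: (adm_kappa_inf hd); split; rewrite /= in_itv /= ?andbT.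
  have hG : grad_energy (p m) <= G.
    have [p1 p0 _] := hp; rewrite GE.
    apply: (pressure_bound hOm hM CP0 k0 _ hp hf hS (hPoincare M hM hR _ p1 p0)).
    by move=> K /kb/andP[].
  split=> //; first by have [] := hu.
  have kb' K : K \in cells M -> 0 <= kappah d (c m) (th m) K <= kmax.
    by move=> /kb/andP[h1 ->]; rewrite (le_trans (ltW k0) h1).
  apply: (le_trans (velocity_bound hOm hM kb' hu hf)).
  by rewrite UE lerD2l ler_wpM2l// mulr_ge0// sqr_ge0.
move=> m /andP[m1 mN]; split; last first.
  have [_ hG hU] := flow m mN.
  have -> : L2normv (Omega d) (P0fun (gradh (p m))) = Num.sqrt (grad_energy (p m)).
    by rewrite /L2normv (ipv_P0 hOm hM).
  have h1 : L2normv (Omega d) (RTfun (u m)) <= Num.sqrt U by exact: ler_wsqrtr.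
  by have := ler_wsqrtr hG; lra.
have bc n : (n <= N)%N -> forall K, K \in cells M -> `|c n K| <= 1.
  by move=> nN K KM; have /andP[c0 c1] := hc n nN K KM; rewrite ger0_norm.
have bt n : (n <= N)%N -> forall K, K \in cells M -> 0 <= th n K /\ `|th n K| <= thmax d.
  move=> nN K KM; have /andP[t1 t2] := hth n nN K KM.
  have t3 : 0 <= th n K by rewrite (le_trans (ltW tm0)).
  by rewrite ger0_norm.
have uRT n : (n <= N)%N -> RT0 (Omega d) (u n) by move=> /flow[].
have uU n : (n <= N)%N -> ipv (Omega d) (RTfun (u n)) (RTfun (u n)) <= U by move=> /flow[].
have eqc' n : (n < N)%N -> forall K, K \in cells M ->
    (c n.+1 K - c n K) / k - Dc d * laph (Omega d) (c n.+1) K =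
    (sch K - (sh K + lam d) * c n.+1 K) - bh (Omega d) (u n) (c n.+1) K := eqc n.
have hEc : k * (\sum_(1 <= n < m.+1) normh (Omega d) (c n) ^+ 2) <= Ec.
  rewrite EcE ler_pdivlMr ?(adm_Dc hd)// mulrC.
  apply: (le_trans (energy_sum hOm hM hCreg hR (Z := Zc) kp (adm_Dc hd) uRT bc eqc' _ uU hA mN));
    last by rewrite -WcE lerD2l ler_wpM2r// mT.
  move=> n nN; rewrite ZcE; apply: (source_bound areaM) hSc hS hA => // K KM.
  have /andP[c0 c1] := hc _ nN _ KM; have l0 := adm_lam hd; rewrite !mul1r.
  by apply: concentration_source => //; exact: ltW.
have hEt : k * (\sum_(1 <= n < m.+1) normh (Omega d) (th n) ^+ 2) <= Et.
  rewrite EtE ler_pdivlMr ?(adm_Dth hd)// mulrC.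
  have bt' n : (n <= N)%N -> forall K, K \in cells M -> `|th n K| <= thmax d.
    by move=> nN K KM; have [] := bt n nN K KM.
  have eqt' n : (n < N)%N -> forall K, K \in cells M ->
      (th n.+1 K - th n K) / k - Dth d * laph (Omega d) (th n.+1) K =
      (- sth K - sh K * (th n.+1 K - thstar d)) - bh (Omega d) (u n) (th n.+1) K := eqt n.
  apply: (le_trans (energy_sum hOm hM hCreg hR (Z := Zt) kp (adm_Dth hd) uRT bt' eqt' _ uU hA mN));
    last by rewrite -WtE lerD2l ler_wpM2r// mT.
  move=> n nN; rewrite ZtE; apply: (source_bound areaM) hSth hS hA => // K KM.
  have [t0 tK] := bt _ nN _ KM.
  by apply: temperature_source => //; [rewrite -(ger0_norm t0)|exact: ltW].
by have := sqrtr_ge0 U; have := sqrtr_ge0 G; lra.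
Qed.
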